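(* Let $k\in\mathbb{Z}$. The $osp(2n|2m)$-module $\mathcal{H}_{\langle k\rangle}$ is irreducible if and only if $k\leq n_1+m+1-n_2$. When $k\leq n_1+m+1-n_2$, $\mathcal{A}_{\langle k\rangle}=\bigoplus_{i=0}^\infty\eta^i(\mathcal{H}_{\langle k-2i\rangle})$ is the decomposition of $\mathcal{A}_{\langle k\rangle}$ into irreducible $osp(2n|2m)$-submodules.
   Context: Fix positive integers $n,m$ and integers $n_1,n_2$ with $1\le n_1$, $n_1+1<n_2\le n$. Let $\mathcal{A}$ be the complex supercommutative polynomial algebra in even variables $x_1,\dots,x_n,y_1,\dots,y_n$ and odd variables $\theta_1,\dots,\theta_m,\vartheta_1,\dots,\vartheta_m$, with partial derivatives $\partial_{x_i},\partial_{y_i}$ and odd derivations $\partial_{\theta_r},\partial_{\vartheta_r}$ (super Leibniz rule). Consider first the representation $\rho$ of $osp(2n|2m)\subset gl(2n|2m)$ (indices $1..2n$ even, $2n+1..2n+2m$ odd) on $\mathcal{A}$ given on a spanning set by ($i,j\in\{1..n\}$, $r,s\in\{1..m\}$): $E_{i,j}-E_{n+j,n+i}\mapsto x_i\partial_{x_j}-y_j\partial_{y_i}$; $E_{2n+r,2n+s}-E_{2n+m+s,2n+m+r}\mapsto\theta_r\partial_{\theta_s}-\vartheta_s\partial_{\vartheta_r}$; $E_{i,2n+r}-E_{2n+m+r,n+i}\mapsto x_i\partial_{\theta_r}-\vartheta_r\partial_{y_i}$; $E_{2n+r,i}+E_{n+i,2n+m+r}\mapsto\theta_r\partial_{x_i}+y_i\partial_{\vartheta_r}$;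 ($i<j$) $E_{i,n+j}-E_{j,n+i}\mapsto x_i\partial_{y_j}-x_j\partial_{y_i}$, $E_{n+i,j}-E_{n+j,i}\mapsto y_i\partial_{x_j}-y_j\partial_{x_i}$; ($r\le s$) $E_{2n+m+r,2n+s}+E_{2n+m+s,2n+r}\mapsto\vartheta_r\partial_{\theta_s}+\vartheta_s\partial_{\theta_r}$, $E_{2n+r,2n+m+s}+E_{2n+s,2n+m+r}\mapsto\theta_r\partial_{\vartheta_s}+\theta_s\partial_{\vartheta_r}$; $E_{i,2n+m+r}+E_{2n+r,n+i}\mapsto x_i\partial_{\vartheta_r}+\theta_r\partial_{y_i}$; $E_{n+i,2n+r}-E_{2n+m+r,i}\mapsto y_i\partial_{\theta_r}-\vartheta_r\partial_{x_i}$. Let $\sigma$ be the automorphism of the algebra of polynomial-coefficient differential operators on $\mathcal{A}$ with $\sigma(x_r)=\partial_{x_r}$, $\sigma(\partial_{x_r})=-x_r$ for $r\le n_1$, $\sigma(y_s)=\partial_{y_s}$, $\sigma(\partial_{y_s})=-y_s$ for $s>n_2$, fixing all other generators (operators are composed in the order written; e.g. $x_i\partial_{x_j}$ with $i,j\le n_1$ becomes $-x_j\partial_{x_i}-\delta_{i,j}$). The representation considered is $\xi\mapsto\sigma(\rho(\xi))$. Let $\Delta=-\sum_{i=1}^{n_1}x_i\partial_{y_i}+\sum_{r=n_1+1}^{n_2}\partial_{x_r}\partial_{y_r}-\sum_{s=n_2+1}^ny_s\partial_{x_s}+\sum_{r=1}^m\partial_{\theta_r}\partial_{\vartheta_r}$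 and $\eta=\sum_{i=1}^{n_1}y_i\partial_{x_i}+\sum_{r=n_1+1}^{n_2}x_ry_r+\sum_{s=n_2+1}^nx_s\partial_{y_s}+\sum_{r=1}^m\theta_r\vartheta_r$ (operators). For $k\in\mathbb{Z}$, $\mathcal{A}_{\langle k\rangle}$ is the span of monomials $x^\alpha y^\beta\theta_{i_1}\cdots\theta_{i_a}\vartheta_{j_1}\cdots\vartheta_{j_b}$ with $\sum_{r=n_1+1}^n\alpha_r-\sum_{i=1}^{n_1}\alpha_i+\sum_{i=1}^{n_2}\beta_i-\sum_{r=n_2+1}^n\beta_r+a+b=k$, and $\mathcal{H}_{\langle k\rangle}=\{f\in\mathcal{A}_{\langle k\rangle}\mid\Delta(f)=0\}$. *)

(* Defs.v *)
From HB Require Import structures.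
From mathcomp Require Import all_boot all_order all_algebra.
Import Order.TTheory GRing.Theory Num.Theory.
Local Open Scope ring_scope.

Section SuperPoly.
Variables (C : numClosedFieldType) (n m : nat).

(* A monomial x^alpha y^beta theta_S vartheta_T, where the odd part is the
   ordered product theta_{i1}...theta_{ia} vartheta_{j1}...vartheta_{jb}
   with i1<...<ia (elements of SS) and j1<...<jb (elements of TT).
   Indices are 0-based: 'I_n index i stands for variable number i+1. *)
Definition mon : Type :=
  ({ffun 'I_n -> nat} * {ffun 'I_n -> nat} * {set 'I_m} * {set 'I_m})%type.

(* Elements of the ambient space: coefficient functions; the superalgebra
   A consists of those with finite support (is_poly). *)
Definition fn := mon -> C.

Definition is_poly (f : fn) : Prop :=
  exists s : seq mon, forall mu, mu \notin s -> f mu = 0.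

Definition fzero : fn := fun _ => 0.
Definition fadd (f g : fn) : fn := fun mu => f mu + g mu.
Definition fsub (f g : fn) : fn := fun mu => f mu - g mu.
Definition fopp (f : fn) : fn := fun mu => - f mu.
Definition fscale (c : C) (f : fn) : fn := fun mu => c * f mu.

Definition incr (a : {ffun 'I_n -> nat}) (i : 'I_n) : {ffun 'I_n -> nat} :=
  [ffun j => if j == i then (a j).+1 else a j].
Definition decr (a : {ffun 'I_n -> nat}) (i : 'I_n) : {ffun 'I_n -> nat} :=
  [ffun j => if j == i then (a j).-1 else a j].

Definition sgn (k : nat) : C := (-1) ^+ k.

Definition below (SS : {set 'I_m}) (r : 'I_m) : nat :=
  #|[set s in SS | (s < r)%N]|.

Definition mulx (i : 'I_n) (f : fn) : fn := fun mu =>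
  let: (a, b, SS, TT) := mu in if (0 < a i)%N then f (decr a i, b, SS, TT) else 0.
Definition muly (i : 'I_n) (f : fn) : fn := fun mu =>
  let: (a, b, SS, TT) := mu in if (0 < b i)%N then f (a, decr b i, SS, TT) else 0.
Definition dx (i : 'I_n) (f : fn) : fn := fun mu =>
  let: (a, b, SS, TT) := mu in ((a i).+1)%:R * f (incr a i, b, SS, TT).
Definition dy (i : 'I_n) (f : fn) : fn := fun mu =>
  let: (a, b, SS, TT) := mu in ((b i).+1)%:R * f (a, incr b i, SS, TT).

Definition multh (r : 'I_m) (f : fn) : fn := fun mu =>
  let: (a, b, SS, TT) := mu in
  if r \in SS then sgn (below SS r) * f (a, b, SS :\ r, TT) else 0.
Definition mulvt (r : 'I_m) (f : fn) : fn := fun mu =>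
  let: (a, b, SS, TT) := mu in
  if r \in TT then sgn (#|SS| + below TT r) * f (a, b, SS, TT :\ r) else 0.
(* odd (left) derivations, super Leibniz rule *)
Definition dth (r : 'I_m) (f : fn) : fn := fun mu =>
  let: (a, b, SS, TT) := mu in
  if r \notin SS then sgn (below SS r) * f (a, b, r |: SS, TT) else 0.
Definition dvt (r : 'I_m) (f : fn) : fn := fun mu =>
  let: (a, b, SS, TT) := mu in
  if r \notin TT then sgn (#|SS| + below TT r) * f (a, b, SS, r |: TT) else 0.

Variables (n1 n2 : nat).

(* images under the automorphism sigma of the even generators
   (0-based: variable i+1 <= n1 iff i < n1; i+1 > n2 iff n2 <= i) *)
Definition sx (i : 'I_n) : fn -> fn :=
  if (i < n1)%N then dx i else mulx i.
Definition sdx (i : 'I_n) : fn -> fn :=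
  if (i < n1)%N then (fun f => fopp (mulx i f)) else dx i.
Definition sy (i : 'I_n) : fn -> fn :=
  if (n2 <= i)%N then dy i else muly i.
Definition sdy (i : 'I_n) : fn -> fn :=
  if (n2 <= i)%N then (fun f => fopp (muly i f)) else dy i.

(* the operators sigma(rho(xi)) for xi in the given spanning set of osp(2n|2m) *)
Definition ospgen (T : fn -> fn) : Prop :=
     (exists i j : 'I_n, T = fun f => fsub (sx i (sdx j f)) (sy j (sdy i f)))
  \/ (exists r s : 'I_m, T = fun f => fsub (multh r (dth s f)) (mulvt s (dvt r f)))
  \/ (exists (i : 'I_n) (r : 'I_m), T = fun f => fsub (sx i (dth r f)) (mulvt r (sdy i f)))
  \/ (exists (i : 'I_n) (r : 'I_m), T = fun f => fadd (multh r (sdx i f)) (sy i (dvt r f)))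
  \/ (exists i j : 'I_n, (i < j)%N /\ T = fun f => fsub (sx i (sdy j f)) (sx j (sdy i f)))
  \/ (exists i j : 'I_n, (i < j)%N /\ T = fun f => fsub (sy i (sdx j f)) (sy j (sdx i f)))
  \/ (exists r s : 'I_m, (r <= s)%N /\ T = fun f => fadd (mulvt r (dth s f)) (mulvt s (dth r f)))
  \/ (exists r s : 'I_m, (r <= s)%N /\ T = fun f => fadd (multh r (dvt s f)) (multh s (dvt r f)))
  \/ (exists (i : 'I_n) (r : 'I_m), T = fun f => fadd (sx i (dvt r f)) (multh r (sdy i f)))
  \/ (exists (i : 'I_n) (r : 'I_m), T = fun f => fsub (sy i (dth r f)) (mulvt r (sdx i f))).

Definition is_submod (W : fn -> Prop) : Prop :=
  W fzero /\ (forall f g, W f -> W g -> W (fadd f g)) /\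
  (forall c f, W f -> W (fscale c f)) /\
  (forall T, ospgen T -> forall f, W f -> W (T f)).

Definition irreducible (V : fn -> Prop) : Prop :=
  is_submod V /\ (exists f, V f /\ exists mu, f mu != 0) /\
  forall W, is_submod W -> (forall f, W f -> V f) ->
    (forall f, W f -> forall mu, f mu = 0) \/ (forall f, V f -> W f).

Definition deg (mu : mon) : int :=
  let: (a, b, SS, TT) := mu in
  \sum_(i < n | (n1 <= i)%N) (a i)%:Z - \sum_(i < n | (i < n1)%N) (a i)%:Z
  + \sum_(i < n | (i < n2)%N) (b i)%:Z - \sum_(i < n | (n2 <= i)%N) (b i)%:Z
  + (#|SS|)%:Z + (#|TT|)%:Z.

Definition Ak (k : int) (f : fn) : Prop :=
  is_poly f /\ forall mu, f mu != 0 -> deg mu = k.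

Definition Delta (f : fn) : fn := fun mu =>
  - (\sum_(i < n | (i < n1)%N) mulx i (dy i f) mu)
  + \sum_(i < n | (n1 <= i < n2)%N) dx i (dy i f) mu
  - \sum_(i < n | (n2 <= i)%N) muly i (dx i f) mu
  + \sum_(r < m) dth r (dvt r f) mu.

Definition eta (f : fn) : fn := fun mu =>
  \sum_(i < n | (i < n1)%N) muly i (dx i f) mu
  + \sum_(i < n | (n1 <= i < n2)%N) mulx i (muly i f) mu
  + \sum_(i < n | (n2 <= i)%N) mulx i (dy i f) mu
  + \sum_(r < m) multh r (mulvt r f) mu.

Definition Hk (k : int) (f : fn) : Prop :=
  Ak k f /\ forall mu, Delta f mu = 0.

Definition eta_img (i : nat) (V : fn -> Prop) (g : fn) : Prop :=
  exists f, V f /\ g = iter i eta f.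

End SuperPoly.

(* Main.v *)
(* The transformed generators still satisfy the super Weyl relations, so Delta and eta
   commute with osp(2n|2m) and [Delta, eta] acts on A_<k> as k + kappa, where
   kappa = n2 - n1 - m.  For k + kappa <= 1 the resulting coefficients of
   Delta^i eta^i on H_<k-2i> never vanish, and since Delta is locally nilpotent this
   gives A_<k> = H_<k> (+) eta A_<k-2> and the whole decomposition.

   Irreducibility: call x_i (i <= n1) and y_i (i > n2) the variables u, their partners v,
   and all others middle.  Some positive operators lower a bounded-below weight, so
   every nonzero submodule of H_<k> contains a vector f they all kill.  Summing
   u_i (d/du_i d/dr - r' d/dv_i) f = 0 over i, with r' the partner of a middle variable
   r, expresses (deg_u)(d/dr f) as r' g, g the middle Laplacian of f; applying the
   derivative along r' and summing over r pins down a degree of g which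
   k + kappa <= 1 forbids.  Hence g = 0, and the same argument once more, with the middle
   x in place of u, leaves only f = c u_1^(-k) (k <= 0) or f = c x_(n1+1)^k (k > 0).
   Every nonzero submodule thus contains the same monomial.  A monomial-diagonal
   contravariant form, for which Delta and eta are adjoint, turns a proper submodule W
   into the nonzero submodule (W + eta A_<k-2>)^perp of H_<k>; both would contain
   that monomial, which is not isotropic.

   For d = k + kappa - 1 > 0, eta^d maps H_<k-2d> injectively into H_<k>,
   and its image misses the same monomial, so H_<k> is reducible. *)

Require Import Defs.
From HB Require Import structures.
From mathcomp Require Import all_boot all_order all_algebra.
From mathcomp Require Import boolp functions ring zify.
Import Order.TTheory GRing.Theory Num.Theory.
Local Open Scope ring_scope.

(** * Operators and their commutation relations *)

(** Irreducibility cannot come from definiteness: the form is bilinear and its weights change sign,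
    so [W] and its orthogonal might meet. Uniqueness of the singular vector replaces positivity.
    Finite dimension is missing as well: A_<k> is infinite-dimensional, because the degree counts
    the u's negatively, so a proper subspace need not have a non-zero orthogonal. The remedy is a
    second grading, by the degree in all outer variables. Up to a shift it is the eigenvalue of an
    element of osp(2n|2m), so every submodule is graded by it, and its levels inside A_<k> are
    finite-dimensional; there orthogonals are plain linear algebra. The sl2 side rests on one
    factor: Delta sends eta^(j+1) h, for h in H_<l>, to (j+1)(l + kappa + j) eta^j h. For l = k - 2i
    and j < i the factor is negative once k + kappa <= 1; its zero at l = k - 2d, j = d - 1 is the
    source of the submodule in the reducible range. *)

Section Exterior.
Variables (C : numClosedFieldType) (m : nat).
Implicit Types (g : {set 'I_m} -> C) (S : {set 'I_m}) (r s : 'I_m).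

(** Creation and annihilation on a single exterior algebra. The theta operators are these verbatim,
    the vartheta operators up to a sign depending only on the theta part ([mulvtE], [dvtE]). *)
Definition emul r g S : C := if r \in S then sgn C (below m S r) * g (S :\ r) else 0.
Definition eder r g S : C := if r \notin S then sgn C (below m S r) * g (r |: S) else 0.

Lemma belowU1 S r s : s \notin S -> below m (s |: S) r = ((s < r) + below m S r)%N.
Proof.
move=> sS; rewrite /below; case: ltnP => sr.
  rewrite (_ : [set _ in _ | _] = s |: [set t in S | (t < r)%N]).
    by rewrite cardsU1 inE (negbTE sS).
  by apply/setP => t; rewrite !inE; case: eqVneq => // ->; rewrite sr.
congr #|pred_of_set _|; apply/setP => t; rewrite !inE; case: eqVneq => // ->.
by rewrite (negbTE sS) ltnNge sr.
Qed.

Lemma belowD1 S r s : s \in S -> below m S r = ((s < r) + below m (S :\ s) r)%N.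
Proof. by move=> sS; rewrite -{1}(setD1K sS) belowU1 // !inE eqxx. Qed.

Lemma belowU1_id S r : below m (r |: S) r = below m S r.
Proof.
case: (boolP (r \in S)) => [rS | /belowU1->]; last by rewrite ltnn.
by rewrite (setUidPr _) // sub1set.
Qed.

Lemma belowD1_id S r : below m (S :\ r) r = below m S r.
Proof.
case: (boolP (r \in S)) => [/belowD1-> | rS]; first by rewrite ltnn.
by congr (below m _ r); apply/setDidPl; rewrite disjoint_sym disjoints1.
Qed.

Lemma setU1D1 S r s : r != s -> (r |: S) :\ s = r |: (S :\ s).
Proof.
by move=> ns; apply/setP => t; rewrite !inE; case: (eqVneq t r) => // ->; rewrite ns.
Qed.

Lemma sgnD k l : sgn C (k + l) = sgn C k * sgn C l.
Proof. exact: exprD. Qed.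

Lemma sgn_mul k : sgn C k * sgn C k = 1.
Proof. by rewrite -expr2 sqrr_sign. Qed.

Lemma sgnS k : sgn C k.+1 = - sgn C k.
Proof. by rewrite /sgn exprS mulN1r. Qed.

Lemma sgn_ltn r s : r != s -> sgn C (r < s)%N = - sgn C (s < r)%N.
Proof. by rewrite /sgn -val_eqE /=; case: ltngtP => //; rewrite expr0 expr1 ?opprK. Qed.

(** Of two distinct indices exactly one lies below the other, so exactly one of the two orders picks
    up an extra position count; [sgn_ltn] records this single sign. *)
Lemma emul_anti r s g S : emul r (emul s g) S = - emul s (emul r g) S.
Proof.
rewrite /emul !inE; have [-> | ns] := eqVneq r s.
  by rewrite ?eqxx /= !mulr0 if_same oppr0.
case rS: (r \in S); case sS: (s \in S); rewrite ?mulr0 ?oppr0 //=.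
rewrite (belowD1 _ _ _ sS) (belowD1 S s r rS) !sgnD (sgn_ltn _ _ ns) setDDl setUC -setDDl.
ring.
Qed.

Lemma eder_anti r s g S : eder r (eder s g) S = - eder s (eder r g) S.
Proof.
rewrite /eder !inE; have [-> | ns] := eqVneq r s.
  by rewrite ?eqxx /= !mulr0 if_same oppr0.
case rS: (r \in S); case sS: (s \in S); rewrite ?mulr0 ?oppr0 //=.
rewrite (belowU1 S s r) ?rS // (belowU1 S r s) ?sS // !sgnD (sgn_ltn _ _ ns) setUCA.
ring.
Qed.

Lemma eder_emul r s g S :
  eder r (emul s g) S = (if r == s then g S else 0) - emul s (eder r g) S.
Proof.
rewrite /eder /emul !inE; have [<- | ns] := eqVneq r s.
  rewrite ?eqxx /=; case: (boolP (r \in S)) => rS /=; last first.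
    by rewrite subr0 belowU1_id mulrA sgn_mul mul1r setU1K.
  rewrite setD1K // (belowD1 _ _ _ rS) ltnn add0n mulrA sgn_mul mul1r.
  by rewrite subrr.
rewrite sub0r.
case rS: (r \in S); case sS: (s \in S); rewrite ?mulr0 ?oppr0 //=.
rewrite (belowU1 S s r) ?rS // (belowD1 S r s sS) !sgnD (sgn_ltn _ _ ns) setU1D1 //.
ring: (sgn_mul (s < r)%N).
Qed.

End Exterior.

(** * The module of coefficient functions and linearity of the generators *)

Section LinearStructure.
Variables (C : numClosedFieldType) (n m : nat).
(** Copying the function module over [C^o] makes the given pointwise operations convertible to the
    module ones, which is why the bridging equations below hold by computation. *)
HB.instance Definition _ := GRing.Lmodule.copy (fn C n m) (mon n m -> (C : pzRingType)^o).

Lemma faddE (f g : fn C n m) : fadd C n m f g = f + g. Proof. by []. Qed.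
Lemma fsubE (f g : fn C n m) : fsub C n m f g = f - g. Proof. by []. Qed.
Lemma foppE (f : fn C n m) : fopp C n m f = - f. Proof. by []. Qed.
Lemma fscaleE c (f : fn C n m) : fscale C n m c f = c *: f. Proof. by []. Qed.
Lemma fzeroE : fzero C n m = 0. Proof. by []. Qed.

Lemma fnD (f g : fn C n m) mu : (f + g) mu = f mu + g mu. Proof. by []. Qed.
Lemma fnN (f : fn C n m) mu : (- f) mu = - f mu. Proof. by []. Qed.
Lemma fnZ c (f : fn C n m) mu : (c *: f) mu = c * f mu. Proof. by []. Qed.
Lemma fn0 mu : (0 : fn C n m) mu = 0. Proof. by []. Qed.
Lemma fn_sum I (r : seq I) (P : pred I) (F : I -> fn C n m) mu :
  (\sum_(i <- r | P i) F i) mu = \sum_(i <- r | P i) F i mu.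
Proof. by elim/big_rec2: _ => // i y x _ <-. Qed.

End LinearStructure.

Ltac lin_tac := rewrite /mulx /muly /dx /dy /multh /mulvt /dth /dvt => c f g;
  apply/funext => -[[[a b] S] T] /=; rewrite !fnD !fnZ; try case: ifP => // _; ring.

Section Linear.
Variables (C : numClosedFieldType) (n m : nat) (i : 'I_n) (r : 'I_m).

Fact mulx_linear : linear (mulx C n m i). Proof. lin_tac. Qed.
Fact muly_linear : linear (muly C n m i). Proof. lin_tac. Qed.
Fact dx_linear : linear (dx C n m i). Proof. lin_tac. Qed.
Fact dy_linear : linear (dy C n m i). Proof. lin_tac. Qed.
Fact multh_linear : linear (multh C n m r). Proof. lin_tac. Qed.
Fact mulvt_linear : linear (mulvt C n m r). Proof. lin_tac. Qed.
Fact dth_linear : linear (dth C n m r). Proof. lin_tac. Qed.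
Fact dvt_linear : linear (dvt C n m r). Proof. lin_tac. Qed.
HB.instance Definition _ := GRing.isLinear.Build C (fn C n m) (fn C n m) *:%R _ mulx_linear.
HB.instance Definition _ := GRing.isLinear.Build C (fn C n m) (fn C n m) *:%R _ muly_linear.
HB.instance Definition _ := GRing.isLinear.Build C (fn C n m) (fn C n m) *:%R _ dx_linear.
HB.instance Definition _ := GRing.isLinear.Build C (fn C n m) (fn C n m) *:%R _ dy_linear.
HB.instance Definition _ := GRing.isLinear.Build C (fn C n m) (fn C n m) *:%R _ multh_linear.
HB.instance Definition _ := GRing.isLinear.Build C (fn C n m) (fn C n m) *:%R _ mulvt_linear.
HB.instance Definition _ := GRing.isLinear.Build C (fn C n m) (fn C n m) *:%R _ dth_linear.
HB.instance Definition _ := GRing.isLinear.Build C (fn C n m) (fn C n m) *:%R _ dvt_linear.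

Variables n1 n2 : nat.
Fact sx_linear : linear (sx C n m n1 i).
Proof. by move=> c f g; rewrite /sx; case: ifP => _; rewrite linearP. Qed.
Fact sdx_linear : linear (sdx C n m n1 i).
Proof. by move=> c f g; rewrite /sdx; case: ifP => _; rewrite ?foppE linearP // opprD scalerN. Qed.
Fact sy_linear : linear (sy C n m n2 i).
Proof. by move=> c f g; rewrite /sy; case: ifP => _; rewrite linearP. Qed.
Fact sdy_linear : linear (sdy C n m n2 i).
Proof. by move=> c f g; rewrite /sdy; case: ifP => _; rewrite ?foppE linearP // opprD scalerN. Qed.
HB.instance Definition _ := GRing.isLinear.Build C (fn C n m) (fn C n m) *:%R _ sx_linear.
HB.instance Definition _ := GRing.isLinear.Build C (fn C n m) (fn C n m) *:%R _ sdx_linear.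
HB.instance Definition _ := GRing.isLinear.Build C (fn C n m) (fn C n m) *:%R _ sy_linear.
HB.instance Definition _ := GRing.isLinear.Build C (fn C n m) (fn C n m) *:%R _ sdy_linear.
End Linear.

(** * Exponent vectors *)

Section Exponents.
Variable n : nat.
Implicit Types (a : {ffun 'I_n -> nat}) (i j : 'I_n).

Lemma incrE a i j : incr n a i j = (a j + (j == i))%N.
Proof. by rewrite ffunE; case: eqP => _; rewrite ?addn1 ?addn0. Qed.
Lemma decrE a i j : decr n a i j = (a j - (j == i))%N.
Proof. by rewrite ffunE; case: eqP => _; rewrite ?subn1 ?subn0. Qed.
Lemma incrK a i : decr n (incr n a i) i = a.
Proof. by apply/ffunP => j; rewrite decrE incrE addnK. Qed.
Lemma decrK a i : (0 < a i)%N -> incr n (decr n a i) i = a.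
Proof.
by move=> ai; apply/ffunP => j; rewrite incrE decrE; case: eqP => [->|_] /=; rewrite ?subn0 ?addn0 ?subn1 ?addn1 ?prednK.
Qed.
Lemma incrC a i j : incr n (incr n a i) j = incr n (incr n a j) i.
Proof. by apply/ffunP => l; rewrite !incrE addnAC. Qed.
Lemma decrC a i j : decr n (decr n a i) j = decr n (decr n a j) i.
Proof. by apply/ffunP => l; rewrite !decrE subnAC. Qed.
Lemma incr_decr a i j : i != j -> incr n (decr n a i) j = decr n (incr n a j) i.
Proof.
move=> ij; apply/ffunP => l; rewrite !(incrE, decrE).
by case: (eqVneq l i) => [->|]; rewrite ?(negbTE ij); lia.
Qed.
End Exponents.

Ltac pt := apply/funext => -[[[a b] S] T] /=.
Ltac ptc := pt; repeat (case: ifP => ?); rewrite ?mulr0 ?oppr0 //; ring.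

(** * Super Weyl relations before the twist by sigma *)

Section Commutation.
Variables (C : numClosedFieldType) (n m : nat).
Implicit Types (i j : 'I_n) (r s : 'I_m) (f : fn C n m).
Local Notation mulx := (mulx C n m).
Local Notation muly := (muly C n m).
Local Notation dx := (dx C n m).
Local Notation dy := (dy C n m).
Local Notation multh := (multh C n m).
Local Notation mulvt := (mulvt C n m).
Local Notation dth := (dth C n m).
Local Notation dvt := (dvt C n m).

Lemma mulx_mulx i j f : mulx i (mulx j f) = mulx j (mulx i f).
Proof.
pt; rewrite !decrE; have [->|ij] := eqVneq i j; first by [].
by rewrite !subn0; case: ifP; case: ifP => //; rewrite decrC.
Qed.
Lemma muly_muly i j f : muly i (muly j f) = muly j (muly i f).
Proof.
pt; rewrite !decrE; have [->|ij] := eqVneq i j; first by [].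
by rewrite !subn0; case: ifP; case: ifP => //; rewrite decrC.
Qed.
Lemma dx_dx i j f : dx i (dx j f) = dx j (dx i f).
Proof.
pt; rewrite !incrE; have [->|ij] := eqVneq i j; first by [].
by rewrite !addn0 incrC; ring.
Qed.
Lemma dy_dy i j f : dy i (dy j f) = dy j (dy i f).
Proof.
pt; rewrite !incrE; have [->|ij] := eqVneq i j; first by [].
by rewrite !addn0 incrC; ring.
Qed.
Lemma dx_mulx i j f : dx i (mulx j f) = mulx j (dx i f) + (if i == j then f else 0).
Proof.
pt; rewrite fnD /= incrE decrE (eq_sym j); have [->|ij] := eqVneq i j.
  rewrite addn1 /= incrK; case: ltnP => aj; last by rewrite add0r; move: aj; case: (a j) => // _; rewrite mul1r.
  by rewrite decrK // subn1 prednK //; move: aj; case: (a j) => // k _; rewrite [k.+2]lock -addn1 -lock natrD; ring.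
by rewrite addn0 subn0 fn0 addr0; case: ifP => _; rewrite ?mulr0 // incr_decr // eq_sym.
Qed.
Lemma dy_muly i j f : dy i (muly j f) = muly j (dy i f) + (if i == j then f else 0).
Proof.
pt; rewrite fnD /= incrE decrE (eq_sym j); have [->|ij] := eqVneq i j.
  rewrite addn1 /= incrK; case: ltnP => aj; last by rewrite add0r; move: aj; case: (b j) => // _; rewrite mul1r.
  by rewrite decrK // subn1 prednK //; move: aj; case: (b j) => // k _; rewrite [k.+2]lock -addn1 -lock natrD; ring.
by rewrite addn0 subn0 fn0 addr0; case: ifP => _; rewrite ?mulr0 // incr_decr // eq_sym.
Qed.
Lemma mulx_muly i j f : mulx i (muly j f) = muly j (mulx i f). Proof. ptc. Qed.
Lemma mulx_dy i j f : mulx i (dy j f) = dy j (mulx i f). Proof. ptc. Qed.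
Lemma dx_muly i j f : dx i (muly j f) = muly j (dx i f). Proof. ptc. Qed.
Lemma dx_dy i j f : dx i (dy j f) = dy j (dx i f). Proof. ptc. Qed.
Lemma mulx_multh i r f : mulx i (multh r f) = multh r (mulx i f). Proof. ptc. Qed.
Lemma mulx_mulvt i r f : mulx i (mulvt r f) = mulvt r (mulx i f). Proof. ptc. Qed.
Lemma mulx_dth i r f : mulx i (dth r f) = dth r (mulx i f). Proof. ptc. Qed.
Lemma mulx_dvt i r f : mulx i (dvt r f) = dvt r (mulx i f). Proof. ptc. Qed.
Lemma dx_multh i r f : dx i (multh r f) = multh r (dx i f). Proof. ptc. Qed.
Lemma dx_mulvt i r f : dx i (mulvt r f) = mulvt r (dx i f). Proof. ptc. Qed.
Lemma dx_dth i r f : dx i (dth r f) = dth r (dx i f). Proof. ptc. Qed.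
Lemma dx_dvt i r f : dx i (dvt r f) = dvt r (dx i f). Proof. ptc. Qed.
Lemma muly_multh i r f : muly i (multh r f) = multh r (muly i f). Proof. ptc. Qed.
Lemma muly_mulvt i r f : muly i (mulvt r f) = mulvt r (muly i f). Proof. ptc. Qed.
Lemma muly_dth i r f : muly i (dth r f) = dth r (muly i f). Proof. ptc. Qed.
Lemma muly_dvt i r f : muly i (dvt r f) = dvt r (muly i f). Proof. ptc. Qed.
Lemma dy_multh i r f : dy i (multh r f) = multh r (dy i f). Proof. ptc. Qed.
Lemma dy_mulvt i r f : dy i (mulvt r f) = mulvt r (dy i f). Proof. ptc. Qed.
Lemma dy_dth i r f : dy i (dth r f) = dth r (dy i f). Proof. ptc. Qed.
Lemma dy_dvt i r f : dy i (dvt r f) = dvt r (dy i f). Proof. ptc. Qed.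

(** Reaching a vartheta means crossing all thetas. This sign is constant while only [T] varies, so
    it factors out of [emul] and [eder], and the relations among vartheta operators reduce to those
    of one exterior algebra. *)
Lemma mulvtE r f a b S T :
  mulvt r f (a, b, S, T) = sgn C #|S| * emul C m r (fun T => f (a, b, S, T)) T.
Proof. by rewrite /= /emul; case: ifP => _; rewrite ?mulr0 // sgnD mulrA. Qed.
Lemma dvtE r f a b S T :
  dvt r f (a, b, S, T) = sgn C #|S| * eder C m r (fun T => f (a, b, S, T)) T.
Proof. by rewrite /= /eder; case: ifP => _; rewrite ?mulr0 // sgnD mulrA. Qed.

Lemma emulZ c r (g : {set 'I_m} -> C) S :
  emul C m r (fun T => c * g T) S = c * emul C m r g S.
Proof. by rewrite /emul; case: ifP => _; rewrite ?mulr0 // mulrCA. Qed.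
Lemma ederZ c r (g : {set 'I_m} -> C) S :
  eder C m r (fun T => c * g T) S = c * eder C m r g S.
Proof. by rewrite /eder; case: ifP => _; rewrite ?mulr0 // mulrCA. Qed.

Lemma multh_multh r s f : multh r (multh s f) = - multh s (multh r f).
Proof. by pt; exact: (emul_anti C m r s (fun S => f (a, b, S, T)) S). Qed.
Lemma dth_dth r s f : dth r (dth s f) = - dth s (dth r f).
Proof. by pt; exact: (eder_anti C m r s (fun S => f (a, b, S, T)) S). Qed.
Lemma dth_multh r s f : dth r (multh s f) = (if r == s then f else 0) - multh s (dth r f).
Proof.
pt; rewrite [LHS](eder_emul C m r s (fun S => f (a, b, S, T))).
by rewrite fnD fnN; case: eqP.
Qed.
Lemma mulvt_mulvt r s f : mulvt r (mulvt s f) = - mulvt s (mulvt r f).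
Proof.
apply/funext => -[[[a b] S] T]; rewrite fnN !mulvtE.
rewrite (funext (mulvtE s f a b S)) (funext (mulvtE r f a b S)).
by rewrite !emulZ emul_anti; ring.
Qed.
Lemma dvt_dvt r s f : dvt r (dvt s f) = - dvt s (dvt r f).
Proof.
apply/funext => -[[[a b] S] T]; rewrite fnN !dvtE.
rewrite (funext (dvtE s f a b S)) (funext (dvtE r f a b S)).
by rewrite !ederZ eder_anti; ring.
Qed.
Lemma dvt_mulvt r s f : dvt r (mulvt s f) = (if r == s then f else 0) - mulvt s (dvt r f).
Proof.
apply/funext => -[[[a b] S] T]; rewrite fnD fnN dvtE mulvtE.
rewrite (funext (mulvtE s f a b S)).
have E : (fun T => dvt r f (a, b, S, T)) = _ := funext (dvtE r f a b S).
rewrite E emulZ ederZ eder_emul mulrBr mulrBr !mulrA sgn_mul !mul1r.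
by case: eqP.
Qed.
Lemma cardD1s (S : {set 'I_m}) r : r \in S -> sgn C #|S| = - sgn C #|S :\ r|.
Proof. by move=> rS; rewrite (cardsD1 r S) rS sgnS. Qed.
Lemma cardU1s (S : {set 'I_m}) r : r \notin S -> sgn C #|r |: S| = - sgn C #|S|.
Proof. by move=> rS; rewrite cardsU1 rS sgnS. Qed.

(** A theta operator changes [#|S|] by one and hence flips the crossing sign of every vartheta
    operator; this alone makes the two families anticommute. *)
Lemma mulvt_multh r s f : mulvt r (multh s f) = - multh s (mulvt r f).
Proof. 
pt; rewrite fnN /=; case: ifP => rT; case: ifP => rS; rewrite ?mulr0 ?oppr0 //.
by rewrite !sgnD (cardD1s _ _ rS); ring.
Qed.
Lemma mulvt_dth r s f : mulvt r (dth s f) = - dth s (mulvt r f).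
Proof.
pt; rewrite fnN /=; case: ifP => rT; case: ifP => rS; rewrite ?mulr0 ?oppr0 //.
by rewrite !sgnD (cardU1s _ _ rS); ring.
Qed.
Lemma dvt_multh r s f : dvt r (multh s f) = - multh s (dvt r f).
Proof.
pt; rewrite fnN /=; case: ifP => rT; case: ifP => rS; rewrite ?mulr0 ?oppr0 //.
by rewrite !sgnD (cardD1s _ _ rS); ring.
Qed.
Lemma dvt_dth r s f : dvt r (dth s f) = - dth s (dvt r f).
Proof.
pt; rewrite fnN /=; case: ifP => rT; case: ifP => rS; rewrite ?mulr0 ?oppr0 //.
by rewrite !sgnD (cardU1s _ _ rS); ring.
Qed.

End Commutation.

Ltac fring := apply/funext => ?; rewrite ?(fnD, fnN, fnZ, fn0); ring.

(** * Relations after the twist; Delta and eta commute with osp *)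

Section Weyl.
Variables (C : numClosedFieldType) (n m n1 n2 : nat).
Implicit Types (i j : 'I_n) (r s : 'I_m) (f : fn C n m).
Local Notation mulx := (mulx C n m).
Local Notation muly := (muly C n m).
Local Notation dx := (dx C n m).
Local Notation dy := (dy C n m).
Local Notation multh := (multh C n m).
Local Notation mulvt := (mulvt C n m).
Local Notation dth := (dth C n m).
Local Notation dvt := (dvt C n m).
Local Notation sx := (sx C n m n1).
Local Notation sdx := (sdx C n m n1).
Local Notation sy := (sy C n m n2).
Local Notation sdy := (sdy C n m n2).
Local Notation Delta := (Delta C n m n1 n2).
Local Notation eta := (Defs.eta C n m n1 n2).

Ltac sig := rewrite /Defs.sx /Defs.sdx /Defs.sy /Defs.sdy;
  repeat (case: ifP => ?); rewrite ?foppE ?linearN /=.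

Lemma sx_sx i j f : sx i (sx j f) = sx j (sx i f).
Proof. by sig; rewrite 1?mulx_mulx 1?dx_dx // dx_mulx; (case: eqP => [E|_]; [congruence|by rewrite addr0]). Qed.
Lemma sy_sy i j f : sy i (sy j f) = sy j (sy i f).
Proof. by sig; rewrite 1?muly_muly 1?dy_dy // dy_muly; (case: eqP => [E|_]; [congruence|by rewrite addr0]). Qed.
Lemma sdx_sdx i j f : sdx i (sdx j f) = sdx j (sdx i f).
Proof. by sig; rewrite ?opprK 1?mulx_mulx 1?dx_dx //; rewrite dx_mulx; (case: eqP => [E|_]; [congruence|by rewrite addr0]). Qed.
Lemma sdy_sdy i j f : sdy i (sdy j f) = sdy j (sdy i f).
Proof. by sig; rewrite ?opprK 1?muly_muly 1?dy_dy // dy_muly; (case: eqP => [E|_]; [congruence|by rewrite addr0]). Qed.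
(** The twist keeps the canonical relation because [-x, d/dx] = 1; for indices on different sides of
    n1 the operators commute and [i = j] is impossible. *)
Lemma sdx_sx i j f : sdx i (sx j f) = sx j (sdx i f) + (if i == j then f else 0).
Proof.
rewrite /Defs.sx /Defs.sdx; case: (boolP (i < n1)%N) => hi; case: (boolP (j < n1)%N) => hj;
  rewrite ?foppE ?linearN /= ?dx_mulx //.
- by rewrite (eq_sym j); case: eqP => _; fring.
- by rewrite mulx_mulx; case: eqP => [E|_]; [by move: hi hj; rewrite E; case: (leq _ _)|rewrite addr0].
- by rewrite dx_dx; case: eqP => [E|_]; [by move: hi hj; rewrite E; case: (leq _ _)|rewrite addr0].
Qed.
Lemma sdy_sy i j f : sdy i (sy j f) = sy j (sdy i f) + (if i == j then f else 0).
Proof.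
rewrite /Defs.sy /Defs.sdy; case: (boolP (n2 <= i)%N) => hi; case: (boolP (n2 <= j)%N) => hj;
  rewrite ?foppE ?linearN /= ?dy_muly //.
- by rewrite (eq_sym j); case: eqP => _; fring.
- by rewrite muly_muly; case: eqP => [E|_]; [by move: hi hj; rewrite E; case: (leq _ _)|rewrite addr0].
- by rewrite dy_dy; case: eqP => [E|_]; [by move: hi hj; rewrite E; case: (leq _ _)|rewrite addr0].
Qed.
Ltac sxy := by sig; rewrite ?(mulx_muly, mulx_dy, dx_muly, dx_dy).
Lemma sx_sy i j f : sx i (sy j f) = sy j (sx i f). Proof. sxy. Qed.
Lemma sx_sdy i j f : sx i (sdy j f) = sdy j (sx i f). Proof. sxy. Qed.
Lemma sdx_sy i j f : sdx i (sy j f) = sy j (sdx i f). Proof. sxy. Qed.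
Lemma sdx_sdy i j f : sdx i (sdy j f) = sdy j (sdx i f). Proof. sxy. Qed.
Ltac eo := by sig; rewrite ?(mulx_multh, mulx_mulvt, mulx_dth, mulx_dvt,
  muly_multh, muly_mulvt, muly_dth, muly_dvt, dx_multh, dx_mulvt, dx_dth, dx_dvt,
  dy_multh, dy_mulvt, dy_dth, dy_dvt).
Lemma multh_sx i r f : multh r (sx i f) = sx i (multh r f). Proof. eo. Qed.
Lemma multh_sdx i r f : multh r (sdx i f) = sdx i (multh r f). Proof. eo. Qed.
Lemma multh_sy i r f : multh r (sy i f) = sy i (multh r f). Proof. eo. Qed.
Lemma multh_sdy i r f : multh r (sdy i f) = sdy i (multh r f). Proof. eo. Qed.
Lemma mulvt_sx i r f : mulvt r (sx i f) = sx i (mulvt r f). Proof. eo. Qed.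
Lemma mulvt_sdx i r f : mulvt r (sdx i f) = sdx i (mulvt r f). Proof. eo. Qed.
Lemma mulvt_sy i r f : mulvt r (sy i f) = sy i (mulvt r f). Proof. eo. Qed.
Lemma mulvt_sdy i r f : mulvt r (sdy i f) = sdy i (mulvt r f). Proof. eo. Qed.
Lemma dth_sx i r f : dth r (sx i f) = sx i (dth r f). Proof. eo. Qed.
Lemma dth_sdx i r f : dth r (sdx i f) = sdx i (dth r f). Proof. eo. Qed.
Lemma dth_sy i r f : dth r (sy i f) = sy i (dth r f). Proof. eo. Qed.
Lemma dth_sdy i r f : dth r (sdy i f) = sdy i (dth r f). Proof. eo. Qed.
Lemma dvt_sx i r f : dvt r (sx i f) = sx i (dvt r f). Proof. eo. Qed.
Lemma dvt_sdx i r f : dvt r (sdx i f) = sdx i (dvt r f). Proof. eo. Qed.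
Lemma dvt_sy i r f : dvt r (sy i f) = sy i (dvt r f). Proof. eo. Qed.
Lemma dvt_sdy i r f : dvt r (sdy i f) = sdy i (dvt r f). Proof. eo. Qed.

Lemma Delta_sums f : Delta f =
  - (\sum_(i < n | (i < n1)%N) mulx i (dy i f))
  + \sum_(i < n | (n1 <= i < n2)%N) dx i (dy i f)
  - \sum_(i < n | (n2 <= i)%N) muly i (dx i f)
  + \sum_(r < m) dth r (dvt r f).
Proof. by apply/funext => mu; rewrite !(fnD, fnN) !fn_sum. Qed.

Lemma eta_sums f : eta f =
  \sum_(i < n | (i < n1)%N) muly i (dx i f)
  + \sum_(i < n | (n1 <= i < n2)%N) mulx i (muly i f)
  + \sum_(i < n | (n2 <= i)%N) mulx i (dy i f)
  + \sum_(r < m) multh r (mulvt r f).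
Proof. by apply/funext => mu; rewrite !(fnD, fnN) !fn_sum. Qed.

Lemma sum_comp_linear (I : finType) (P : pred I) (A B : I -> {linear fn C n m -> fn C n m}) c f g :
  \sum_(x | P x) A x (B x (c *: f + g)) =
  c *: (\sum_(x | P x) A x (B x f)) + \sum_(x | P x) A x (B x g).
Proof. by rewrite scaler_sumr -big_split; apply: eq_bigr => x _; rewrite !linearP. Qed.

Fact DeltaP : linear Delta.
Proof.
move=> c f g; rewrite !Delta_sums.
rewrite (sum_comp_linear _ _ (fun i => mulx i) (fun i => dy i)).
rewrite (sum_comp_linear _ _ (fun i => dx i) (fun i => dy i)).
rewrite (sum_comp_linear _ _ (fun i => muly i) (fun i => dx i)).
by rewrite (sum_comp_linear _ _ (fun r => dth r) (fun r => dvt r)); fring.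
Qed.

Fact etaP : linear eta.
Proof.
move=> c f g; rewrite !eta_sums.
rewrite (sum_comp_linear _ _ (fun i => muly i) (fun i => dx i)).
rewrite (sum_comp_linear _ _ (fun i => mulx i) (fun i => muly i)).
rewrite (sum_comp_linear _ _ (fun i => mulx i) (fun i => dy i)).
by rewrite (sum_comp_linear _ _ (fun r => multh r) (fun r => mulvt r)); fring.
Qed.

HB.instance Definition _ := GRing.isLinear.Build C (fn C n m) (fn C n m) *:%R _ DeltaP.
HB.instance Definition _ := GRing.isLinear.Build C (fn C n m) (fn C n m) *:%R _ etaP.

Hypothesis n12 : (n1 <= n2)%N.

Lemma sum_split3 (M : nmodType) (F : 'I_n -> M) :
  \sum_i F i = \sum_(i < n | (i < n1)%N) F i + \sum_(i < n | (n1 <= i < n2)%N) F i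
             + \sum_(i < n | (n2 <= i)%N) F i.
Proof.
rewrite (bigID (fun i : 'I_n => (i < n1)%N)) -addrA; congr (_ + _).
rewrite (bigID (fun i : 'I_n => (i < n2)%N)); congr (_ + _); apply: eq_bigl => i; lia.
Qed.

(** Delta is the sigma-image of the constant-coefficient super Laplacian, as eta is that of the
    quadratic form sum x_i y_i + sum theta_r vartheta_r. Written this way the three index ranges
    disappear from the commutators below. *)
Lemma DeltaE f : Delta f = \sum_i sdx i (sdy i f) + \sum_r dth r (dvt r f).
Proof.
rewrite Delta_sums; congr (_ + _); rewrite sum_split3 -!sumrN; congr (_ + _ + _); apply: eq_bigr => i hi.
- have -> : sdy i f = dy i f by rewrite /Defs.sdy ifF //; lia.
  by rewrite /Defs.sdx hi.
- have -> : sdy i f = dy i f by rewrite /Defs.sdy ifF //; lia.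
  by rewrite /Defs.sdx ifF //; lia.
- have -> : sdy i f = - muly i f by rewrite /Defs.sdy hi.
  rewrite /Defs.sdx ifF; last lia.
  by rewrite linearN /= dx_muly.
Qed.

Lemma etaE f : eta f = \sum_i sx i (sy i f) + \sum_r multh r (mulvt r f).
Proof.
rewrite eta_sums; congr (_ + _); rewrite sum_split3; congr (_ + _ + _); apply: eq_bigr => i hi.
- have -> : sy i f = muly i f by rewrite /Defs.sy ifF //; lia.
  by rewrite /Defs.sx hi dx_muly.
- have -> : sy i f = muly i f by rewrite /Defs.sy ifF //; lia.
  by rewrite /Defs.sx ifF //; lia.
- have -> : sy i f = dy i f by rewrite /Defs.sy hi.
  by rewrite /Defs.sx ifF //; lia.
Qed.

Lemma sum_delta (I : finType) (M : nmodType) (F : I -> M) (i : I) :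
  \sum_j (if j == i then F j else 0) = F i.
Proof. by rewrite -big_mkcond big_pred1_eq. Qed.
Lemma sum_deltar (I : finType) (M : nmodType) (F : I -> M) (i : I) :
  \sum_j (if i == j then F j else 0) = F i.
Proof. by under eq_bigr do rewrite eq_sym; exact: sum_delta. Qed.

Lemma Delta_sx i f : Delta (sx i f) = sx i (Delta f) + sdy i f.
Proof.
rewrite !DeltaE linearD /= !linear_sum /= addrAC; congr (_ + _); last first.
  by apply: eq_bigr => r _; rewrite dvt_sx dth_sx.
rewrite -[X in _ + X](sum_delta _ _ (fun j => sdy j f)) -big_split /=.
by apply: eq_bigr => j _; rewrite -sx_sdy sdx_sx; case: eqP.
Qed.
Lemma Delta_sy i f : Delta (sy i f) = sy i (Delta f) + sdx i f.
Proof.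
rewrite !DeltaE linearD /= !linear_sum /= addrAC; congr (_ + _); last first.
  by apply: eq_bigr => r _; rewrite dvt_sy dth_sy.
rewrite -[X in _ + X](sum_delta _ _ (fun j => sdx j f)) -big_split /=.
apply: eq_bigr => j _; rewrite sdy_sy linearD /= sdx_sy.
by case: eqP; rewrite ?linear0.
Qed.
Lemma Delta_sdx i f : Delta (sdx i f) = sdx i (Delta f).
Proof.
rewrite !DeltaE linearD /= !linear_sum /=; congr (_ + _).
  by apply: eq_bigr => j _; rewrite -sdx_sdy sdx_sdx.
by apply: eq_bigr => r _; rewrite dvt_sdx dth_sdx.
Qed.
Lemma Delta_sdy i f : Delta (sdy i f) = sdy i (Delta f).
Proof.
rewrite !DeltaE linearD /= !linear_sum /=; congr (_ + _).
  by apply: eq_bigr => j _; rewrite sdy_sdy sdx_sdy.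
by apply: eq_bigr => r _; rewrite dvt_sdy dth_sdy.
Qed.
Lemma Delta_multh r f : Delta (multh r f) = multh r (Delta f) - dvt r f.
Proof.
rewrite !DeltaE linearD /= !linear_sum /= -addrA; congr (_ + _).
  by apply: eq_bigr => j _; rewrite multh_sdx multh_sdy.
rewrite -[X in _ - X](sum_delta _ _ (fun s => dvt s f)) -sumrB /=.
apply: eq_bigr => s _; rewrite dvt_multh linearN /= dth_multh.
by case: eqP => [->|_]; fring.
Qed.
Lemma Delta_mulvt r f : Delta (mulvt r f) = mulvt r (Delta f) + dth r f.
Proof.
rewrite !DeltaE linearD /= !linear_sum /= -addrA; congr (_ + _).
  by apply: eq_bigr => j _; rewrite mulvt_sdx mulvt_sdy.
rewrite -[X in _ + X](sum_delta _ _ (fun s => dth s f)) -big_split /=.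
apply: eq_bigr => s _; rewrite dvt_mulvt linearB /= mulvt_dth.
by case: eqP => [->|_]; rewrite ?linear0; fring.
Qed.
Lemma Delta_dth r f : Delta (dth r f) = dth r (Delta f).
Proof.
rewrite !DeltaE linearD /= !linear_sum /=; congr (_ + _).
  by apply: eq_bigr => j _; rewrite dth_sdx dth_sdy.
by apply: eq_bigr => s _; rewrite dvt_dth linearN /= dth_dth opprK.
Qed.
Lemma Delta_dvt r f : Delta (dvt r f) = dvt r (Delta f).
Proof.
rewrite !DeltaE linearD /= !linear_sum /=; congr (_ + _).
  by apply: eq_bigr => j _; rewrite dvt_sdx dvt_sdy.
by apply: eq_bigr => s _; rewrite dvt_dvt linearN /= dvt_dth.
Qed.

Lemma eta_sdx i f : eta (sdx i f) = sdx i (eta f) - sy i f.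
Proof.
rewrite !etaE linearD /= !linear_sum /= addrAC; congr (_ + _); last first.
  by apply: eq_bigr => r _; rewrite mulvt_sdx multh_sdx.
rewrite -[X in _ - X](sum_deltar _ _ (fun j => sy j f)) -sumrB /=.
by apply: eq_bigr => j _; rewrite -sdx_sy sdx_sx; case: eqP => [->|_]; fring.
Qed.
Lemma eta_sdy i f : eta (sdy i f) = sdy i (eta f) - sx i f.
Proof.
rewrite !etaE linearD /= !linear_sum /= addrAC; congr (_ + _); last first.
  by apply: eq_bigr => r _; rewrite mulvt_sdy multh_sdy.
rewrite -[X in _ - X](sum_deltar _ _ (fun j => sx j f)) -sumrB /=.
apply: eq_bigr => j _; rewrite -sx_sdy sdy_sy linearD /=.
by case: eqP => [->|_]; rewrite ?linear0; fring.
Qed.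
Lemma eta_sx i f : eta (sx i f) = sx i (eta f).
Proof.
rewrite !etaE linearD /= !linear_sum /=; congr (_ + _).
  by apply: eq_bigr => j _; rewrite -sx_sy sx_sx.
by apply: eq_bigr => r _; rewrite mulvt_sx multh_sx.
Qed.
Lemma eta_sy i f : eta (sy i f) = sy i (eta f).
Proof.
rewrite !etaE linearD /= !linear_sum /=; congr (_ + _).
  by apply: eq_bigr => j _; rewrite sy_sy sx_sy.
by apply: eq_bigr => r _; rewrite mulvt_sy multh_sy.
Qed.
Lemma eta_dth r f : eta (dth r f) = dth r (eta f) - mulvt r f.
Proof.
rewrite !etaE linearD /= !linear_sum /= -addrA; congr (_ + _).
  by apply: eq_bigr => j _; rewrite dth_sx dth_sy.
rewrite -[X in _ - X](sum_deltar _ _ (fun s => mulvt s f)) -sumrB /=.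
apply: eq_bigr => s _; rewrite mulvt_dth linearN /= dth_multh.
by case: eqP => [->|_]; fring.
Qed.
Lemma eta_dvt r f : eta (dvt r f) = dvt r (eta f) + multh r f.
Proof.
rewrite !etaE linearD /= !linear_sum /= -addrA; congr (_ + _).
  by apply: eq_bigr => j _; rewrite dvt_sx dvt_sy.
rewrite -[X in _ + X](sum_deltar _ _ (fun s => multh s f)) -big_split /=.
apply: eq_bigr => s _; rewrite dvt_multh dvt_mulvt linearB /=.
by case: eqP => [->|_]; rewrite ?linear0; fring.
Qed.
Lemma eta_multh r f : eta (multh r f) = multh r (eta f).
Proof.
rewrite !etaE linearD /= !linear_sum /=; congr (_ + _).
  by apply: eq_bigr => j _; rewrite multh_sx multh_sy.
by apply: eq_bigr => s _; rewrite mulvt_multh linearN /= multh_multh opprK.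
Qed.
Lemma eta_mulvt r f : eta (mulvt r f) = mulvt r (eta f).
Proof.
rewrite !etaE linearD /= !linear_sum /=; congr (_ + _).
  by apply: eq_bigr => j _; rewrite mulvt_sx mulvt_sy.
by apply: eq_bigr => s _; rewrite mulvt_mulvt linearN /= mulvt_multh.
Qed.

Definition eta_rules := (eta_sx, eta_sy, eta_sdx, eta_sdy, eta_multh, eta_mulvt, eta_dth, eta_dvt).
Definition Delta_rules :=
  (Delta_sx, Delta_sy, Delta_sdx, Delta_sdy, Delta_multh, Delta_mulvt, Delta_dth, Delta_dvt).

Lemma DeltaB f g : Delta (f - g) = Delta f - Delta g. Proof. exact: linearB. Qed.
Lemma DeltaD f g : Delta (f + g) = Delta f + Delta g. Proof. exact: linearD. Qed.
Lemma etaB f g : eta (f - g) = eta f - eta g. Proof. exact: linearB. Qed.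
Lemma etaD f g : eta (f + g) = eta f + eta g. Proof. exact: linearD. Qed.

(** Moving Delta past the multiplier of a summand leaves a product of two derivations; the two
    summands of a generator leave products that cancel once their factors are put in the same
    order. *)
Lemma osp_Delta T f : ospgen C n m n1 n2 T -> Delta (T f) = T (Delta f).
Proof.
move=> [[i[j ->]]|[[r[s ->]]|[[i[r ->]]|[[i[r ->]]|[[i[j [_ ->]]]|[[i[j [_ ->]]]|
  [[r[s [_ ->]]]|[[r[s [_ ->]]]|[[i[r ->]]|[i[r ->]]]]]]]]]]];
rewrite ?(fsubE, faddE) ?(DeltaB, DeltaD) !Delta_rules.
- by rewrite sdx_sdy; fring.
- by rewrite dvt_dth; fring.
- by rewrite dth_sdy; fring.
- by rewrite dvt_sdx; fring.
- by rewrite sdy_sdy; fring.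
- by rewrite sdx_sdx; fring.
- by rewrite dth_dth; fring.
- by rewrite dvt_dvt; fring.
- by rewrite dvt_sdy; fring.
- by rewrite dth_sdx; fring.
Qed.

Lemma osp_eta T f : ospgen C n m n1 n2 T -> eta (T f) = T (eta f).
Proof.
move=> [[i[j ->]]|[[r[s ->]]|[[i[r ->]]|[[i[r ->]]|[[i[j [_ ->]]]|[[i[j [_ ->]]]|
  [[r[s [_ ->]]]|[[r[s [_ ->]]]|[[i[r ->]]|[i[r ->]]]]]]]]]]];
rewrite ?(fsubE, faddE) ?(etaB, etaD) !eta_rules; move: (eta f) => g.
- by rewrite !linearB /= sx_sy; fring.
- by rewrite linearB linearD /= mulvt_multh; fring.
- by rewrite !linearB /= mulvt_sx; fring.
- by rewrite linearB linearD /= multh_sy; fring.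
- by rewrite !linearB /= sx_sx; fring.
- by rewrite !linearB /= sy_sy; fring.
- by rewrite !linearB /= mulvt_mulvt; fring.
- by rewrite !linearD /= multh_multh; fring.
- by rewrite linearB linearD /= multh_sx; fring.
- by rewrite !linearB /= mulvt_sy; fring.
Qed.

Lemma osp_linear T c f g : ospgen C n m n1 n2 T -> T (c *: f + g) = c *: T f + T g.
Proof.
move=> [[i[j ->]]|[[r[s ->]]|[[i[r ->]]|[[i[r ->]]|[[i[j [_ ->]]]|[[i[j [_ ->]]]|
  [[r[s [_ ->]]]|[[r[s [_ ->]]]|[[i[r ->]]|[i[r ->]]]]]]]]]]];
rewrite ?(fsubE, faddE) !linearP /=; fring.
Qed.

End Weyl.

(** * Weights and supports *)

Lemma Posz_sum (I : Type) (t : seq I) (P : pred I) (F : I -> nat) :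
  (\sum_(x <- t | P x) F x)%N%:Z = \sum_(x <- t | P x) (F x)%:Z.
Proof. exact: (big_morph Posz PoszD). Qed.

Section Weights.
Variables (C : numClosedFieldType) (n m : nat).
Implicit Types (i j : 'I_n) (r s : 'I_m) (f g : fn C n m) (mu nu : mon n m).
Local Notation mulx := (mulx C n m).
Local Notation muly := (muly C n m).
Local Notation dx := (dx C n m).
Local Notation dy := (dy C n m).
Local Notation multh := (multh C n m).
Local Notation mulvt := (mulvt C n m).
Local Notation dth := (dth C n m).
Local Notation dvt := (dvt C n m).
Local Notation is_poly := (is_poly C n m).

(** One weight with free coefficients, so that a single shift lemma per operator serves the degree,
    the partial degrees of the singular-vector argument and the weight driving the descent. *)
Definition wt (cx cy : 'I_n -> int) (ct : int) mu : int :=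
  let: (a, b, SS, TT) := mu in
  \sum_i cx i * (a i)%:Z + \sum_i cy i * (b i)%:Z + ct * (#|SS| + #|TT|)%:Z.

Arguments wt : simpl never.

Lemma sum_incr (c : 'I_n -> int) a i :
  \sum_j c j * (incr n a i j)%:Z = \sum_j c j * (a j)%:Z + c i.
Proof.
rewrite -[X in _ + X](sum_delta _ _ c) -big_split /=; apply: eq_bigr => j _.
by rewrite incrE; case: eqP => _; rewrite ?addn1 ?addn0 ?intS /=; ring.
Qed.

Lemma wt_incrx cx cy ct a b S T i :
  wt cx cy ct (incr n a i, b, S, T) = wt cx cy ct (a, b, S, T) + cx i.
Proof. by rewrite /wt sum_incr; ring. Qed.
Lemma wt_incry cx cy ct a b S T i :
  wt cx cy ct (a, incr n b i, S, T) = wt cx cy ct (a, b, S, T) + cy i.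
Proof. by rewrite /wt sum_incr; ring. Qed.
Lemma wt_U1l cx cy ct a b (S T : {set 'I_m}) r : r \notin S ->
  wt cx cy ct (a, b, r |: S, T) = wt cx cy ct (a, b, S, T) + ct.
Proof. by move=> rS; rewrite /wt cardsU1 rS add1n addSn intS; ring. Qed.
Lemma wt_U1r cx cy ct a b (S T : {set 'I_m}) r : r \notin T ->
  wt cx cy ct (a, b, S, r |: T) = wt cx cy ct (a, b, S, T) + ct.
Proof. by move=> rS; rewrite /wt cardsU1 rS add1n addnS intS; ring. Qed.

(* c is the amount by which A shifts each of the weights wt; phi moves the support. *)
Definition shifts (A : fn C n m -> fn C n m)
    (c : ('I_n -> int) -> ('I_n -> int) -> int -> int) :=
  exists phi : mon n m -> mon n m, forall f mu, A f mu != 0 ->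
    exists nu, [/\ f nu != 0, mu = phi nu &
      forall cx cy ct, wt cx cy ct mu = wt cx cy ct nu + c cx cy ct].

Lemma shifts_mulx i : shifts (mulx i) (fun cx _ _ => cx i).
Proof.
exists (fun mu => let: (a, b, SS, TT) := mu in (incr n a i, b, SS, TT)).
move=> f [[[a b] S] T] /=; case: ifP => [ai nz|]; last by rewrite eqxx.
exists (decr n a i, b, S, T); split=> //; first by rewrite decrK.
by move=> cx cy ct; rewrite -[in LHS](decrK _ _ _ ai) wt_incrx.
Qed.
Lemma shifts_muly i : shifts (muly i) (fun _ cy _ => cy i).
Proof.
exists (fun mu => let: (a, b, SS, TT) := mu in (a, incr n b i, SS, TT)).
move=> f [[[a b] S] T] /=; case: ifP => [ai nz|]; last by rewrite eqxx.
exists (a, decr n b i, S, T); split=> //; first by rewrite decrK.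
by move=> cx cy ct; rewrite -[in LHS](decrK _ _ _ ai) wt_incry.
Qed.
Lemma shifts_dx i : shifts (dx i) (fun cx _ _ => - cx i).
Proof.
exists (fun mu => let: (a, b, SS, TT) := mu in (decr n a i, b, SS, TT)).
move=> f [[[a b] S] T] /=; rewrite mulf_eq0 pnatr_eq0 /= => nz.
exists (incr n a i, b, S, T); split=> //; first by rewrite incrK.
by move=> cx cy ct; rewrite wt_incrx addrK.
Qed.
Lemma shifts_dy i : shifts (dy i) (fun _ cy _ => - cy i).
Proof.
exists (fun mu => let: (a, b, SS, TT) := mu in (a, decr n b i, SS, TT)).
move=> f [[[a b] S] T] /=; rewrite mulf_eq0 pnatr_eq0 /= => nz.
exists (a, incr n b i, S, T); split=> //; first by rewrite incrK.
by move=> cx cy ct; rewrite wt_incry addrK.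
Qed.
Lemma sgn_neq0 k : sgn C k != 0. Proof. by rewrite signr_eq0. Qed.
Lemma shifts_multh r : shifts (multh r) (fun _ _ ct => ct).
Proof.
exists (fun mu => let: (a, b, SS, TT) := mu in (a, b, r |: SS, TT)).
move=> f [[[a b] S] T] /=; case: ifP => [rS|]; last by rewrite eqxx.
rewrite mulf_eq0 (negbTE (sgn_neq0 _)) /= => nz.
exists (a, b, S :\ r, T); split=> //; first by rewrite setD1K.
by move=> cx cy ct; rewrite -[in LHS](setD1K rS) wt_U1l // setD11.
Qed.
Lemma shifts_mulvt r : shifts (mulvt r) (fun _ _ ct => ct).
Proof.
exists (fun mu => let: (a, b, SS, TT) := mu in (a, b, SS, r |: TT)).
move=> f [[[a b] S] T] /=; case: ifP => [rS|]; last by rewrite eqxx.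
rewrite mulf_eq0 (negbTE (sgn_neq0 _)) /= => nz.
exists (a, b, S, T :\ r); split=> //; first by rewrite setD1K.
by move=> cx cy ct; rewrite -[in LHS](setD1K rS) wt_U1r // setD11.
Qed.
Lemma shifts_dth r : shifts (dth r) (fun _ _ ct => - ct).
Proof.
exists (fun mu => let: (a, b, SS, TT) := mu in (a, b, SS :\ r, TT)).
move=> f [[[a b] S] T] /=; case: ifP => [rS|]; last by rewrite eqxx.
rewrite mulf_eq0 (negbTE (sgn_neq0 _)) /= => nz.
exists (a, b, r |: S, T); split=> //; first by rewrite setU1K.
by move=> cx cy ct; rewrite wt_U1l // addrK.
Qed.
Lemma shifts_dvt r : shifts (dvt r) (fun _ _ ct => - ct).
Proof.
exists (fun mu => let: (a, b, SS, TT) := mu in (a, b, SS, TT :\ r)).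
move=> f [[[a b] S] T] /=; case: ifP => [rS|]; last by rewrite eqxx.
rewrite mulf_eq0 (negbTE (sgn_neq0 _)) /= => nz.
exists (a, b, S, r |: T); split=> //; first by rewrite setU1K.
by move=> cx cy ct; rewrite wt_U1r // addrK.
Qed.
Lemma shiftsN A c : shifts A c -> shifts (fun f => fopp C n m (A f)) c.
Proof.
case=> phi H; exists phi => f mu; rewrite foppE fnN oppr_eq0; exact: H.
Qed.

Definition polyw (Q : mon n m -> Prop) f :=
  is_poly f /\ forall mu, f mu != 0 -> Q mu.

Lemma polyw0 Q : polyw Q 0.
Proof. by split=> [|mu]; [exists [::]|rewrite eqxx]. Qed.
Lemma polywP Q c f g : polyw Q f -> polyw Q g -> polyw Q (c *: f + g).
Proof.
move=> [[s hs] qs] [[t ht] qt]; split.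
  exists (s ++ t) => mu; rewrite mem_cat negb_or => /andP[mus mut].
  by rewrite fnD fnZ hs // ht // mulr0 addr0.
move=> mu; rewrite fnD fnZ; have [->|/qs//] := eqVneq (f mu) 0.
by rewrite mulr0 add0r => /qt.
Qed.
Lemma polywD Q f g : polyw Q f -> polyw Q g -> polyw Q (f + g).
Proof. by move=> /(polywP Q 1 f g); rewrite scale1r. Qed.
Lemma polywZ Q c f : polyw Q f -> polyw Q (c *: f).
Proof. by move=> /(polywP Q c f 0) /(_ (polyw0 Q)); rewrite addr0. Qed.
Lemma polywN Q f : polyw Q f -> polyw Q (- f).
Proof. by move=> /(polywZ Q (-1)); rewrite scaleN1r. Qed.
Lemma polywB Q f g : polyw Q f -> polyw Q g -> polyw Q (f - g).
Proof. by move=> qf /polywN; exact: polywD. Qed.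
Lemma polyw_sum Q (I : Type) (l : seq I) (P : pred I) (F : I -> fn C n m) :
  (forall x : I, P x -> polyw Q (F x)) -> polyw Q (\sum_(x <- l | P x) F x).
Proof. by move=> H; apply: (big_ind (polyw Q)) => //; [exact: polyw0|exact: polywD]. Qed.

Lemma polyw_shift A c cx cy ct (Q Q' : int -> Prop) f : shifts A c ->
  polyw (fun mu => Q (wt cx cy ct mu)) f ->
  (forall z, Q z -> Q' (z + c cx cy ct)) ->
  polyw (fun mu => Q' (wt cx cy ct mu)) (A f).
Proof.
move=> [phi H] [[s hs] qs] QQ'; split.
  exists (map phi s) => mu; have [//|] := eqVneq (A f mu) 0.
  move=> /H [nu [nz -> _]]; rewrite map_f //.
  by apply: contraNT nz => /hs->.
by move=> mu /H [nu [nz _ ->]]; apply/QQ'/qs.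
Qed.

Lemma polyw_shift2 A B cA cB cx cy ct (Q Q' : int -> Prop) f :
  shifts A cA -> shifts B cB -> polyw (fun mu => Q (wt cx cy ct mu)) f ->
  (forall z, Q z -> Q' (z + (cB cx cy ct + cA cx cy ct))) ->
  polyw (fun mu => Q' (wt cx cy ct mu)) (A (B f)).
Proof.
move=> hA hB qf QQ'.
apply: (polyw_shift _ _ _ _ _ (fun z => Q' (z + cA cx cy ct)) _ _ hA) => //.
by apply: (polyw_shift _ _ _ _ _ _ (fun z => Q' (z + cA cx cy ct)) _ hB qf) => z qz;
  rewrite -addrA; apply: QQ'.
Qed.

Lemma mulx_dxE i f a b S T : mulx i (dx i f) (a, b, S, T) = (a i)%:R * f (a, b, S, T).
Proof.
by rewrite /=; case: ltnP => ai; [rewrite decrK // decrE eqxx subn1 prednK|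
  move: ai; rewrite leqn0 => /eqP->; rewrite mul0r].
Qed.
Lemma muly_dyE i f a b S T : muly i (dy i f) (a, b, S, T) = (b i)%:R * f (a, b, S, T).
Proof.
by rewrite /=; case: ltnP => ai; [rewrite decrK // decrE eqxx subn1 prednK|
  move: ai; rewrite leqn0 => /eqP->; rewrite mul0r].
Qed.
Lemma dx_mulxE i f a b S T : dx i (mulx i f) (a, b, S, T) = (a i + 1)%:R * f (a, b, S, T).
Proof. by rewrite /= incrK incrE eqxx !addn1. Qed.
Lemma dy_mulyE i f a b S T : dy i (muly i f) (a, b, S, T) = (b i + 1)%:R * f (a, b, S, T).
Proof. by rewrite /= incrK incrE eqxx !addn1. Qed.
Lemma multh_dthE r f a b S T : multh r (dth r f) (a, b, S, T) = (r \in S)%:R * f (a, b, S, T).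
Proof.
rewrite /=; case: ifP => rS; rewrite ?mul0r // mul1r setD11 /= setD1K //.
by rewrite belowD1_id mulrA sgn_mul mul1r.
Qed.
Lemma mulvt_dvtE r f a b S T : mulvt r (dvt r f) (a, b, S, T) = (r \in T)%:R * f (a, b, S, T).
Proof.
rewrite /=; case: ifP => rS; rewrite ?mul0r // mul1r setD11 /= setD1K //.
by rewrite belowD1_id mulrA sgn_mul mul1r.
Qed.
Lemma dth_multhE r f a b S T :
  dth r (multh r f) (a, b, S, T) = (1 - (r \in S)%:R) * f (a, b, S, T).
Proof. by rewrite dth_multh eqxx fnD fnN multh_dthE; ring. Qed.
Lemma dvt_mulvtE r f a b S T :
  dvt r (mulvt r f) (a, b, S, T) = (1 - (r \in T)%:R) * f (a, b, S, T).
Proof. by rewrite dvt_mulvt eqxx fnD fnN mulvt_dvtE; ring. Qed.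

Lemma sum_mem (S : {set 'I_m}) : \sum_r (r \in S)%:R = #|S|%:R :> C.
Proof.
rewrite -sum1_card natr_sum [RHS]big_mkcond /=.
by apply: eq_bigr => r _; case: (r \in S).
Qed.

Lemma card_mid n1 n2 : (n1 <= n2 <= n)%N -> #|[pred i : 'I_n | (n1 <= i < n2)%N]| = (n2 - n1)%N.
Proof.
move=> /andP[n12 n2n]; rewrite -sum1_card.
rewrite -(big_mkord (fun l => n1 <= l < n2)%N (fun=> 1%N)) /=.
rewrite (big_cat_nat (leq0n n1)) ?(leq_trans n12) //= big_nat_cond big1 ?add0n; last by move=> l; lia.
rewrite (big_cat_nat n12) //= addnC big_nat_cond big1 ?add0n; last by move=> l; lia.
rewrite big_nat_cond (eq_bigl (fun l => n1 <= l < n2)%N) -?big_nat; last by move=> l; lia.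
by rewrite sum_nat_const_nat muln1.
Qed.

End Weights.
Arguments wt : simpl never.

Arguments polyw_shift {C n m A c cx cy ct} Q Q' {f}.
Arguments polyw_shift2 {C n m A B cA cB cx cy ct} Q Q' {f}.

(** * Diagonal operators and vanishing of partial derivatives *)

Section Diagonal.
Variables (C : numClosedFieldType) (n m : nat).
Implicit Types (i j : 'I_n) (r s : 'I_m) (f g h : fn C n m) (mu nu : mon n m).
Local Notation wt := (wt n m).

Definition diag (w : mon n m -> int) f : fn C n m := fun mu => (w mu)%:~R * f mu.

Section Commute.
Variables (cx cy : 'I_n -> int) (ct : int).
Lemma dx_diag i f : cx i = 0 ->
  dx C n m i (diag (wt cx cy ct) f) = diag (wt cx cy ct) (dx C n m i f).
Proof. by move=> c0; pt; rewrite /diag wt_incrx c0 addr0 mulrCA. Qed.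
Lemma dy_diag i f : cy i = 0 ->
  dy C n m i (diag (wt cx cy ct) f) = diag (wt cx cy ct) (dy C n m i f).
Proof. by move=> c0; pt; rewrite /diag wt_incry c0 addr0 mulrCA. Qed.
Lemma dth_diag r f : ct = 0 ->
  dth C n m r (diag (wt cx cy ct) f) = diag (wt cx cy ct) (dth C n m r f).
Proof.
move=> c0; pt; rewrite /diag c0 /=; case: ifP => rS; last by rewrite mulr0.
by rewrite wt_U1l // addr0 mulrCA.
Qed.
Lemma dvt_diag r f : ct = 0 ->
  dvt C n m r (diag (wt cx cy ct) f) = diag (wt cx cy ct) (dvt C n m r f).
Proof.
move=> c0; pt; rewrite /diag c0 /=; case: ifP => rS; last by rewrite mulr0.
by rewrite wt_U1r // addr0 mulrCA.
Qed.
End Commute.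

Lemma wtD cx cx' cy cy' ct ct' mu :
  wt (fun i => cx i + cx' i) (fun i => cy i + cy' i) (ct + ct') mu =
  wt cx cy ct mu + wt cx' cy' ct' mu.
Proof.
case: mu => [[[a b] S] T]; rewrite /wt.
under eq_bigr do rewrite mulrDl.
under [X in _ + X + _]eq_bigr do rewrite mulrDl.
by rewrite !big_split /=; ring.
Qed.
Lemma wt_eq cx cx' cy cy' ct mu : cx =1 cx' -> cy =1 cy' ->
  wt cx cy ct mu = wt cx' cy' ct mu.
Proof. by move=> /funext-> /funext->. Qed.

Lemma mulx_inj i h : mulx C n m i h = 0 -> h = 0.
Proof.
move=> /(congr1 (fun F : fn C n m => F)) E; apply/funext => -[[[a b] S] T].
have := congr1 (fun F : fn C n m => F (incr n a i, b, S, T)) E.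
by rewrite /= incrE eqxx addn1 /= incrK.
Qed.
Lemma muly_inj i h : muly C n m i h = 0 -> h = 0.
Proof.
move=> E; apply/funext => -[[[a b] S] T].
have := congr1 (fun F : fn C n m => F (a, incr n b i, S, T)) E.
by rewrite /= incrE eqxx addn1 /= incrK.
Qed.
Lemma dxE_decr i f (a b : {ffun 'I_n -> nat}) (S T : {set 'I_m}) : (0 < a i)%N ->
  dx C n m i f (decr n a i, b, S, T) = (a i)%:R * f (a, b, S, T).
Proof. by move=> ai; rewrite /= decrK // decrE eqxx subn1 prednK. Qed.
Lemma dyE_decr i f (a b : {ffun 'I_n -> nat}) (S T : {set 'I_m}) : (0 < b i)%N ->
  dy C n m i f (a, decr n b i, S, T) = (b i)%:R * f (a, b, S, T).
Proof. by move=> ai; rewrite /= decrK // decrE eqxx subn1 prednK. Qed.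
Lemma dthE_rem r f (a b : {ffun 'I_n -> nat}) (S T : {set 'I_m}) : r \in S ->
  dth C n m r f (a, b, S :\ r, T) = sgn C (below m S r) * f (a, b, S, T).
Proof. by move=> rS; rewrite /= setD11 /= setD1K // belowD1_id. Qed.
Lemma dvtE_rem r f (a b : {ffun 'I_n -> nat}) (S T : {set 'I_m}) : r \in T ->
  dvt C n m r f (a, b, S, T :\ r) = sgn C (#|S| + below m T r) * f (a, b, S, T).
Proof. by move=> rS; rewrite /= setD11 /= setD1K // belowD1_id. Qed.

Lemma dx0 i f (a b : {ffun 'I_n -> nat}) (S T : {set 'I_m}) : dx C n m i f = 0 -> f (a, b, S, T) != 0 -> a i = 0%N.
Proof.
move=> E; have [//|ai] := posnP (a i); move/eqP: (dxE_decr i f a b S T ai).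
by rewrite E fn0 eq_sym mulf_eq0 pnatr_eq0 => /orP[/eqP->//|->].
Qed.
Lemma dy0 i f (a b : {ffun 'I_n -> nat}) (S T : {set 'I_m}) : dy C n m i f = 0 -> f (a, b, S, T) != 0 -> b i = 0%N.
Proof.
move=> E; have [//|ai] := posnP (b i); move/eqP: (dyE_decr i f a b S T ai).
by rewrite E fn0 eq_sym mulf_eq0 pnatr_eq0 => /orP[/eqP->//|->].
Qed.
Lemma dth0 r f (a b : {ffun 'I_n -> nat}) (S T : {set 'I_m}) : dth C n m r f = 0 -> f (a, b, S, T) != 0 -> r \notin S.
Proof.
move=> E nz; apply/negP => rS; move/eqP: (dthE_rem r f a b S T rS).
by rewrite E fn0 eq_sym mulf_eq0 (negbTE (sgn_neq0 _ _)) (negbTE nz).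
Qed.
Lemma dvt0 r f (a b : {ffun 'I_n -> nat}) (S T : {set 'I_m}) : dvt C n m r f = 0 -> f (a, b, S, T) != 0 -> r \notin T.
Proof.
move=> E nz; apply/negP => rS; move/eqP: (dvtE_rem r f a b S T rS).
by rewrite E fn0 eq_sym mulf_eq0 (negbTE (sgn_neq0 _ _)) (negbTE nz).
Qed.
End Diagonal.

Arguments Defs.mulx : simpl never.
Arguments Defs.muly : simpl never.
Arguments Defs.dx : simpl never.
Arguments Defs.dy : simpl never.
Arguments Defs.multh : simpl never.
Arguments Defs.mulvt : simpl never.
Arguments Defs.dth : simpl never.
Arguments Defs.dvt : simpl never.

(** * The decomposition of A_<k> *)

Section Decomposition.
Variables (C : numClosedFieldType) (n m n1 n2 : nat).
Hypotheses (n12 : (n1 <= n2)%N) (n2n : (n2 <= n)%N).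
Implicit Types (i j : 'I_n) (r s : 'I_m) (f g h : fn C n m) (mu nu : mon n m) (k l : int).
Local Notation mulx := (mulx C n m).
Local Notation muly := (muly C n m).
Local Notation multh := (multh C n m).
Local Notation mulvt := (mulvt C n m).
Local Notation dth := (dth C n m).
Local Notation dvt := (dvt C n m).
Local Notation sx := (sx C n m n1).
Local Notation sdx := (sdx C n m n1).
Local Notation sy := (sy C n m n2).
Local Notation sdy := (sdy C n m n2).
Local Notation Delta := (Delta C n m n1 n2).
Local Notation eta := (Defs.eta C n m n1 n2).
Local Notation is_poly := (is_poly C n m).
Local Notation Ak := (Ak C n m n1 n2).
Local Notation Hk := (Hk C n m n1 n2).
Local Notation deg := (deg n m n1 n2).
Local Notation polyw := (polyw C n m).
Local Notation wt := (wt n m).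

Definition dgx i : int := if (n1 <= i)%N then 1 else -1.
Definition dgy i : int := if (i < n2)%N then 1 else -1.

Lemma degE mu : deg mu = wt dgx dgy 1 mu.
Proof.
case: mu => [[[a b] S] T]; rewrite /Defs.deg /wt mul1r PoszD addrA; congr (_ + _ + _).
rewrite -addrA; congr (_ + _).
  rewrite [RHS](bigID (fun i => (n1 <= i)%N)) /= -sumrN; congr (_ + _).
    by apply: eq_bigr => i hi; rewrite /dgx hi mul1r.
  by apply: eq_big => [i|i hi]; rewrite ?ltnNge // /dgx leqNgt hi mulN1r.
rewrite [RHS](bigID (fun i => (i < n2)%N)) /= -sumrN; congr (_ + _).
  by apply: eq_bigr => i hi; rewrite /dgy hi mul1r.
by apply: eq_big => [i|i hi]; [rewrite leqNgt|rewrite /dgy ltnNge hi mulN1r].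
Qed.

Lemma AkE k f : Ak k f <-> polyw (fun mu => wt dgx dgy 1 mu = k) f.
Proof. by split=> [[pf Q]|[pf Q]]; split=> // mu /Q; rewrite degE. Qed.

Lemma Ak_shift A c d k f : shifts C n m A c -> c dgx dgy 1 = d -> Ak k f -> Ak (k + d) (A f).
Proof.
by move=> sA <- /AkE ak; apply/AkE; apply: (polyw_shift (fun z => z = k) (fun z => z = k + _) sA ak) => z ->.
Qed.

Lemma Ak_sx i k f : Ak k f -> Ak (k + 1) (sx i f).
Proof.
rewrite /Defs.sx; case: ifP => hi; apply: Ak_shift; first exact: shifts_dx.
- by rewrite /dgx leqNgt hi opprK.
- exact: shifts_mulx.
- by rewrite /dgx leqNgt hi.
Qed.
Lemma Ak_sdx i k f : Ak k f -> Ak (k - 1) (sdx i f).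
Proof.
rewrite /Defs.sdx; case: ifP => hi.
  apply: (Ak_shift (fun f => fopp C n m (mulx i f))).
    exact: (shiftsN _ _ _ _ _ (shifts_mulx _ _ _ i)).
  by rewrite /dgx leqNgt hi.
apply: Ak_shift; first exact: shifts_dx.
by rewrite /dgx leqNgt hi.
Qed.
Lemma Ak_sy i k f : Ak k f -> Ak (k + 1) (sy i f).
Proof.
rewrite /Defs.sy; case: ifP => hi; apply: Ak_shift; first exact: shifts_dy.
- by rewrite /dgy ltnNge hi opprK.
- exact: shifts_muly.
- by rewrite /dgy ltnNge hi.
Qed.
Lemma Ak_sdy i k f : Ak k f -> Ak (k - 1) (sdy i f).
Proof.
rewrite /Defs.sdy; case: ifP => hi.
  apply: (Ak_shift (fun f => fopp C n m (muly i f))).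
    exact: (shiftsN _ _ _ _ _ (shifts_muly _ _ _ i)).
  by rewrite /dgy ltnNge hi.
apply: Ak_shift; first exact: shifts_dy.
by rewrite /dgy ltnNge hi.
Qed.
Lemma Ak_multh r k f : Ak k f -> Ak (k + 1) (multh r f).
Proof. by apply: Ak_shift; first exact: shifts_multh. Qed.
Lemma Ak_mulvt r k f : Ak k f -> Ak (k + 1) (mulvt r f).
Proof. by apply: Ak_shift; first exact: shifts_mulvt. Qed.
Lemma Ak_dth r k f : Ak k f -> Ak (k - 1) (dth r f).
Proof. by apply: Ak_shift; first exact: shifts_dth. Qed.
Lemma Ak_dvt r k f : Ak k f -> Ak (k - 1) (dvt r f).
Proof. by apply: Ak_shift; first exact: shifts_dvt. Qed.

Lemma AkP c k f g : Ak k f -> Ak k g -> Ak k (c *: f + g).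
Proof. exact: polywP. Qed.
Lemma AkD k f g : Ak k f -> Ak k g -> Ak k (f + g).
Proof. exact: polywD. Qed.
Lemma AkB k f g : Ak k f -> Ak k g -> Ak k (f - g).
Proof. exact: polywB. Qed.
Lemma AkZ c k f : Ak k f -> Ak k (c *: f).
Proof. exact: polywZ. Qed.
Lemma Ak0 k : Ak k 0. Proof. exact: polyw0. Qed.
Lemma Ak_sum k (I : Type) (t : seq I) (P : pred I) (F : I -> fn C n m) :
  (forall x : I, P x -> Ak k (F x)) -> Ak k (\sum_(x <- t | P x) F x).
Proof. exact: polyw_sum. Qed.

Lemma Ak_osp T k f : ospgen C n m n1 n2 T -> Ak k f -> Ak k (T f).
Proof.
(* Every summand of a generator lowers the degree by one and then raises it by one. *)
move=> oT ak; rewrite -(subrK 1 k).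
move: oT => [[i[j ->]]|[[r[s ->]]|[[i[r ->]]|[[i[r ->]]|[[i[j [_ ->]]]|[[i[j [_ ->]]]|
  [[r[s [_ ->]]]|[[r[s [_ ->]]]|[[i[r ->]]|[i[r ->]]]]]]]]]]];
by rewrite ?(fsubE, faddE); (apply: AkB || apply: AkD);
   (apply: Ak_sx || apply: Ak_sy || apply: Ak_multh || apply: Ak_mulvt);
   (apply: Ak_sdx || apply: Ak_sdy || apply: Ak_dth || apply: Ak_dvt).
Qed.

Lemma Ak_Delta k f : Ak k f -> Ak (k - 2) (Delta f).
Proof.
move=> ak; have -> : k - 2 = k - 1 - 1 by ring.
rewrite DeltaE //; apply: AkD; apply: Ak_sum => x _.
  by apply: Ak_sdx; exact: Ak_sdy.
by apply: Ak_dth; exact: Ak_dvt.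
Qed.
Lemma Ak_eta k f : Ak k f -> Ak (k + 2) (eta f).
Proof.
move=> ak; have -> : k + 2 = k + 1 + 1 by ring.
rewrite etaE //; apply: AkD; apply: Ak_sum => x _.
  by apply: Ak_sx; exact: Ak_sy.
by apply: Ak_multh; exact: Ak_mulvt.
Qed.
Lemma Ak_iter_eta N k f : Ak k f -> Ak (k + (2 * N)%N%:Z) (iter N eta f).
Proof.
elim: N => [|N IH] ak; first by rewrite muln0 addr0.
have -> : k + (2 * N.+1)%N%:Z = k + (2 * N)%N%:Z + 2 by lia.
by rewrite iterS; apply: Ak_eta; exact: IH.
Qed.
Lemma Ak_iter_Delta N k f : Ak k f -> Ak (k - (2 * N)%N%:Z) (iter N Delta f).
Proof.
elim: N => [|N IH] ak; first by rewrite muln0 subr0.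
have -> : k - (2 * N.+1)%N%:Z = k - (2 * N)%N%:Z - 2 by lia.
by rewrite iterS; apply: Ak_Delta; exact: IH.
Qed.

(** The constant of normal ordering in [Delta, eta]: each middle pair x_i, y_i contributes 1 and
    each odd pair -1, while for an outer pair the two constants cancel. *)
Definition kappa : int := n2%:Z - n1%:Z - m%:Z.

Lemma Delta_etaE f : Delta (eta f) = eta (Delta f)
  + (\sum_i (sx i (sdx i f) + sdy i (sy i f)) + \sum_r (multh r (dth r f) - dvt r (mulvt r f))).
Proof.
rewrite etaE // linearD /= !linear_sum /= [in X in _ = X + _]etaE // addrACA -!big_split /=.
congr (_ + _); apply: eq_bigr => x _.
  by rewrite Delta_sx // Delta_sy // linearD /= addrA.
by rewrite Delta_multh // Delta_mulvt // linearD /= addrA.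
Qed.

Lemma Delta_eta k f : Ak k f -> Delta (eta f) = eta (Delta f) + (k + kappa)%:~R *: f.
Proof.
move=> [_ dk]; rewrite Delta_etaE; congr (_ + _); apply/funext => mu.
rewrite fnZ; have [f0|/dk <-] := eqVneq (f mu) 0.
  rewrite f0 mulr0; case: mu f0 => [[[a b] S] T] f0.
  rewrite fnD !fn_sum !big1 ?addr0 // => [r _|i _].
    by rewrite fnD fnN multh_dthE dvt_mulvtE f0 !mulr0 subr0.
  rewrite fnD /Defs.sx /Defs.sdx /Defs.sy /Defs.sdy.
  by do 2 case: ifP => _; rewrite ?foppE ?linearN ?fnN /=
    ?(mulx_dxE, dx_mulxE, muly_dyE, dy_mulyE) f0 !mulr0 ?oppr0 ?addr0.
rewrite degE; case: mu => [[[a b] S] T].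
have -> : wt dgx dgy 1 (a, b, S, T) + kappa =
    \sum_(i < n) (dgx i * (a i)%:Z + dgy i * (b i)%:Z + (n1 <= i < n2)%N%:Z)
    + \sum_r ((r \in S)%:Z + (r \in T)%:Z - 1).
  rewrite !big_split /= /wt /kappa sumrN sumr_const card_ord mul1r.
  have -> : \sum_(i < n) (n1 <= i < n2)%N%:Z = n2%:Z - n1%:Z.
    rewrite subzn // -(card_mid n n1 n2) ?n12 // -sum1_card Posz_sum [in RHS]big_mkcond /=.
    by apply: eq_bigr => i _; rewrite inE; case: ifP.
  have E (A : {set 'I_m}) : \sum_r (r \in A)%:Z = #|A|%:Z.
    by rewrite -sum1_card Posz_sum [in RHS]big_mkcond /=; apply: eq_bigr => r _; case: ifP.
  by rewrite !E natz PoszD; ring.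
rewrite fnD !fn_sum rmorphD /= !rmorph_sum /= mulrDl !mulr_suml; congr (_ + _).
  apply: eq_bigr => i _; rewrite fnD /Defs.sx /Defs.sdx /Defs.sy /Defs.sdy /dgx /dgy.
  case: (ltnP i n1) => h1; case: (leqP n2 i) => h2; rewrite ?foppE ?linearN ?fnN /=
    ?(mulx_dxE, dx_mulxE, muly_dyE, dy_mulyE) ?natrD ?rmorphD ?rmorphM /= ?rmorphN /=;
    try (exfalso; lia); ring.
by apply: eq_bigr => r _; rewrite fnD fnN multh_dthE dvt_mulvtE !rmorphB !rmorphD /=; ring.
Qed.

Lemma poly_bound (w : mon n m -> int) f : is_poly f ->
  exists N : nat, forall mu, f mu != 0 -> w mu <= N%:Z.
Proof.
move=> [s hs]; exists (\sum_(nu <- s) `|w nu|)%N => mu nz.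
have mus : mu \in s by apply: contraNT nz => /hs->.
by rewrite (big_rem mu) //=; lia.
Qed.

Lemma wt_ge0 (cx cy : 'I_n -> int) (ct : int) mu :
  (forall i, 0 <= cx i) -> (forall i, 0 <= cy i) -> 0 <= ct -> 0 <= wt cx cy ct mu.
Proof.
case: mu => [[[a b] S] T] hx hy ht; rewrite /wt.
by rewrite !addr_ge0 ?sumr_ge0 ?mulr_ge0 // => i _; rewrite mulr_ge0.
Qed.

(** The total degree does not drop under the outer terms of Delta, such as x_i d/dy_i. The degree
    that omits x_i for i <= n1 and y_i for i > n2 does: every term differentiates by a counted
    variable and multiplies only by omitted ones. *)
Lemma Delta_nilp f : is_poly f -> exists N, iter N Delta f = 0.
Proof.
pose wx i : int := if (i < n1)%N then 0 else 1.
pose wy i : int := if (n2 <= i)%N then 0 else 1.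
move=> pf; have [N hN] := poly_bound (wt wx wy 1) f pf; exists N.+1.
have dec k g : polyw (fun mu => wt wx wy 1 mu <= k) g ->
    polyw (fun mu => wt wx wy 1 mu <= k - 1) (Delta g).
  move=> pg; rewrite DeltaE //; apply: polywD; apply: polyw_sum => x _; last first.
    apply: (polyw_shift2 (fun z => z <= k) (fun z => z <= k - 1)
      (shifts_dth _ _ _ _) (shifts_dvt _ _ _ _) pg) => z; lia.
  rewrite /Defs.sdx /Defs.sdy; case: ifP => h1; case: ifP => h2; rewrite ?foppE ?linearN /=.
  - by exfalso; lia.
  - apply/polywN; apply: (polyw_shift2 (fun z => z <= k) (fun z => z <= k - 1)
      (shifts_mulx _ _ _ _) (shifts_dy _ _ _ _) pg) => z; rewrite /wx /wy h1 h2; lia.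
  - apply/polywN; apply: (polyw_shift2 (fun z => z <= k) (fun z => z <= k - 1)
      (shifts_dx _ _ _ _) (shifts_muly _ _ _ _) pg) => z; rewrite /wx /wy h1 h2; lia.
  - apply: (polyw_shift2 (fun z => z <= k) (fun z => z <= k - 1)
      (shifts_dx _ _ _ _) (shifts_dy _ _ _ _) pg) => z; rewrite /wx /wy h1 h2; lia.
have it M : polyw (fun mu => wt wx wy 1 mu <= N%:Z - M%:Z) (iter M Delta f).
  elim: M => [|M IH]; first by split=> //; rewrite subr0.
  have -> : N%:Z - M.+1%:Z = N%:Z - M%:Z - 1 by lia.
by exact: dec.
apply/funext => mu; apply/eqP; apply: contraT => /(proj2 (it N.+1)).
have: 0 <= wt wx wy 1 mu by apply: wt_ge0 => // i; rewrite /wx /wy; case: ifP.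
lia.
Qed.

Lemma HkE l h : Hk l h <-> Ak l h /\ Delta h = 0.
Proof. by split=> [[ah dh]|[ah dh]]; split=> //; [apply/funext|rewrite dh]. Qed.
Lemma HkP c l f g : Hk l f -> Hk l g -> Hk l (c *: f + g).
Proof.
move=> /HkE [af df] /HkE [ag dg]; apply/HkE; split; first exact: AkP.
by rewrite DeltaP // df dg scaler0 addr0.
Qed.
Lemma Hk0 l : Hk l 0.
Proof. by apply/HkE; split; [exact: Ak0|rewrite linear0]. Qed.
Lemma HkZ c l f : Hk l f -> Hk l (c *: f).
Proof. by move=> /(HkP c l f 0) /(_ (Hk0 l)); rewrite addr0. Qed.
Lemma Hk_osp T l f : ospgen C n m n1 n2 T -> Hk l f -> Hk l (T f).
Proof.
move=> oT /HkE [af df]; apply/HkE; split; first exact: Ak_osp.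
rewrite osp_Delta // df; have := osp_linear C n m n1 n2 T (-1) 0 0 oT.
by rewrite scaler0 add0r scaleN1r addNr.
Qed.

(** The commutator acts on eta^t h by l + kappa + 2t; the factor is the sum of these numbers for t
    from 0 to j. *)
Lemma Delta_iter_eta l h (j : nat) : Hk l h ->
  Delta (iter j.+1 eta h) = (j.+1%:Z * (l + kappa + j%:Z))%:~R *: iter j eta h.
Proof.
move=> /HkE [ah dh]; elim: j => [|j IH].
  by rewrite /= (Delta_eta l) // dh linear0 add0r mul1r addr0.
rewrite iterS (Delta_eta (l + (2 * j.+1)%N%:Z)); last exact: Ak_iter_eta.
rewrite IH linearZ /= -scalerDl -intrD; congr (_%:~R *: _).
rewrite PoszM !intS; ring.
Qed.

Lemma iter_linear0 (A : {linear fn C n m -> fn C n m}) N : iter N A 0 = 0.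
Proof. by elim: N => //= N ->; rewrite linear0. Qed.
Lemma iter_linearP (A : {linear fn C n m -> fn C n m}) N c f g :
  iter N A (c *: f + g) = c *: iter N A f + iter N A g.
Proof. by elim: N => //= N ->; rewrite linearP. Qed.
Lemma iter_linear_sum (A : {linear fn C n m -> fn C n m}) N (I : Type) (t : seq I) (F : I -> fn C n m) :
  iter N A (\sum_(x <- t) F x) = \sum_(x <- t) iter N A (F x).
Proof. by elim: N => //= N ->; rewrite linear_sum. Qed.

Lemma iter_Delta_eta_gt l h (i j : nat) : Hk l h -> (i < j)%N -> iter j Delta (iter i eta h) = 0.
Proof.
move=> hh; elim: i j => [|i IH] [|j] // ij.
  by have /HkE [_ dh] := hh; rewrite iterSr /= dh (iter_linear0 Delta).
rewrite iterSr (Delta_iter_eta l) //; have := iter_linearP Delta j _ (iter i eta h) 0.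
move/(_ (i.+1%:Z * (l + kappa + i%:Z))%:~R); rewrite addr0 => ->.
by rewrite IH // (iter_linear0 Delta) scaler0 addr0.
Qed.

Lemma iter_Delta_eta l h (j : nat) : Hk l h -> (forall i : nat, (i < j)%N -> l + kappa + i%:Z != 0) ->
  exists2 c : C, c != 0 & iter j Delta (iter j eta h) = c *: h.
Proof.
move=> hh; elim: j => [_|j IH nz]; first by exists 1; rewrite ?oner_eq0 // scale1r.
have [c c0 E] := IH (fun (i : nat) ij => nz i (leqW ij)).
exists ((j.+1%:Z * (l + kappa + j%:Z))%:~R * c).
  by rewrite mulf_neq0 // intr_eq0 mulf_neq0 // nz.
rewrite iterSr (Delta_iter_eta l) //; have := iter_linearP Delta j _ (iter j eta h) 0.
move/(_ (j.+1%:Z * (l + kappa + j%:Z))%:~R); rewrite addr0 => ->.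
by rewrite E (iter_linear0 Delta) addr0 scalerA.
Qed.

(** Induction on the order of nilpotency: the last non-zero Delta^N f is a harmonic [h], and Delta^N
    eta^N h is a non-zero multiple of [h], so subtracting a multiple of eta^N h lowers the order.
    The top component is thus found first. *)
Lemma decomp_exists k f : k + kappa <= 1 -> Ak k f ->
  exists N (g : nat -> fn C n m), (forall i : nat, Hk (k - (2 * i)%N%:Z) (g i)) /\
    f = \sum_(i < N) iter i eta (g i).
Proof.
move=> kc ak; have [N fN] := Delta_nilp f (proj1 ak); exists N.
elim: N f ak fN => [|N IH] f ak fN.
  by exists (fun=> 0); split=> [i|]; [exact: Hk0|rewrite big_ord0].
set h := iter N Delta f.
have hh : Hk (k - (2 * N)%N%:Z) h by apply/HkE; split; [exact: Ak_iter_Delta|exact: fN].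
(* For i < N the factor is k - 2N + kappa + i <= -N < 0. *)
have [i iN|c c0 E] := iter_Delta_eta _ _ N hh; first by apply/eqP; lia.
pose h' := c^-1 *: h.
have hh' : Hk (k - (2 * N)%N%:Z) h' by exact: HkZ.
have [||g [gH gE]] := IH (f - iter N eta h').
- apply: AkB => //; rewrite -{1}(subrK ((2 * N)%N%:Z) k).
  by apply: Ak_iter_eta; case/HkE: hh'.
- have := iter_linearP Delta N (-1) (iter N eta h') f; rewrite scaleN1r addrC => ->.
  have := iter_linearP eta N c^-1 h 0; rewrite addr0 -/h' => ->.
  have := iter_linearP Delta N c^-1 (iter N eta h) (iter N eta 0) => ->.
  rewrite E !(iter_linear0 eta, iter_linear0 Delta) addr0 [c^-1 *: (c *: _)]scalerA mulVf // scale1r.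
  by rewrite scaleN1r addNr.
exists (fun i : nat => if i == N then h' else g i); split=> [i|].
  by case: eqP => [->|].
rewrite big_ord_recr /= eqxx -(subrK (iter N eta h') f) gE; congr (_ + _).
by apply: eq_bigr => i _; rewrite ltn_eqF.
Qed.

(** Applying Delta as often as the last component carries eta kills all the others and returns a
    non-zero multiple of the harmonic vector behind that one. *)
Lemma decomp_direct k N (g : nat -> fn C n m) : k + kappa <= 1 ->
  (forall i : nat, (i < N)%N -> Hk (k - (2 * i)%N%:Z) (g i)) ->
  \sum_(i < N) iter i eta (g i) = 0 -> forall i : nat, (i < N)%N -> g i = 0.
Proof.
move=> kc; elim: N => // N IH gH s0.
have gN : g N = 0.
  have [i iN|c c0 E] := iter_Delta_eta _ _ N (gH N (leqnn _)); first by apply/eqP; lia.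
  have := congr1 (iter N Delta) s0; rewrite (iter_linear0 Delta) (iter_linear_sum Delta) big_ord_recr /= E.
  rewrite big1 ?add0r => [/eqP|i _]; last exact: iter_Delta_eta_gt (gH i (leqW (ltn_ord i))) _.
  by rewrite scaler_eq0 (negbTE c0) => /eqP.
move=> i; rewrite ltnS leq_eqVlt => /orP[/eqP->//|]; apply: IH i.
  by move=> i iN; apply: gH; exact: leqW.
by move: s0; rewrite big_ord_recr /= gN (iter_linear0 eta) addr0.
Qed.

Lemma harmonic_eta0 k f : k + kappa <= 1 -> Ak (k - 2) f -> Delta (eta f) = 0 -> eta f = 0.
Proof.
move=> kc af df; have [||N [g [gH fE]]] := decomp_exists (k - 2) f; rewrite //; first by lia.
have hk : Hk k (eta f) by apply/HkE; split=> //; rewrite -(subrK 2 k); exact: Ak_eta.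
(* A relation among components: -eta f in the slot of H_<k>, and the decomposition of [f] shifted by
   one power of eta in the others. Directness kills the first slot. *)
pose g' (i : nat) := if i is i'.+1 then g i' else - eta f.
have g'0 : g' 0 = 0.
  apply: (decomp_direct k N.+1 g') => // [[|i] iN|] //.
  - by rewrite muln0 subr0 /= -scaleN1r; exact: HkZ.
  - by have := gH i; rewrite (_ : k - 2 - (2 * i)%N%:Z = k - (2 * i.+1)%N%:Z) //; lia.
  - by rewrite big_ord_recl /= fE linear_sum addNr.
by apply/eqP; rewrite -oppr_eq0; apply/eqP.
Qed.

End Decomposition.

(** * Uniqueness of singular vectors *)

Section Singular.
Variables (C : numClosedFieldType) (n m n1 n2 : nat).
Hypotheses (n12 : (n1 <= n2)%N) (n2n : (n2 <= n)%N).
Implicit Types (i j : 'I_n) (r s : 'I_m) (f g h : fn C n m) (mu nu : mon n m) (k l : int).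
Local Notation mulx := (mulx C n m).
Local Notation muly := (muly C n m).
Local Notation dx := (dx C n m).
Local Notation dy := (dy C n m).
Local Notation multh := (multh C n m).
Local Notation mulvt := (mulvt C n m).
Local Notation dth := (dth C n m).
Local Notation dvt := (dvt C n m).
Local Notation Delta := (Delta C n m n1 n2).
Local Notation Ak := (Ak C n m n1 n2).
Local Notation polyw := (polyw C n m).
Local Notation wt := (wt n m).
Local Notation kappa := (kappa m n1 n2).
Local Notation diag := (diag C n m).

Definition mid i := (n1 <= i < n2)%N.
(* For an outer index i, u_i is x_i or y_i, whichever sigma exchanges with its derivative,
   and v_i is the other one. *)
Definition mulu i := if (i < n1)%N then mulx i else muly i.
Definition mulv i := if (i < n1)%N then muly i else mulx i.
Definition du i := if (i < n1)%N then dx i else dy i.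
Definition dv i := if (i < n1)%N then dy i else dx i.

(** Partial degrees: [eu] in the u's, [ev] in the v's, [em] in the middle and odd variables
    together, [ex] in the middle x's, [eo] in the odd ones. The degree is [ev + em - eu]. *)
Definition eu := wt (fun i => (i < n1)%N%:Z) (fun i => (n2 <= i)%N%:Z) 0.
Definition ev := wt (fun i => (n2 <= i)%N%:Z) (fun i => (i < n1)%N%:Z) 0.
Definition em := wt (fun i => (mid i)%:Z) (fun i => (mid i)%:Z) 1.
Definition ex := wt (fun i => (mid i)%:Z) (fun=> 0) 0.
Definition eo := wt (fun=> 0) (fun=> 0) 1.

Lemma eu_ge0 mu : 0 <= eu mu. Proof. exact: wt_ge0. Qed.
Lemma ev_ge0 mu : 0 <= ev mu. Proof. exact: wt_ge0. Qed.
Lemma ex_ge0 mu : 0 <= ex mu. Proof. exact: wt_ge0. Qed.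
Lemma eo_ge0 mu : 0 <= eo mu. Proof. exact: wt_ge0. Qed.
Lemma em_ge mu : ex mu + eo mu <= em mu.
Proof.
rewrite -wtD /em; pose z : 'I_n -> int := fun i => 0.
have -> : wt (fun i => (mid i)%:Z) (fun i => (mid i)%:Z) 1 mu =
  wt (fun i => ((mid i)%:Z + 0) + 0) (fun i => 0 + 0 + (mid i)%:Z) (0 + 1 + 0) mu.
  by apply: wt_eq => i; rewrite ?add0r ?addr0.
by rewrite [leRHS]wtD lerDl; apply: wt_ge0.
Qed.

Lemma deg_split mu : deg n m n1 n2 mu + eu mu = ev mu + em mu.
Proof.
rewrite degE // -!wtD addr0 add0r; apply: wt_eq => i; rewrite /dgx /dgy /mid.
  by case: (ltnP i n1) => h1; case: (leqP n2 i) => h2 //=; exfalso; lia.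
by case: (ltnP i n1) => h1; case: (leqP n2 i) => h2 //=; exfalso; lia.
Qed.

Lemma mulu_duE f : \sum_(i | ~~ mid i) mulu i (du i f) = diag eu f.
Proof.
apply/funext => -[[[a b] S] T]; rewrite fn_sum /diag /eu /wt mul0r addr0 -big_split /=.
rewrite rmorph_sum mulr_suml [LHS]big_mkcond /=; apply: eq_bigr => i _.
rewrite /mulu /du /mid; case: ltnP => h1; case: leqP => h2 /=;
  rewrite ?(mulx_dxE, muly_dyE) ?mul0r ?mul1r ?add0r ?addr0 //; try (exfalso; lia).
Qed.

Definition Dmid f := \sum_(i | mid i) dx i (dy i f) + \sum_r dth r (dvt r f).

Lemma Delta_mid f : Delta f = Dmid f - \sum_(i | ~~ mid i) mulu i (dv i f).
Proof.
rewrite DeltaE // (bigID mid) /= addrAC -sumrN; congr (_ + _ + _); apply: eq_bigr => i.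
  by move=> /andP[h1 h2]; rewrite /Defs.sdx /Defs.sdy !ifF //; lia.
rewrite /mid /Defs.sdx /Defs.sdy /mulu /dv => hi.
case: ltnP hi => h1; case: leqP => h2 //= _; rewrite ?foppE ?linearN /= ?dx_muly //.
by exfalso; lia.
Qed.

Lemma sum_dx_mulx h : \sum_(i | mid i) dx i (mulx i h) = diag (fun mu => ex mu + (n2 - n1)%N%:Z) h.
Proof.
apply/funext => -[[[a b] S] T]; rewrite fn_sum /diag /ex /wt mul0r addr0.
rewrite [X in _ + X + _]big1 ?addr0; last by move=> i _; rewrite mul0r.
rewrite -(card_mid n n1 n2) ?n12 // -sum1_card (eq_bigr (fun i => (mid i * a i)%N%:Z)); last first.
  by move=> i _; rewrite PoszM.
rewrite Posz_sum [X in _ + X]big_mkcond -big_split /= rmorph_sum mulr_suml [LHS]big_mkcond /=.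
apply: eq_bigr => i _; rewrite inE -/(mid i); case: ifP => _ //=.
  by rewrite dx_mulxE mul1n natrD rmorphD.
by rewrite !mul0n add0r mul0r.
Qed.

Lemma dxE i h (a b : {ffun 'I_n -> nat}) (S T : {set 'I_m}) :
  dx i h (a, b, S, T) = ((a i).+1)%:R * h (incr n a i, b, S, T).
Proof. by []. Qed.
Lemma dyE i h (a b : {ffun 'I_n -> nat}) (S T : {set 'I_m}) :
  dy i h (a, b, S, T) = ((b i).+1)%:R * h (a, incr n b i, S, T).
Proof. by []. Qed.

(* Not the whole nilradical: only the positive root vectors needed below are listed. *)
Record singular f : Prop := Singular {
  sing_x : forall i (r : 'I_n), ~~ mid i -> mid r -> du i (dx r f) = muly r (dv i f);
  sing_y : forall i (r : 'I_n), ~~ mid i -> mid r -> du i (dy r f) = mulx r (dv i f);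
  sing_th : forall i r, ~~ mid i -> du i (dth r f) = mulvt r (dv i f);
  sing_vt : forall i r, ~~ mid i -> du i (dvt r f) = - multh r (dv i f);
  sing_u : forall i0 i : 'I_n, (i0 < n1)%N -> i0 = 0%N :> nat -> ~~ mid i -> i != i0 ->
    mulu i0 (du i f) = - mulv i0 (dv i f);
  sing_xth : forall i r, mid i -> mulx i (dth r f) = mulvt r (dy i f);
  sing_xvt : forall i r, mid i -> mulx i (dvt r f) = - multh r (dy i f);
  sing_xx : forall i0 i : 'I_n, mid i0 -> i0 = n1 :> nat -> mid i -> i != i0 ->
    mulx i0 (dx i f) = muly i (dy i0 f)
}.

Lemma mulu_muly i (r : 'I_n) h : ~~ mid i -> mid r -> mulu i (muly r h) = muly r (mulu i h).
Proof. by rewrite /mulu; case: ifP; rewrite ?mulx_muly // muly_muly. Qed.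
Lemma mulu_mulx i (r : 'I_n) h : ~~ mid i -> mid r -> mulu i (mulx r h) = mulx r (mulu i h).
Proof. by rewrite /mulu; case: ifP; rewrite ?mulx_muly // mulx_mulx. Qed.
Lemma mulu_multh i r h : mulu i (multh r h) = multh r (mulu i h).
Proof. by rewrite /mulu; case: ifP; rewrite ?mulx_multh ?muly_multh. Qed.
Lemma mulu_mulvt i r h : mulu i (mulvt r h) = mulvt r (mulu i h).
Proof. by rewrite /mulu; case: ifP; rewrite ?mulx_mulvt ?muly_mulvt. Qed.
Lemma muluN i h : mulu i (- h) = - mulu i h.
Proof. by rewrite /mulu; case: ifP => _; rewrite linearN. Qed.

Variables (k : int) (f : fn C n m).
Hypotheses (kc : k + kappa <= 1) (fk : Ak k f) (Df : Delta f = 0) (sf : singular f).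

Lemma Dmid_sing : \sum_(i | ~~ mid i) mulu i (dv i f) = Dmid f.
Proof. by apply/eqP; rewrite eq_sym -subr_eq0 -Delta_mid Df. Qed.

Lemma eu_dx (r : 'I_n) : mid r -> diag eu (dx r f) = muly r (Dmid f).
Proof.
move=> hr; rewrite -mulu_duE -Dmid_sing linear_sum; apply: eq_bigr => i hi.
by rewrite (sing_x _ sf) // mulu_muly.
Qed.
Lemma eu_dy (r : 'I_n) : mid r -> diag eu (dy r f) = mulx r (Dmid f).
Proof.
move=> hr; rewrite -mulu_duE -Dmid_sing linear_sum; apply: eq_bigr => i hi.
by rewrite (sing_y _ sf) // mulu_mulx.
Qed.
Lemma eu_dth r : diag eu (dth r f) = mulvt r (Dmid f).
Proof.
rewrite -mulu_duE -Dmid_sing linear_sum; apply: eq_bigr => i hi.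
by rewrite (sing_th _ sf) // mulu_mulvt.
Qed.
Lemma eu_dvt r : diag eu (dvt r f) = - multh r (Dmid f).
Proof.
rewrite -mulu_duE -Dmid_sing linear_sum -sumrN; apply: eq_bigr => i hi.
by rewrite (sing_vt _ sf) // muluN mulu_multh.
Qed.

Lemma mid_n1 (r : 'I_n) : mid r -> (r < n1)%N%:Z = 0. Proof. by case/andP => h _; rewrite ltnNge h. Qed.
Lemma mid_n2 (r : 'I_n) : mid r -> (n2 <= r)%N%:Z = 0. Proof. by case/andP => _ h; rewrite leqNgt h. Qed.

Lemma diagD (w : mon n m -> int) g h : diag w (g + h) = diag w g + diag w h.
Proof. by apply/funext => mu; rewrite /diag !fnD mulrDr. Qed.
Lemma diagN (w : mon n m -> int) g : diag w (- g) = - diag w g.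
Proof. by apply/funext => mu; rewrite /diag !fnN mulrN. Qed.
Lemma diag_sum (w : mon n m -> int) (I : Type) (t : seq I) (P : pred I) (F : I -> fn C n m) :
  diag w (\sum_(x <- t | P x) F x) = \sum_(x <- t | P x) diag w (F x).
Proof.
apply: (big_morph (diag w) (diagD w)); by apply/funext => mu; rewrite /diag mulr0.
Qed.

(** Differentiating each equation along the partner variable yields every term of [Dmid f] twice,
    once per member of the pair, whence the factor 2; the derivatives pass through [diag eu] because
    middle and odd variables have [eu]-weight zero. The odd terms get their minus sign from
    [sing_vt] in one half and from anticommuting derivations in the other. *)
Lemma eu_Dmid : diag eu (Dmid f) *+ 2 =
  \sum_(i | mid i) (dx i (mulx i (Dmid f)) + dy i (muly i (Dmid f)))
  - \sum_r (dth r (multh r (Dmid f)) + dvt r (mulvt r (Dmid f))).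
Proof.
rewrite mulr2n {1 2}/Dmid diagD !diag_sum addrACA -!big_split -sumrN /=; congr (_ + _).
  apply: eq_bigr => i hi; rewrite -{1}(dx_diag C n m _ _ _ i) ?mid_n1 //.
  rewrite eu_dy //; congr (_ + _).
  by rewrite dx_dy -(dy_diag C n m _ _ _ i) ?mid_n2 // eu_dx.
apply: eq_bigr => r _; rewrite -{1}dth_diag // eu_dvt linearN opprD; congr (_ + _).
by rewrite -[dth r _]opprK -dvt_dth diagN -dvt_diag // eu_dth.
Qed.

Lemma Ak_dx_mid l i g : mid i -> Ak l g -> Ak (l - 1) (dx i g).
Proof. by move=> /andP[h _]; have := Ak_sdx C n m n1 n2 i l g; rewrite /Defs.sdx ltnNge h. Qed.
Lemma Ak_dy_mid l i g : mid i -> Ak l g -> Ak (l - 1) (dy i g).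
Proof. by move=> /andP[_ h]; have := Ak_sdy C n m n1 n2 i l g; rewrite /Defs.sdy leqNgt h. Qed.
Lemma Ak_Dodd : Ak (k - 2) (\sum_r dth r (dvt r f)).
Proof.
have -> : k - 2 = k - 1 - 1 by ring.
by apply: Ak_sum => x hx; apply: Ak_dth; exact: Ak_dvt.
Qed.
Lemma Ak_Dmid : Ak (k - 2) (Dmid f).
Proof.
apply: AkD; last exact: Ak_Dodd.
have -> : k - 2 = k - 1 - 1 by ring.
by apply: Ak_sum => x hx; apply: Ak_dx_mid => //; exact: Ak_dy_mid.
Qed.

(** On a monomial of [Dmid f] the doubled identity reads 2 eu = em + 2 kappa, whereas degree k - 2
    gives eu = ev + em - k + 2. Hence 2 ev + em = 2 (k + kappa) - 4, which is negative. *)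
Lemma Dmid0 : Dmid f = 0.
Proof.
apply/funext => mu; apply/eqP; apply: contraT => nz.
have dmu := proj2 Ak_Dmid mu nz.
have := congr1 (fun F : fn C n m => F mu) eu_Dmid.
have : em mu = em mu by [].
move: (deg_split mu) (ev_ge0 mu) (em_ge mu) (ex_ge0 mu) (eo_ge0 mu).
rewrite dmu => ds e1 e2 e3 e4 _.
have -> : (diag eu (Dmid f) *+ 2) mu = (eu mu * 2)%:~R * Dmid f mu.
  by rewrite mulr2n fnD /diag rmorphM /=; ring.
have -> : (\sum_(i | mid i) (dx i (mulx i (Dmid f)) + dy i (muly i (Dmid f)))
  - \sum_r (dth r (multh r (Dmid f)) + dvt r (mulvt r (Dmid f)))) mu
   = (em mu + 2 * (n2 - n1)%N%:Z - 2 * m%:Z)%:~R * Dmid f mu.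
  clear -n12 n2n; case: mu => [[[a b] S] T]; set g := Dmid f.
  have E1 : \sum_(i | mid i) (dx i (mulx i g) + dy i (muly i g)) (a, b, S, T) =
      (\sum_i (mid i)%:Z * (a i)%:Z + \sum_i (mid i)%:Z * (b i)%:Z
        + 2 * (n2 - n1)%N%:Z)%:~R * g (a, b, S, T).
    rewrite -(card_mid n n1 n2) ?n12 // -(sum1_card [pred i : 'I_n | (n1 <= i < n2)%N]).
    rewrite Posz_sum mulr_sumr [in RHS](big_mkcond (fun i => i \in _)) /= -!big_split /=.
    rewrite rmorph_sum mulr_suml [LHS]big_mkcond /=; apply: eq_bigr => i _.
    rewrite inE -/(mid i); case: ifP => _ /=; last by rewrite !mul0r.
    by rewrite fnD dx_mulxE dy_mulyE !mul1r !natrD; ring.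
  have E2 : \sum_r (dth r (multh r g) + dvt r (mulvt r g)) (a, b, S, T) =
      (2 * m%:Z - (#|S| + #|T|)%:Z)%:~R * g (a, b, S, T).
    under eq_bigr do rewrite fnD dth_multhE dvt_mulvtE.
    rewrite big_split /= -!mulr_suml !sumrB !sum_mem !sumr_const !card_ord.
    by rewrite PoszD; ring.
  rewrite fnD fnN !fn_sum E1 E2 -mulrBl -rmorphB /em /wt; congr (_%:~R * _); ring.
move=> /(mulIf nz) /eqP; rewrite eqr_int => /eqP.
move: kc; rewrite /kappa; lia.
Qed.

Lemma eu_or_dx (r : 'I_n) mu : mid r -> eu mu != 0 -> dx r f mu = 0.
Proof.
move=> hr emu; have := congr1 (fun F : fn C n m => F mu) (eu_dx r hr).
by rewrite Dmid0 linear0 /diag => /eqP; rewrite mulf_eq0 intr_eq0 (negbTE emu) => /eqP.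
Qed.
Lemma eu_or_dy (r : 'I_n) mu : mid r -> eu mu != 0 -> dy r f mu = 0.
Proof.
move=> hr emu; have := congr1 (fun F : fn C n m => F mu) (eu_dy r hr).
by rewrite Dmid0 linear0 /diag => /eqP; rewrite mulf_eq0 intr_eq0 (negbTE emu) => /eqP.
Qed.
Lemma eu_or_dth r mu : eu mu != 0 -> dth r f mu = 0.
Proof.
move=> emu; have := congr1 (fun F : fn C n m => F mu) (eu_dth r).
by rewrite Dmid0 linear0 /diag => /eqP; rewrite mulf_eq0 intr_eq0 (negbTE emu) => /eqP.
Qed.
Lemma eu_or_dvt r mu : eu mu != 0 -> dvt r f mu = 0.
Proof.
move=> emu; have := congr1 (fun F : fn C n m => F mu) (eu_dvt r).
by rewrite Dmid0 linear0 oppr0 /diag => /eqP; rewrite mulf_eq0 intr_eq0 (negbTE emu) => /eqP.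
Qed.

Variable r0 : 'I_n.
Hypothesis r0E : r0 = n1 :> nat.
Hypothesis r0mid : mid r0.

(** After multiplication by y_(n1+1), which is injective, [dv i f] becomes [du i (dx r0 f)]. A
    u-derivative only looks up monomials containing that u, where [eu] is positive and [dx r0 f]
    vanishes. *)
Lemma dv0 i : ~~ mid i -> dv i f = 0.
Proof.
move=> hi; apply: (muly_inj C n m r0); rewrite -(sing_x _ sf) //.
apply/funext => -[[[a b] S] T]; rewrite /du; case: ltnP => hi1.
  rewrite dxE eu_or_dx ?mulr0 //.
  by have := eu_ge0 (a, b, S, T); rewrite /eu wt_incrx hi1; lia.
have h2 : (n2 <= i)%N by move: hi; rewrite /mid; lia.
rewrite dyE eu_or_dx ?mulr0 //.
by have := eu_ge0 (a, b, S, T); rewrite /eu wt_incry h2; lia.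
Qed.

Lemma ev_supp mu : f mu != 0 -> ev mu = 0.
Proof.
case: mu => [[[a b] S] T] nz; rewrite /ev /wt mul0r addr0 !big1 ?addr0 // => i _.
  case: (ltnP i n1) => hi; last by rewrite mul0r.
  have := dv0 i; rewrite /dv hi /mid => H; rewrite (dy0 C n m i f a b S T) ?mulr0 // H //; lia.
case: (leqP n2 i) => hi; last by rewrite mul0r.
have hi1 : (i < n1)%N = false by lia.
have := dv0 i; rewrite /dv hi1 /mid => H; rewrite (dx0 C n m i f a b S T) ?mulr0 // H //; lia.
Qed.

(** Removing a middle or odd variable does not change [eu]; so a monomial of [f] mixing such a
    variable with some u would survive in a derivative that vanishes wherever [eu] is non-zero. *)
Lemma eu_em_supp mu : f mu != 0 -> (eu mu == 0) || (em mu == 0).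
Proof.
case: mu => [[[a b] S] T] nz; have [//|e0] := eqVneq (eu _) 0; apply/eqP => /=.
have hx i : mid i -> a i = 0%N.
  move=> hi; case: (posnP (a i)) => // ai.
  have := dxE_decr C n m i f a b S T ai; rewrite eu_or_dx //; last first.
    by move: e0; rewrite -{1}(decrK n a i ai) /eu wt_incrx mid_n1 // addr0.
  by move/esym/eqP; rewrite mulf_eq0 pnatr_eq0 (negbTE nz) orbF => /eqP.
have hy i : mid i -> b i = 0%N.
  move=> hi; case: (posnP (b i)) => // ai.
  have := dyE_decr C n m i f a b S T ai; rewrite eu_or_dy //; last first.
    by move: e0; rewrite -{1}(decrK n b i ai) /eu wt_incry mid_n2 // addr0.
  by move/esym/eqP; rewrite mulf_eq0 pnatr_eq0 (negbTE nz) orbF => /eqP.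
have hS : S = set0.
  apply/setP => r; rewrite inE; apply/negP => rS.
  have := dthE_rem C n m r f a b S T rS; rewrite eu_or_dth //.
  by move/esym/eqP; rewrite mulf_eq0 (negbTE (sgn_neq0 _ _)) (negbTE nz).
have hT : T = set0.
  apply/setP => r; rewrite inE; apply/negP => rS.
  have := dvtE_rem C n m r f a b S T rS; rewrite eu_or_dvt //.
  by move/esym/eqP; rewrite mulf_eq0 (negbTE (sgn_neq0 _ _)) (negbTE nz).
rewrite /em /wt hS hT cards0 mulr0 addr0 !big1 ?addr0 // => i _.
  by case: (boolP (mid i)) => [/hy->|]; rewrite ?mulr0 ?mul0r.
by case: (boolP (mid i)) => [/hx->|]; rewrite ?mulr0 ?mul0r.
Qed.

Lemma em0_supp a b S T : em (a, b, S, T) = 0 ->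
  [/\ forall i, mid i -> a i = 0%N, forall i, mid i -> b i = 0%N, S = set0 & T = set0].
Proof.
rewrite /em /wt mul1r => E.
have px : 0 <= \sum_i (mid i)%:Z * (a i)%:Z by apply: sumr_ge0 => i _; rewrite mulr_ge0.
have py : 0 <= \sum_i (mid i)%:Z * (b i)%:Z by apply: sumr_ge0 => i _; rewrite mulr_ge0.
have ex0 : \sum_i (mid i)%:Z * (a i)%:Z = 0 by lia.
have ey0 : \sum_i (mid i)%:Z * (b i)%:Z = 0 by lia.
split.
- move=> i hi; move/eqP: ex0; rewrite psumr_eq0 => [/allP/(_ i)|j _]; last by rewrite mulr_ge0.
  by rewrite mem_index_enum hi mul1r => /(_ isT) /eqP [].
- move=> i hi; move/eqP: ey0; rewrite psumr_eq0 => [/allP/(_ i)|j _]; last by rewrite mulr_ge0.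
  by rewrite mem_index_enum hi mul1r => /(_ isT) /eqP [].
- by apply/eqP; rewrite -cards_eq0; lia.
- by apply/eqP; rewrite -cards_eq0; lia.
Qed.

Lemma eu0_supp a b S T : eu (a, b, S, T) = 0 ->
  (forall i, (i < n1)%N -> a i = 0%N) /\ (forall i, (n2 <= i)%N -> b i = 0%N).
Proof.
rewrite /eu /wt mul0r addr0 /= => E.
have px : 0 <= \sum_(i < n) (i < n1)%N%:Z * (a i)%:Z by apply: sumr_ge0 => i _; rewrite mulr_ge0.
have py : 0 <= \sum_(i < n) (n2 <= i)%N%:Z * (b i)%:Z by apply: sumr_ge0 => i _; rewrite mulr_ge0.
have /andP[/eqP ex0 /eqP ey0] := etrans (esym (paddr_eq0 px py)) (introT eqP E).
split.
- move=> i hi; move/eqP: ex0; rewrite psumr_eq0 => [/allP/(_ i)|j _]; last by rewrite mulr_ge0.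
  by rewrite mem_index_enum hi mul1r => /(_ isT) /eqP [].
- move=> i hi; move/eqP: ey0; rewrite psumr_eq0 => [/allP/(_ i)|j _]; last by rewrite mulr_ge0.
  by rewrite mem_index_enum hi mul1r => /(_ isT) /eqP [].
Qed.

Lemma dv_supp a b S T : f (a, b, S, T) != 0 ->
  (forall i, (i < n1)%N -> b i = 0%N) /\ (forall i, (n2 <= i)%N -> a i = 0%N).
Proof.
move=> nz; split=> i hi.
  have H := dv0 i; rewrite /dv hi /mid in H; apply: dy0 (H _) nz; lia.
have hi1 : (i < n1)%N = false by lia.
have H := dv0 i; rewrite /dv hi1 /mid in H; apply: dx0 (H _) nz; lia.
Qed.

Variable i0 : 'I_n.
Hypotheses (i0E : i0 = 0%N :> nat) (n1_gt0 : (0 < n1)%N).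

Lemma du0 i : ~~ mid i -> i != i0 -> du i f = 0.
Proof.
move=> hi ii0; have := sing_u _ sf i0 i; rewrite i0E => /(_ n1_gt0 erefl hi ii0).
rewrite dv0 // /mulu /mulv i0E n1_gt0 linear0 oppr0; exact: mulx_inj.
Qed.

Definition expo (j : 'I_n) (e : nat) : {ffun 'I_n -> nat} := [ffun i => if i == j then e else 0%N].
Definition vac (j : 'I_n) (e : nat) : mon n m := (expo j e, [ffun=> 0%N], set0, set0).

(** Only the exponent is left, and the degree determines it, since every x_j has degree 1 or -1. *)
Lemma vac_eq j a b S T : f (a, b, S, T) != 0 -> (forall i, i != j -> a i = 0%N) ->
  (forall i, b i = 0%N) -> S = set0 -> T = set0 -> (a, b, S, T) = vac j `|k|%N.
Proof.
move=> nz ha hb hS hT; subst S T; rewrite /vac; congr (_, _, _, _); last first.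
  by apply/ffunP => i; rewrite ffunE hb.
have := proj2 fk _ nz; rewrite degE // /wt (bigD1 j) //= big1 ?addr0; last first.
  by move=> i /ha->; rewrite mulr0.
rewrite big1 ?cards0 ?addn0 ?mulr0 ?addr0; last by move=> i _; rewrite hb mulr0.
rewrite /dgx => E; apply/ffunP => i; rewrite ffunE; case: eqP => [->|/eqP/ha//].
by move: E; case: ifP => _; rewrite ?mul1r ?mulN1r => <-; rewrite ?abszN absz_nat.
Qed.

(** With [ev = 0] the degree is k = em - eu, and one of the two vanishes; for k <= 0 this forces em
    = 0. What remains involves only u's, and all u-derivatives but the one for [i0] are zero. *)
Lemma singular_le0 mu : k <= 0 -> f mu != 0 -> mu = vac i0 `|k|%N.
Proof.
case: mu => [[[a b] S] T] k0 nz.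
have ds := deg_split (a, b, S, T); rewrite (proj2 fk _ nz) (ev_supp _ nz) in ds.
have em0 : em (a, b, S, T) = 0.
  have := eu_em_supp _ nz; have := eu_ge0 (a, b, S, T); have := em_ge (a, b, S, T).
  have := ex_ge0 (a, b, S, T); have := eo_ge0 (a, b, S, T); lia.
have [ha hb hS hT] := em0_supp _ _ _ _ em0; have [hb' ha'] := dv_supp _ _ _ _ nz.
apply: vac_eq => // i.
  move=> ii0; case: (boolP (mid i)) => [/ha//|hi]; have H := du0 i hi ii0.
  case: (leqP n2 i) => [/ha'//|h2]; have h1 : (i < n1)%N by move: hi; rewrite /mid; lia.
  by rewrite /du h1 in H; apply: dx0 H nz.
case: (boolP (mid i)) => [/hb//|hi]; case: (ltnP i n1) => [/hb'//|h1].
have ii0 : i != i0 by apply: contraTneq h1 => ->; rewrite i0E -ltnNge.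
have H := du0 i hi ii0; rewrite /du ltnNge h1 in H; exact: dy0 H nz.
Qed.

(** * Singular vectors in positive degree *)

Section Positive.
Hypothesis k_gt0 : 0 < k.

Lemma eu_zero mu : f mu != 0 -> eu mu = 0.
Proof.
move=> nz; have ds := deg_split mu; rewrite (proj2 fk _ nz) (ev_supp _ nz) in ds.
have := eu_em_supp _ nz; have := eu_ge0 mu; lia.
Qed.

Definition Dodd f := \sum_r dth r (dvt r f).

Lemma Dodd_mid : \sum_(i | mid i) dx i (dy i f) = - Dodd f.
Proof. by apply/eqP; rewrite -addr_eq0; apply/eqP; exact: Dmid0. Qed.

Local Notation exn := (fun mu => ex mu + (n2 - n1)%N%:Z).

(** Here the singular equations multiply by a middle x instead of differentiating, so it is [dx i]
    that must be applied before summing. The Euler operator therefore appears with the shift n2 -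
    n1, which makes it injective ([diag_exn0]) and finally allows dividing by it. *)
Lemma ex_dth r : diag exn (dth r f) = - mulvt r (Dodd f).
Proof.
rewrite -sum_dx_mulx -linearN -Dodd_mid linear_sum; apply: eq_bigr => i hi.
by rewrite (sing_xth _ sf) // dx_mulvt.
Qed.
Lemma ex_dvt r : diag exn (dvt r f) = multh r (Dodd f).
Proof.
rewrite -sum_dx_mulx -[Dodd f]opprK -Dodd_mid linearN linear_sum -sumrN; apply: eq_bigr => i hi.
by rewrite (sing_xvt _ sf) // linearN /= dx_multh.
Qed.

Lemma diag_exnE h : diag exn h = diag ex h + (n2 - n1)%N%:R *: h.
Proof. by apply/funext => mu; rewrite fnD fnZ /diag rmorphD /= mulrDl. Qed.
Lemma exn_dth r h : dth r (diag exn h) = diag exn (dth r h).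
Proof. by rewrite !diag_exnE linearD linearZ /= dth_diag. Qed.
Lemma exn_dvt r h : dvt r (diag exn h) = diag exn (dvt r h).
Proof. by rewrite !diag_exnE linearD linearZ /= dvt_diag. Qed.

Lemma ex_Dodd : diag exn (Dodd f) *+ 2 =
  \sum_r (dth r (multh r (Dodd f)) + dvt r (mulvt r (Dodd f))).
Proof.
rewrite mulr2n {1 2}/Dodd !diag_sum -big_split /=; apply: eq_bigr => r _.
rewrite -{1}exn_dth ex_dvt; congr (_ + _).
by rewrite -[dth r _]opprK -dvt_dth diagN -exn_dvt ex_dth linearN opprK.
Qed.

Lemma Dodd_eu0 mu : Dodd f mu != 0 -> eu mu = 0.
Proof.
have pf : polyw (fun mu => wt (fun i => (i < n1)%N%:Z) (fun i => (n2 <= i)%N%:Z) 0 mu = 0) f.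
  by split; [case: fk|exact: eu_zero].
move=> nz; suff /(_ mu nz) : forall mu, Dodd f mu != 0 -> eu mu = 0 by [].
apply: (proj2 (polyw_sum C n m (fun mu => eu mu = 0) _ _ _ _ _)) => r _.
by apply: (polyw_shift2 (fun z => z = 0) (fun z => z = 0)
  (shifts_dth _ _ _ _) (shifts_dvt _ _ _ _) pf) => z ->.
Qed.

(** On a monomial of [Dodd f] the identity [ex_Dodd] gives 2 ex + eo = -2 kappa. Since [eu = 0]
    there, k - 2 = ev + em >= ex + eo; doubling yields 2 (k + kappa) >= 4 + eo, against k + kappa <=
    1. *)
Lemma Dodd0 : Dodd f = 0.
Proof.
apply/funext => mu; apply/eqP; apply: contraT => nz.
have dmu := proj2 Ak_Dodd mu nz; have eu0 := Dodd_eu0 mu nz.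
have := congr1 (fun F : fn C n m => F mu) ex_Dodd.
move: (deg_split mu) (ev_ge0 mu) (em_ge mu) (ex_ge0 mu) (eo_ge0 mu).
rewrite dmu eu0 => ds e1 e2 e3 e4.
have -> : (diag exn (Dodd f) *+ 2) mu = ((ex mu + (n2 - n1)%N%:Z) * 2)%:~R * Dodd f mu.
  by rewrite mulr2n fnD /diag [in RHS]rmorphM /=; ring.
have -> : (\sum_r (dth r (multh r (Dodd f)) + dvt r (mulvt r (Dodd f)))) mu
   = (2 * m%:Z - eo mu)%:~R * Dodd f mu.
  clear; case: mu => [[[a b] S] T]; set g := Dodd f; rewrite fn_sum.
  under eq_bigr do rewrite fnD dth_multhE dvt_mulvtE.
  rewrite big_split /= -!mulr_suml !sumrB !sum_mem !sumr_const !card_ord.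
  rewrite /eo /wt !big1 ?add0r; try by move=> i _; rewrite mul0r.
  by rewrite mul1r PoszD; ring.
move=> /(mulIf nz) /eqP; rewrite eqr_int => /eqP.
move: kc; rewrite /kappa; lia.
Qed.

Lemma exn_neq0 mu : ex mu + (n2 - n1)%N%:Z != 0.
Proof. by have := ex_ge0 mu; move: r0mid; rewrite /mid; lia. Qed.

Lemma diag_exn0 h : diag exn h = 0 -> h = 0.
Proof.
move=> E; apply/funext => mu; have /eqP := congr1 (fun F : fn C n m => F mu) E.
by rewrite /diag mulf_eq0 intr_eq0 (negbTE (exn_neq0 mu)) => /eqP.
Qed.
Lemma dth_f0 r : dth r f = 0.
Proof. by apply: diag_exn0; rewrite ex_dth Dodd0 linear0 oppr0. Qed.
Lemma dvt_f0 r : dvt r f = 0.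
Proof. by apply: diag_exn0; rewrite ex_dvt Dodd0 linear0. Qed.

Variable s0 : 'I_m.

(** Any one odd index recovers [dy i f] from the relation vartheta d/dvartheta + d/dvartheta
    vartheta = 1: [sing_xth] turns vartheta times [dy i f] into x_i times [dth s0 f], which is zero,
    and the other term vanishes with [dvt s0 f]. *)
Lemma dy_f0 i : mid i -> dy i f = 0.
Proof.
move=> hi; have := dvt_mulvt C n m s0 s0 (dy i f).
by rewrite eqxx -(sing_xth _ sf) // dth_f0 -dy_dvt dvt_f0 !linear0 addr0 => <-.
Qed.

Lemma dx_f0 i : mid i -> i != r0 -> dx i f = 0.
Proof.
move=> hi ir; apply: (mulx_inj C n m r0).
by rewrite (sing_xx _ sf) // dy_f0 // linear0.
Qed.

Lemma singular_gt0 mu : f mu != 0 -> mu = vac r0 `|k|%N.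
Proof.
case: mu => [[[a b] S] T] nz; have [hb' ha'] := dv_supp _ _ _ _ nz.
have [ha hb] := eu0_supp _ _ _ _ (eu_zero _ nz).
apply: vac_eq => // [i ir|i||].
- case: (boolP (mid i)) => [hi|]; first exact: dx0 (dx_f0 i hi ir) nz.
  by rewrite /mid; case: (ltnP i n1) => [/ha//|_]; case: (ltnP i n2) => // /ha'.
- case: (boolP (mid i)) => [hi|]; first exact: dy0 (dy_f0 i hi) nz.
  by rewrite /mid; case: (ltnP i n1) => [/hb'//|_]; case: (ltnP i n2) => // /hb.
- by apply/setP => r; rewrite inE; apply: negbTE; exact: dth0 (dth_f0 r) nz.
- by apply/setP => r; rewrite inE; apply: negbTE; exact: dvt0 (dvt_f0 r) nz.
Qed.
End Positive.

End Singular.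

(** * Existence of singular vectors in submodules *)

Section Descent.
Variables (C : numClosedFieldType) (n m n1 n2 : nat).
Hypotheses (n12 : (n1 <= n2)%N) (n2n : (n2 <= n)%N).
Implicit Types (i j : 'I_n) (r s : 'I_m) (f g h : fn C n m) (mu nu : mon n m) (k l : int).
Local Notation mulx := (mulx C n m).
Local Notation muly := (muly C n m).
Local Notation dx := (dx C n m).
Local Notation dy := (dy C n m).
Local Notation multh := (multh C n m).
Local Notation mulvt := (mulvt C n m).
Local Notation dth := (dth C n m).
Local Notation dvt := (dvt C n m).
Local Notation sx := (sx C n m n1).
Local Notation sdx := (sdx C n m n1).
Local Notation sy := (sy C n m n2).
Local Notation sdy := (sdy C n m n2).
Local Notation Hk := (Hk C n m n1 n2).
Local Notation polyw := (polyw C n m).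
Local Notation wt := (wt n m).
Local Notation mid := (mid n n1 n2).
Local Notation du := (du C n m n1).
Local Notation dv := (dv C n m n1).
Local Notation mulu := (mulu C n m n1).
Local Notation mulv := (mulv C n m n1).
Local Notation kappa := (kappa m n1 n2).
Local Notation is_submod := (is_submod C n m n1 n2).
Local Notation ospgen := (ospgen C n m n1 n2).

(** The same positive operators as in [singular]: there as equations ready for rewriting, here as
    operators, because the descent applies them to vectors they do not kill. *)
Inductive npos : (fn C n m -> fn C n m) -> Prop :=
| npos_x i (r : 'I_n) of ~~ mid i & mid r : npos (fun f => du i (dx r f) - muly r (dv i f))
| npos_y i (r : 'I_n) of ~~ mid i & mid r : npos (fun f => du i (dy r f) - mulx r (dv i f))
| npos_th i r of ~~ mid i : npos (fun f => du i (dth r f) - mulvt r (dv i f))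
| npos_vt i r of ~~ mid i : npos (fun f => du i (dvt r f) + multh r (dv i f))
| npos_u i0 i of (i0 < n1)%N & i0 = 0%N :> nat & ~~ mid i & i != i0 :
    npos (fun f => mulu i0 (du i f) + mulv i0 (dv i f))
| npos_xth i r of mid i : npos (fun f => mulx i (dth r f) - mulvt r (dy i f))
| npos_xvt i r of mid i : npos (fun f => mulx i (dvt r f) + multh r (dy i f))
| npos_xx i0 i of mid i0 & i0 = n1 :> nat & mid i & i != i0 :
    npos (fun f => mulx i0 (dx i f) - muly i (dy i0 f)).

Lemma npos_singular f : (forall T, npos T -> T f = 0) -> singular C n m n1 n2 f.
Proof.
move=> H; split=> *; apply/eqP; rewrite -subr_eq0 ?opprK; apply/eqP.
- exact: (H _ (npos_x _ _ _ _)).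
- exact: (H _ (npos_y _ _ _ _)).
- exact: (H _ (npos_th _ _ _)).
- exact: (H _ (npos_vt _ _ _)).
- exact: (H _ (npos_u _ _ _ _ _ _)).
- exact: (H _ (npos_xth _ _ _)).
- exact: (H _ (npos_xvt _ _ _)).
- exact: (H _ (npos_xx _ _ _ _ _ _)).
Qed.

Section Stable.
Variable W : fn C n m -> Prop.
Hypothesis sW : is_submod W.

Lemma submodD f g : W f -> W g -> W (f + g). Proof. by case: sW => _ [+ _]; apply. Qed.
Lemma submodZ c f : W f -> W (c *: f). Proof. by case: sW => _ [_ [+ _]]; apply. Qed.
Lemma submodN f : W f -> W (- f). Proof. by rewrite -scaleN1r; exact: submodZ. Qed.
Lemma submodB f g : W f -> W g -> W (f - g).
Proof. by move=> wf /submodN; exact: submodD. Qed.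
Lemma submod0 : W 0. Proof. by case: sW. Qed.
Lemma submod_osp T f : ospgen T -> W f -> W (T f).
Proof. by case: sW => _ [_ [_ +]] oT; apply. Qed.
Lemma submod_sum (I : Type) (t : seq I) (P : pred I) (F : I -> fn C n m) :
  (forall x : I, P x -> W (F x)) -> W (\sum_(x <- t | P x) F x).
Proof. by move=> H; apply: (big_ind W) => //; [exact: submod0|exact: submodD]. Qed.
Lemma submod_oppE f g : W f -> g = - f -> W g.
Proof. by move=> wf ->; exact: submodN. Qed.
Lemma submod_eq f g : W f -> g = f -> W g.
Proof. by move=> wf ->. Qed.

Lemma gen_xx i j f : W f -> W (sx i (sdx j f) - sy j (sdy i f)).
Proof.
by move=> wf; apply: (submod_osp (fun f => fsub C n m (sx i (sdx j f)) (sy j (sdy i f))) _ _ wf);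
  left; exists i, j.
Qed.
Lemma gen_xt i r f : W f -> W (sx i (dth r f) - mulvt r (sdy i f)).
Proof.
by move=> wf; apply: (submod_osp (fun f => fsub C n m (sx i (dth r f)) (mulvt r (sdy i f))) _ _ wf);
  do 2 right; left; exists i, r.
Qed.
Lemma gen_tx i r f : W f -> W (multh r (sdx i f) + sy i (dvt r f)).
Proof.
by move=> wf; apply: (submod_osp (fun f => fadd C n m (multh r (sdx i f)) (sy i (dvt r f))) _ _ wf);
  do 3 right; left; exists i, r.
Qed.
Lemma gen_xy i j f : (i < j)%N -> W f -> W (sx i (sdy j f) - sx j (sdy i f)).
Proof.
by move=> ij wf; apply: (submod_osp (fun f => fsub C n m (sx i (sdy j f)) (sx j (sdy i f))) _ _ wf);
  do 4 right; left; exists i, j.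
Qed.
Lemma gen_yx i j f : (i < j)%N -> W f -> W (sy i (sdx j f) - sy j (sdx i f)).
Proof.
by move=> ij wf; apply: (submod_osp (fun f => fsub C n m (sy i (sdx j f)) (sy j (sdx i f))) _ _ wf);
  do 5 right; left; exists i, j.
Qed.
Lemma gen_xv i r f : W f -> W (sx i (dvt r f) + multh r (sdy i f)).
Proof.
by move=> wf; apply: (submod_osp (fun f => fadd C n m (sx i (dvt r f)) (multh r (sdy i f))) _ _ wf);
  do 8 right; left; exists i, r.
Qed.
Lemma gen_yt i r f : W f -> W (sy i (dth r f) - mulvt r (sdx i f)).
Proof.
by move=> wf; apply: (submod_osp (fun f => fsub C n m (sy i (dth r f)) (mulvt r (sdx i f))) _ _ wf);
  do 9 right; exists i, r.
Qed.

Ltac sE := rewrite /Defs.sx /Defs.sdx /Defs.sy /Defs.sdy.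

(** Each of these operators is a generator up to sign and order of factors. The generators that
    demand i < j are available because indices below n1, middle ones and indices from n2 on follow
    each other in this order. *)
Lemma npos_stable T f : npos T -> W f -> W (T f).
Proof.
have notmid i : ~~ mid i -> (i < n1)%N = false -> (n2 <= i)%N = true by rewrite /mid; lia.
have lown2 i : (i < n1)%N -> (n2 <= i)%N = false by lia.
have midn1 i : mid i -> (i < n1)%N = false by rewrite /mid; lia.
have midn2 i : mid i -> (n2 <= i)%N = false by rewrite /mid; lia.
case=> [{}i r hi hr|i r hi hr|i r hi|i r hi|i0 i h0 i00 hi ii0|i r hi|i r hi|i0 i h0 _ hi _] wf.
- have [r1 r2] := (midn1 r hr, midn2 r hr); rewrite /du /dv; case: ifP => h1.
    have h2 := lown2 i h1; apply: submod_eq (gen_xx i r f wf) _.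
    by sE; rewrite h1 h2 r1 r2.
  have h2 := notmid i hi h1; have rl : (r < i)%N by move: hr h2; rewrite /mid; lia.
  apply: submod_oppE (gen_yx r i f rl wf) _.
  by sE; rewrite h1 h2 r1 r2 opprB.
- have [r1 r2] := (midn1 r hr, midn2 r hr); rewrite /du /dv; case: ifP => h1.
    have h2 := lown2 i h1; have rl : (i < r)%N by move: hr; rewrite /mid; lia.
    apply: submod_eq (gen_xy i r f rl wf) _.
    by sE; rewrite h1 h2 r1 r2.
  have h2 := notmid i hi h1; apply: submod_oppE (gen_xx r i f wf) _.
  by sE; rewrite h1 h2 r1 r2 opprB.
- rewrite /du /dv; case: ifP => h1.
    by apply: submod_eq (gen_xt i r f wf) _; sE; rewrite h1 lown2.
  by apply: submod_eq (gen_yt i r f wf) _; sE; rewrite h1 notmid.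
- rewrite /du /dv; case: ifP => h1.
    by apply: submod_eq (gen_xv i r f wf) _; sE; rewrite h1 lown2.
  by apply: submod_eq (gen_tx i r f wf) _; sE; rewrite h1 notmid // addrC.
- have h3 := lown2 i0 h0; rewrite /du /dv /mulu /mulv h0; case: ifP => h1.
    have h2 := lown2 i h1; apply: submod_oppE (gen_xx i i0 f wf) _.
    sE; rewrite h1 h0 h2 h3 foppE linearN /= dx_mulx (negbTE ii0) addr0.
    by rewrite opprB opprK addrC.
  have h2 := notmid i hi h1; have rl : (i0 < i)%N by lia.
  apply: submod_eq (gen_yx i0 i f rl wf) _.
  by sE; rewrite h1 h0 h2 h3 foppE linearN /= opprK mulx_dy addrC.
- by apply: submod_eq (gen_xt i r f wf) _; sE; rewrite midn1 // midn2.
- by apply: submod_eq (gen_xv i r f wf) _; sE; rewrite midn1 // midn2.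
- apply: submod_eq (gen_xx i0 i f wf) _; sE.
  by rewrite (midn1 i0 h0) (midn1 i hi) (midn2 i hi) (midn2 i0 h0).
Qed.
End Stable.

(* Chosen so that every operator in npos strictly lowers the weight: the outer variables
   weigh more than the spread of the middle ones, which increase along
   x_(n1+1), x, odd variables, y, y_(n1+1). *)
Definition levx i : int := if mid i then ((i : nat) != n1)%:Z else 5 + ((i : nat) != 0%N)%:Z.
Definition levy i : int := if mid i then 3 + ((i : nat) == n1)%:Z else 5 + ((i : nat) != 0%N)%:Z.
Definition lev := wt levx levy 2.

Definition lowers (A : fn C n m -> fn C n m) (d : int) :=
  forall N f, polyw (fun mu => lev mu <= N) f -> polyw (fun mu => lev mu <= N + d) (A f).

Lemma lowers_shift A c : shifts C n m A c -> lowers A (c levx levy 2).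
Proof.
move=> sA N f pf; apply: (polyw_shift (fun z => z <= N) (fun z => z <= N + _) sA pf) => z.
by rewrite lerD2r.
Qed.
Lemma lowers_dx i : lowers (dx i) (- levx i). Proof. exact: lowers_shift (shifts_dx _ _ _ i). Qed.
Lemma lowers_dy i : lowers (dy i) (- levy i). Proof. exact: lowers_shift (shifts_dy _ _ _ i). Qed.
Lemma lowers_mulx i : lowers (mulx i) (levx i). Proof. exact: lowers_shift (shifts_mulx _ _ _ i). Qed.
Lemma lowers_muly i : lowers (muly i) (levy i). Proof. exact: lowers_shift (shifts_muly _ _ _ i). Qed.
Lemma lowers_multh r : lowers (multh r) 2. Proof. exact: lowers_shift (shifts_multh _ _ _ r). Qed.
Lemma lowers_mulvt r : lowers (mulvt r) 2. Proof. exact: lowers_shift (shifts_mulvt _ _ _ r). Qed.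
Lemma lowers_dth r : lowers (dth r) (- 2). Proof. exact: lowers_shift (shifts_dth _ _ _ r). Qed.
Lemma lowers_dvt r : lowers (dvt r) (- 2). Proof. exact: lowers_shift (shifts_dvt _ _ _ r). Qed.
Lemma lowers_du i : ~~ mid i -> lowers (du i) (- levx i).
Proof.
move=> hi; rewrite /du; case: ifP => _; first exact: lowers_dx.
by have -> : levx i = levy i; [rewrite /levx /levy (negbTE hi)|exact: lowers_dy].
Qed.
Lemma lowers_dv i : ~~ mid i -> lowers (dv i) (- levx i).
Proof.
move=> hi; rewrite /dv; case: ifP => _; last exact: lowers_dx.
by have -> : levx i = levy i; [rewrite /levx /levy (negbTE hi)|exact: lowers_dy].
Qed.
Lemma lowers_mulu i : ~~ mid i -> lowers (mulu i) (levx i).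
Proof.
move=> hi; rewrite /mulu; case: ifP => _; first exact: lowers_mulx.
by have -> : levx i = levy i; [rewrite /levx /levy (negbTE hi)|exact: lowers_muly].
Qed.
Lemma lowers_mulv i : ~~ mid i -> lowers (mulv i) (levx i).
Proof.
move=> hi; rewrite /mulv; case: ifP => _; last exact: lowers_mulx.
by have -> : levx i = levy i; [rewrite /levx /levy (negbTE hi)|exact: lowers_muly].
Qed.

Lemma lowers2 A B d e N f : lowers A d -> lowers B e -> e + d <= -1 ->
  polyw (fun mu => lev mu <= N) f -> polyw (fun mu => lev mu <= N - 1) (A (B f)).
Proof.
move=> hA hB de /hB /hA [pf Q]; split=> // mu /Q; lia.
Qed.

Lemma npos_lowers T : npos T -> lowers T (- 1).
Proof.
case=> [{}i r hi hr|i r hi hr|i r hi|i r hi|i0 i h0 i00 hi ii0|i r hi|i r hi|i0 i h0 h00 hi ii0] N f pf;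
  (apply: polywB || apply: polywD).
- by apply: lowers2 (lowers_du i hi) (lowers_dx r) _ pf; rewrite /levx hr (negbTE hi); lia.
- by apply: lowers2 (lowers_muly r) (lowers_dv i hi) _ pf; rewrite /levx /levy hr (negbTE hi); lia.
- by apply: lowers2 (lowers_du i hi) (lowers_dy r) _ pf; rewrite /levx /levy hr (negbTE hi); lia.
- by apply: lowers2 (lowers_mulx r) (lowers_dv i hi) _ pf; rewrite /levx /levy hr (negbTE hi); lia.
- by apply: lowers2 (lowers_du i hi) (lowers_dth r) _ pf; rewrite /levx (negbTE hi); lia.
- by apply: lowers2 (lowers_mulvt r) (lowers_dv i hi) _ pf; rewrite /levx (negbTE hi); lia.
- by apply: lowers2 (lowers_du i hi) (lowers_dvt r) _ pf; rewrite /levx (negbTE hi); lia.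
- by apply: lowers2 (lowers_multh r) (lowers_dv i hi) _ pf; rewrite /levx (negbTE hi); lia.
- have h0' : ~~ mid i0 by rewrite /mid; lia.
  have ne : (i : nat) != 0%N by move: ii0; rewrite -val_eqE /= i00.
  by apply: lowers2 (lowers_mulu i0 h0') (lowers_du i hi) _ pf;
    rewrite /levx (negbTE hi) (negbTE h0') i00 ne.
- have h0' : ~~ mid i0 by rewrite /mid; lia.
  have ne : (i : nat) != 0%N by move: ii0; rewrite -val_eqE /= i00.
  by apply: lowers2 (lowers_mulv i0 h0') (lowers_dv i hi) _ pf;
    rewrite /levx (negbTE hi) (negbTE h0') i00 ne.
- by apply: lowers2 (lowers_mulx i) (lowers_dth r) _ pf; rewrite /levx hi; lia.
- by apply: lowers2 (lowers_mulvt r) (lowers_dy i) _ pf; rewrite /levy hi; lia.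
- by apply: lowers2 (lowers_mulx i) (lowers_dvt r) _ pf; rewrite /levx hi; lia.
- by apply: lowers2 (lowers_multh r) (lowers_dy i) _ pf; rewrite /levy hi; lia.
- have ne : (i : nat) != n1 by move: ii0; rewrite -val_eqE /= h00.
  by apply: lowers2 (lowers_mulx i0) (lowers_dx i) _ pf; rewrite /levx hi h0 h00 eqxx ne.
- have ne : (i : nat) == n1 = false by apply: negbTE; move: ii0; rewrite -val_eqE /= h00.
  by apply: lowers2 (lowers_muly i) (lowers_dy i0) _ pf; rewrite /levy hi h0 h00 eqxx ne.
Qed.

Lemma lev_ge0 mu : 0 <= lev mu.
Proof. by apply: wt_ge0 => // i; rewrite /levx /levy; case: ifP. Qed.

(* Applying positive operators must stop because they lower lev. *)
Lemma exists_singular W : is_submod W -> (forall f, W f -> is_poly C n m f) ->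
  (exists2 f, W f & f <> 0) -> exists f, [/\ W f, f <> 0 & singular C n m n1 n2 f].
Proof.
move=> sW pW [f wf f0]; have [N hN] := poly_bound C n m n1 n2 n12 n2n lev f (pW f wf).
have {hN} : polyw (fun mu => lev mu <= N%:Z) f by split=> //; exact: pW.
elim: N f wf f0 => [|N IH] f wf f0 lf.
  exists f; split=> //; apply: npos_singular => T hT; apply/funext => mu; apply/eqP.
  apply: contraT => /(proj2 (npos_lowers T hT _ f lf) mu); have := lev_ge0 mu; lia.
case: (pselect (forall T, npos T -> T f = 0)) => [H|/existsNP [T /not_implyP [hT Tf]]].
  by exists f; split=> //; exact: npos_singular.
apply: (IH (T f)) => //; first exact: (npos_stable W sW T f hT wf).
have [pT QT] := npos_lowers T hT _ f lf; split=> // mu /QT; lia.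
Qed.

Variables (i0 r0 : 'I_n) (s0 : 'I_m).
Hypotheses (i0E : i0 = 0%N :> nat) (n1_gt0 : (0 < n1)%N) (r0E : r0 = n1 :> nat) (n1n2 : (n1 < n2)%N).

Definition delta (mu : mon n m) : fn C n m := fun nu => (nu == mu)%:R.
Definition vk k := vac n m (if k <= 0 then i0 else r0) `|k|%N.

(** Singular vectors of H_<k> are supported on one monomial, so the one found in [W] is a non-zero
    multiple of it. This gets applied to a submodule and to its orthogonal alike. *)
Lemma submod_vac k W : k + kappa <= 1 -> is_submod W -> (forall f, W f -> Hk k f) ->
  (exists2 f, W f & f <> 0) -> W (delta (vk k)).
Proof.
move=> kc sW WH nW.
have [f [wf f0 sf]] := exists_singular W sW (fun f wf => proj1 (proj1 (WH f wf))) nW.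
have /HkE [fk Df] := WH f wf.
have r0mid : mid r0 by rewrite /mid r0E leqnn.
have fv mu : f mu != 0 -> mu = vk k.
  rewrite /vk; case: ifP => k0.
    exact: (singular_le0 C n m n1 n2 n12 n2n k f kc fk Df sf r0 r0E r0mid i0 i0E n1_gt0).
  have kp : 0 < k by rewrite ltNge k0.
  exact: (singular_gt0 C n m n1 n2 n12 n2n k f kc fk Df sf r0 r0E r0mid i0 i0E n1_gt0 kp s0).
have fE : f = f (vk k) *: delta (vk k).
  apply/funext => mu; rewrite fnZ /delta; case: eqP => [->|ne]; rewrite ?mulr1 // mulr0.
  by apply/eqP; apply: contraT => /fv/ne.
have fv0 : f (vk k) != 0.
  by apply/eqP => E; apply: f0; rewrite fE E scale0r.
have -> : delta (vk k) = (f (vk k))^-1 *: f by rewrite {2}fE scalerA mulVf // scale1r.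
exact: submodZ.
Qed.

End Descent.

(** * The contravariant form *)

Section Total.
Variables (C : numClosedFieldType) (n m : nat).
Implicit Types (F G : fn C n m) (mu nu : mon n m).
Local Notation is_poly := (is_poly C n m).

(** [is_poly] only asserts existence, so a support list is chosen classically and stripped of
    duplicates; [totalE] shows that the sum does not depend on the choice. Functions of infinite
    support get the default sum 0. *)
Definition supp_seq F : seq (mon n m) :=
  if pselect (is_poly F) is left H then undup (projT1 (cid H)) else [::].
Definition total F := \sum_(mu <- supp_seq F) F mu.

Lemma totalE F (s : seq (mon n m)) : uniq s -> (forall mu, mu \notin s -> F mu = 0) ->
  total F = \sum_(mu <- s) F mu.
Proof.
move=> us hs; have pF : is_poly F by exists s.
rewrite /total /supp_seq; case: pselect => // H; case: (cid H) => t /= ht.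
rewrite (bigID (fun mu => F mu == 0)) [RHS](bigID (fun mu => F mu == 0)) /=.
rewrite big1 => [|mu /eqP//]; rewrite [X in _ = X + _]big1 => [|mu /eqP//].
rewrite -!(big_filter _ (fun mu => F mu != 0)); congr (_ + _); apply: perm_big.
apply: uniq_perm; rewrite ?filter_uniq ?undup_uniq // => mu.
rewrite !mem_filter mem_undup; case: eqVneq => //= nz.
have mt : mu \in t by apply: contraT => /ht E; rewrite E eqxx in nz.
have ms : mu \in s by apply: contraT => /hs E; rewrite E eqxx in nz.
by rewrite mt ms.
Qed.

Lemma totalP c F G : is_poly F -> is_poly G -> total (c *: F + G) = c * total F + total G.
Proof.
move=> [s hs] [t ht]; have u := undup_uniq (s ++ t).
have hu mu : mu \notin undup (s ++ t) -> F mu = 0 /\ G mu = 0.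
  by rewrite mem_undup mem_cat negb_or => /andP[/hs-> /ht->].
rewrite !(totalE _ _ u) => [|mu /hu[_ ->]//|mu /hu[-> _]//|mu /hu[FE GE]]; last first.
  by rewrite fnD fnZ FE GE mulr0 addr0.
by rewrite mulr_sumr -big_split.
Qed.

Lemma total0 : total 0 = 0.
Proof. by rewrite (totalE _ [::]) ?big_nil. Qed.

Lemma totalZ c F : is_poly F -> total (c *: F) = c * total F.
Proof.
move=> pF; have p0 : is_poly 0 by exists [::].
by have := totalP c F 0 pF p0; rewrite !addr0 total0 addr0.
Qed.

(** Raising an exponent is injective but misses the monomials with exponent zero, so [phi] is only
    asked to reach the support of [F]. *)
Lemma total_reindex F (phi psi : mon n m -> mon n m) : is_poly F -> cancel phi psi ->
  (forall mu, F mu != 0 -> phi (psi mu) = mu) -> total F = total (fun mu => F (phi mu)).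
Proof.
move=> [s hs] cK Fs; pose t := undup (map psi s).
rewrite (totalE _ (map phi t)).
- rewrite (totalE _ t) ?big_map ?undup_uniq // => mu; rewrite mem_undup => mut.
  by apply: hs; apply: contra mut => /(map_f psi); rewrite cK.
- by rewrite map_inj_uniq ?undup_uniq //; exact: can_inj cK.
- move=> mu mut; apply/eqP; apply: contraNT mut => nz.
  rewrite -(Fs _ nz) map_f // mem_undup map_f //; apply: contraT => /hs E.
  by rewrite E eqxx in nz.
Qed.

Lemma poly_mull (w : mon n m -> C) F : is_poly F -> is_poly (fun mu => w mu * F mu).
Proof. by move=> [s hs]; exists s => mu /hs->; rewrite mulr0. Qed.

Lemma poly_shifts A c F : shifts C n m A c -> is_poly F -> is_poly (A F).
Proof.
move=> [phi H] [s hs]; exists (map phi s) => mu; have [//|] := eqVneq (A F mu) 0.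
move=> /H [nu [nz -> _]]; rewrite map_f //.
by apply: contraNT nz => /hs->.
Qed.
End Total.

(** * The weighted form and adjoints of the operators *)

Section Form.
Variables (C : numClosedFieldType) (n m n1 n2 : nat).
Hypotheses (n12 : (n1 <= n2)%N).
Implicit Types (i j : 'I_n) (r s : 'I_m) (f g h : fn C n m) (mu nu : mon n m) (k l : int).
Local Notation mulx := (mulx C n m).
Local Notation muly := (muly C n m).
Local Notation dx := (dx C n m).
Local Notation dy := (dy C n m).
Local Notation multh := (multh C n m).
Local Notation mulvt := (mulvt C n m).
Local Notation dth := (dth C n m).
Local Notation dvt := (dvt C n m).
Local Notation sx := (sx C n m n1).
Local Notation sdx := (sdx C n m n1).
Local Notation sy := (sy C n m n2).
Local Notation sdy := (sdy C n m n2).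
Local Notation Delta := (Delta C n m n1 n2).
Local Notation eta := (Defs.eta C n m n1 n2).
Local Notation is_poly := (is_poly C n m).
Local Notation ospgen := (ospgen C n m n1 n2).
Local Notation total := (total C n m).

(** The factorials are those of the Fischer product, for which multiplication by a variable and
    differentiation by it are adjoint; on the indices in [P] the sign makes them adjoint up to
    -1. *)
Definition fact_prod (P : pred 'I_n) (a : {ffun 'I_n -> nat}) : C :=
  \prod_i ((if P i then (-1) ^+ a i else 1) * (a i)`!%:R).
(* The signs make sigma(x)^* = sigma(d/dx) for every even variable; the sign of TT makes
   the span of the generators stable under the adjunction. *)
Definition wgt mu : C := let: (a, b, SS, TT) := mu in
  fact_prod (fun i => i < n1)%N a * fact_prod (fun i => n2 <= i)%N b * (-1) ^+ #|TT|.

Lemma wgt_neq0 mu : wgt mu != 0.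
Proof.
case: mu => [[[a b] S] T]; rewrite /wgt !mulf_neq0 ?signr_eq0 //;
  by apply/prodf_neq0 => i _; rewrite mulf_neq0 ?pnatr_eq0 -?lt0n ?fact_gt0 //;
     case: ifP; rewrite ?signr_eq0 ?oner_eq0.
Qed.

Lemma fact_prod_incr P a i :
  fact_prod P (incr n a i) = fact_prod P a * ((if P i then -1 else 1) * (a i).+1%:R).
Proof.
rewrite /fact_prod (bigD1 i) //= [in RHS](bigD1 i) //= incrE eqxx addn1 factS natrM exprS.
rewrite (eq_bigr (fun j => (if P j then (-1) ^+ a j else 1) * (a j)`!%:R)); last first.
  by move=> j /negbTE ji; rewrite incrE ji addn0.
by case: ifP => _; ring.
Qed.

Definition pairf f g : fn C n m := fun mu => wgt mu * (f mu * g mu).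
Definition pair f g := total (pairf f g).

Lemma pairC f g : pair f g = pair g f.
Proof. by congr total; apply/funext => mu; rewrite /pairf [f mu * _]mulrC. Qed.

(** Finite support of one factor makes the pairing a finite sum; hence linearity in one argument
    asks nothing of that argument. *)
Lemma poly_pair f g : is_poly g -> is_poly (pairf f g).
Proof. by move=> pg; apply: poly_mull; exact: poly_mull. Qed.

Lemma pairP c f g h : is_poly h -> pair (c *: f + g) h = c * pair f h + pair g h.
Proof.
move=> ph; rewrite -totalP; try exact: poly_pair.
by congr total; apply/funext => mu; rewrite /pairf !(fnD, fnZ) /pairf; ring.
Qed.
Lemma pair0 h : pair 0 h = 0.
Proof.
by rewrite -[RHS](total0 C n m); congr total; apply/funext => mu; rewrite /pairf mul0r mulr0.
Qed.
Lemma pairD f g h : is_poly h -> pair (f + g) h = pair f h + pair g h.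
Proof. by move=> /(pairP 1 f g); rewrite scale1r mul1r. Qed.
Lemma pairZ c f h : is_poly h -> pair (c *: f) h = c * pair f h.
Proof. by move=> /(pairP c f 0); rewrite addr0 pair0 addr0. Qed.
Lemma pairN f h : is_poly h -> pair (- f) h = - pair f h.
Proof. by move=> ph; rewrite -scaleN1r pairZ // mulN1r. Qed.
Lemma pairB f g h : is_poly h -> pair (f - g) h = pair f h - pair g h.
Proof. by move=> ph; rewrite pairD // pairN. Qed.
Lemma pair_sum (I : Type) (t : seq I) (F : I -> fn C n m) h : is_poly h ->
  pair (\sum_(x <- t) F x) h = \sum_(x <- t) pair (F x) h.
Proof.
move=> ph; apply: (big_morph (fun f => pair f h)); last exact: pair0.
by move=> f g; exact: pairD.
Qed.

Lemma pair_mulx i f g : is_poly g ->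
  pair (mulx i f) g = (if (i < n1)%N then -1 else 1) * pair f (dx i g).
Proof.
move=> pg; rewrite /pair.
rewrite (total_reindex _ _ _ _ (fun mu => let: (a, b, SS, TT) := mu in (incr n a i, b, SS, TT))
  (fun mu => let: (a, b, SS, TT) := mu in (decr n a i, b, SS, TT))).
- transitivity (total ((if (i < n1)%N then -1 else 1) *: pairf f (dx i g))).
    congr total; apply/funext => -[[[a b] S] T]; rewrite fnZ /pairf.
    rewrite /wgt fact_prod_incr /Defs.mulx incrE eqxx addn1 /= incrK /Defs.dx; ring.
  rewrite totalZ //; apply: poly_pair; apply: poly_shifts pg; exact: shifts_dx.
- exact: poly_pair.
- by move=> [[[a b] S] T]; rewrite incrK.
- move=> [[[a b] S] T]; rewrite /pairf /Defs.mulx; case: (ltnP 0 (a i)) => ai; first by rewrite decrK.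
  by rewrite mul0r mulr0 eqxx.
Qed.
Lemma pair_muly i f g : is_poly g ->
  pair (muly i f) g = (if (n2 <= i)%N then -1 else 1) * pair f (dy i g).
Proof.
move=> pg; rewrite /pair.
rewrite (total_reindex _ _ _ _ (fun mu => let: (a, b, SS, TT) := mu in (a, incr n b i, SS, TT))
  (fun mu => let: (a, b, SS, TT) := mu in (a, decr n b i, SS, TT))).
- transitivity (total ((if (n2 <= i)%N then -1 else 1) *: pairf f (dy i g))).
    congr total; apply/funext => -[[[a b] S] T]; rewrite fnZ /pairf.
    rewrite /wgt fact_prod_incr /Defs.muly incrE eqxx addn1 /= incrK /Defs.dy; ring.
  rewrite totalZ //; apply: poly_pair; apply: poly_shifts pg; exact: shifts_dy.
- exact: poly_pair.
- by move=> [[[a b] S] T]; rewrite incrK.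
- move=> [[[a b] S] T]; rewrite /pairf /Defs.muly; case: (ltnP 0 (b i)) => ai; first by rewrite decrK.
  by rewrite mul0r mulr0 eqxx.
Qed.

(** Adding an index is not injective on sets; toggling is an involution of all sets, so it can serve
    for reindexing, and the surplus terms vanish on both sides. *)
Definition toggle r (A : {set 'I_m}) := if r \in A then A :\ r else r |: A.
Lemma toggleK r : involutive (toggle r).
Proof.
move=> A; rewrite /toggle; case: (boolP (r \in A)) => rA.
  by rewrite setD11 setD1K.
by rewrite setU11 setU1K.
Qed.

Lemma pair_multh r f g : is_poly g -> pair (multh r f) g = pair f (dth r g).
Proof.
move=> pg; rewrite /pair.
rewrite (total_reindex _ _ _ _ (fun mu => let: (a, b, SS, TT) := mu in (a, b, toggle r SS, TT))
  (fun mu => let: (a, b, SS, TT) := mu in (a, b, toggle r SS, TT))).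
- congr total; apply/funext => -[[[a b] S] T]; rewrite /pairf /Defs.multh /Defs.dth /wgt /toggle.
  case: (boolP (r \in S)) => rS /=; first by rewrite setD11 !(mul0r, mulr0).
  by rewrite setU11 belowU1_id setU1K //; ring.
- exact: poly_pair.
- by move=> [[[a b] S] T]; rewrite toggleK.
- by move=> [[[a b] S] T]; rewrite toggleK.
Qed.
Lemma pair_mulvt r f g : is_poly g -> pair (mulvt r f) g = - pair f (dvt r g).
Proof.
move=> pg; rewrite /pair.
rewrite (total_reindex _ _ _ _ (fun mu => let: (a, b, SS, TT) := mu in (a, b, SS, toggle r TT))
  (fun mu => let: (a, b, SS, TT) := mu in (a, b, SS, toggle r TT))).
- transitivity (total ((-1) *: pairf f (dvt r g))).
    congr total; apply/funext => -[[[a b] S] T]; rewrite fnZ /pairf.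
    rewrite /Defs.mulvt /Defs.dvt /wgt /toggle.
    case: (boolP (r \in T)) => rS /=; first by rewrite setD11 !(mul0r, mulr0).
    by rewrite setU11 belowU1_id setU1K // cardsU1 rS exprS; ring.
  rewrite totalZ ?mulN1r //; apply: poly_pair; apply: poly_shifts pg; exact: shifts_dvt.
- exact: poly_pair.
- by move=> [[[a b] S] T]; rewrite toggleK.
- by move=> [[[a b] S] T]; rewrite toggleK.
Qed.

Lemma poly_sx i f : is_poly f -> is_poly (sx i f).
Proof. by rewrite /Defs.sx; case: ifP => _; apply: poly_shifts; [exact: shifts_dx|exact: shifts_mulx]. Qed.
Lemma poly_sy i f : is_poly f -> is_poly (sy i f).
Proof. by rewrite /Defs.sy; case: ifP => _; apply: poly_shifts; [exact: shifts_dy|exact: shifts_muly]. Qed.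
Lemma poly_sdx i f : is_poly f -> is_poly (sdx i f).
Proof.
rewrite /Defs.sdx; case: ifP => _; last by apply: poly_shifts; exact: shifts_dx.
by apply: (poly_shifts _ _ _ (fun f => fopp C n m (mulx i f))); exact: shiftsN (shifts_mulx _ _ _ i).
Qed.
Lemma poly_sdy i f : is_poly f -> is_poly (sdy i f).
Proof.
rewrite /Defs.sdy; case: ifP => _; last by apply: poly_shifts; exact: shifts_dy.
by apply: (poly_shifts _ _ _ (fun f => fopp C n m (muly i f))); exact: shiftsN (shifts_muly _ _ _ i).
Qed.
Lemma poly_multh r f : is_poly f -> is_poly (multh r f).
Proof. by apply: poly_shifts; exact: shifts_multh. Qed.
Lemma poly_mulvt r f : is_poly f -> is_poly (mulvt r f).
Proof. by apply: poly_shifts; exact: shifts_mulvt. Qed.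
Lemma poly_dth r f : is_poly f -> is_poly (dth r f).
Proof. by apply: poly_shifts; exact: shifts_dth. Qed.
Lemma poly_dvt r f : is_poly f -> is_poly (dvt r f).
Proof. by apply: poly_shifts; exact: shifts_dvt. Qed.

Lemma pair_sx i f g : is_poly f -> is_poly g -> pair (sx i f) g = pair f (sdx i g).
Proof.
move=> pf pg; rewrite /Defs.sx /Defs.sdx; case: ifP => hi; last by rewrite pair_mulx // hi mul1r.
by rewrite foppE [RHS]pairC pairN // pair_mulx // hi pairC; ring.
Qed.
Lemma pair_sy i f g : is_poly f -> is_poly g -> pair (sy i f) g = pair f (sdy i g).
Proof.
move=> pf pg; rewrite /Defs.sy /Defs.sdy; case: ifP => hi; last by rewrite pair_muly // hi mul1r.
by rewrite foppE [RHS]pairC pairN // pair_muly // hi pairC; ring.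
Qed.
Lemma pair_sdx i f g : is_poly f -> is_poly g -> pair (sdx i f) g = pair f (sx i g).
Proof. by move=> pf pg; rewrite pairC -pair_sx // pairC. Qed.
Lemma pair_sdy i f g : is_poly f -> is_poly g -> pair (sdy i f) g = pair f (sy i g).
Proof. by move=> pf pg; rewrite pairC -pair_sy // pairC. Qed.
Lemma pair_dth r f g : is_poly f -> is_poly g -> pair (dth r f) g = pair f (multh r g).
Proof. by move=> pf pg; rewrite pairC -pair_multh // pairC. Qed.
Lemma pair_dvt r f g : is_poly f -> is_poly g -> pair (dvt r f) g = - pair f (mulvt r g).
Proof. by move=> pf pg; rewrite pairC [in RHS]pairC pair_mulvt // opprK. Qed.

Lemma pairBr f g h : is_poly f -> pair f (g - h) = pair f g - pair f h.
Proof. by move=> pf; rewrite pairC pairB // [in LHS]pairC [in X in _ - X]pairC. Qed.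
Lemma pairDr f g h : is_poly f -> pair f (g + h) = pair f g + pair f h.
Proof. by move=> pf; rewrite pairC pairD // [in LHS]pairC [in X in _ + X]pairC. Qed.

Ltac poly_tac := first [ done | apply: poly_sdx; poly_tac | apply: poly_sdy; poly_tac
  | apply: poly_dth; poly_tac | apply: poly_dvt; poly_tac
  | apply: poly_sx; poly_tac | apply: poly_sy; poly_tac
  | apply: poly_multh; poly_tac | apply: poly_mulvt; poly_tac ].
Ltac adj2 L1 L2 := rewrite L1; [rewrite L2; [|poly_tac..]|poly_tac..].

(** Adjunction swaps [sx] with [sdx], [sy] with [sdy], theta with its derivation, and vartheta with
    minus its derivation. It thus carries a generator to the one of opposite root; [e] absorbs the
    signs. *)
Lemma osp_adjoint T : ospgen T -> exists T', ospgen T' /\ exists e : C,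
  forall f g, is_poly f -> is_poly g -> pair (T f) g = e * pair f (T' g).
Proof.
move=> [[i[j ->]]|[[r[s ->]]|[[i[r ->]]|[[i[r ->]]|[[i[j [ij ->]]]|[[i[j [ij ->]]]|
  [[r[s [rs ->]]]|[[r[s [rs ->]]]|[[i[r ->]]|[i[r ->]]]]]]]]]]].
- exists (fun f => fsub C n m (sx j (sdx i f)) (sy i (sdy j f))); split; first by left; exists j, i.
  exists 1 => f g pf pg; rewrite !fsubE pairB // pairBr //.
  by adj2 pair_sx pair_sdx; adj2 pair_sy pair_sdy; ring.
- exists (fun f => fsub C n m (multh s (dth r f)) (mulvt r (dvt s f))).
  split; first by right; left; exists s, r.
  exists 1 => f g pf pg; rewrite !fsubE pairB // pairBr //.
  by adj2 pair_multh pair_dth; adj2 pair_mulvt pair_dvt; ring.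
- exists (fun f => fadd C n m (multh r (sdx i f)) (sy i (dvt r f))).
  split; first by do 3 right; left; exists i, r.
  exists 1 => f g pf pg; rewrite fsubE faddE pairB // pairDr //.
  by adj2 pair_sx pair_dth; adj2 pair_mulvt pair_sdy; ring.
- exists (fun f => fsub C n m (sx i (dth r f)) (mulvt r (sdy i f))).
  split; first by do 2 right; left; exists i, r.
  exists 1 => f g pf pg; rewrite fsubE faddE pairD // pairBr //.
  by adj2 pair_multh pair_sdx; adj2 pair_sy pair_dvt; ring.
- exists (fun f => fsub C n m (sy i (sdx j f)) (sy j (sdx i f))).
  split; first by do 5 right; left; exists i, j.
  exists (-1) => f g pf pg; rewrite !fsubE pairB // pairBr //.
  by adj2 pair_sx pair_sdy; adj2 pair_sx pair_sdy; ring.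
- exists (fun f => fsub C n m (sx i (sdy j f)) (sx j (sdy i f))).
  split; first by do 4 right; left; exists i, j.
  exists (-1) => f g pf pg; rewrite !fsubE pairB // pairBr //.
  by adj2 pair_sy pair_sdx; adj2 pair_sy pair_sdx; ring.
- exists (fun f => fadd C n m (multh r (dvt s f)) (multh s (dvt r f))).
  split; first by do 7 right; left; exists r, s.
  exists (-1) => f g pf pg; rewrite !faddE pairD // pairDr //.
  by adj2 pair_mulvt pair_dth; adj2 pair_mulvt pair_dth; ring.
- exists (fun f => fadd C n m (mulvt r (dth s f)) (mulvt s (dth r f))).
  split; first by do 6 right; left; exists r, s.
  exists (-1) => f g pf pg; rewrite !faddE pairD // pairDr //.
  by adj2 pair_multh pair_dvt; adj2 pair_multh pair_dvt; ring.
- exists (fun f => fsub C n m (sy i (dth r f)) (mulvt r (sdx i f))).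
  split; first by do 9 right; exists i, r.
  exists 1 => f g pf pg; rewrite fsubE faddE pairD // pairBr //.
  by adj2 pair_sx pair_dvt; adj2 pair_multh pair_sdy; ring.
- exists (fun f => fadd C n m (sx i (dvt r f)) (multh r (sdy i f))).
  split; first by do 8 right; left; exists i, r.
  exists 1 => f g pf pg; rewrite fsubE faddE pairB // pairDr //.
  by adj2 pair_sy pair_dth; adj2 pair_mulvt pair_sdx; ring.
Qed.

(** Two signs cancel in the odd part: the one in the adjoint of vartheta, and the one for restoring
    the order theta vartheta after taking adjoints. *)
Lemma pair_eta f g : is_poly f -> is_poly g -> pair f (eta g) = pair (Delta f) g.
Proof.
move=> pf pg; rewrite etaE // DeltaE // pairDr // [pair f (\sum_i _)]pairC [pair f (\sum_r _)]pairC.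
rewrite pairD // !pair_sum //; congr (_ + _); apply: eq_bigr => x _.
  by rewrite sdx_sdy; adj2 pair_sdy pair_sdx; rewrite pairC.
by adj2 pair_dth pair_dvt; rewrite mulvt_multh [in RHS]pairC pairN // opprK.
Qed.

Lemma pair_delta f mu : pair f (delta C n m mu) = wgt mu * f mu.
Proof.
rewrite /pair (totalE _ _ _ _ [:: mu]) ?big_seq1 ?/pairf /delta ?eqxx ?mulr1 //.
by move=> nu; rewrite inE /pairf => /negbTE->; rewrite !mulr0.
Qed.

End Form.

(** * Annihilators of subspaces of a finite coordinate space *)

Section Annihilator.
Variables (C : numClosedFieldType) (n m : nat).
Implicit Types (f g : fn C n m) (s : seq (mon n m)).

(** Subspaces are bare predicates here, so coordinates are eliminated one at a time. If some [g0] in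
    [P] is non-zero at [mu], it serves as pivot and the induction treats the vectors of [P]
    vanishing at [mu]; otherwise evaluation at [mu] annihilates [P]. *)
Lemma exists_annihilator s (P : fn C n m -> Prop) : uniq s -> P 0 ->
  (forall c f g, P f -> P g -> P (c *: f + g)) ->
  (forall f, P f -> forall mu, mu \notin s -> f mu = 0) ->
  (forall f, (forall mu, mu \notin s -> f mu = 0) -> P f) \/
  exists c : fn C n m, [/\ c <> 0, forall mu, mu \notin s -> c mu = 0 &
    forall g, P g -> \sum_(mu <- s) c mu * g mu = 0].
Proof.
elim: s P => [|mu s IH] P /= us P0 PP Ps.
  by left=> f f0; have -> : f = 0 by apply/funext => nu; exact: f0.
case/andP: us => mus us.
pose d : fn C n m := delta C n m mu.
have dmu : d mu = 1 by rewrite /d /delta eqxx.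
have ds nu : nu != mu -> d nu = 0 by rewrite /d /delta => /negbTE->.
have sums (c g : fn C n m) t : \sum_(nu <- s) (c + t *: d) nu * g nu = \sum_(nu <- s) c nu * g nu.
  apply: eq_big_seq => nu nus; rewrite fnD fnZ ds ?mulr0 ?addr0 //.
  by apply: contraNneq mus => <-.
case: (pselect (exists2 g, P g & g mu != 0)) => [[g0 Pg0 g0mu]|no]; last first.
  right; exists d; split.
  - by move=> E; move/eqP: dmu; rewrite E fn0 eq_sym oner_eq0.
  - by move=> nu; rewrite inE negb_or => /andP[/ds].
  - move=> g Pg; rewrite big_cons big_seq big1 => [|nu nus].
      rewrite dmu mul1r addr0; apply/eqP; apply: contraT => gmu; case: no.
      by exists g.
    by rewrite ds ?mul0r //; apply: contraNneq mus => <-.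
have [|||allP|[c [c0 cs cP]]] := IH (fun g => P g /\ g mu = 0) us.
- by split.
- move=> c f g [Pf f0] [Pg g1]; split; first exact: PP.
  by rewrite fnD fnZ f0 g1 mulr0 addr0.
- move=> f [Pf f0] nu nus; have [->//|nm] := eqVneq nu mu.
  by apply: Ps => //; rewrite inE negb_or nm.
- left=> f fs; pose t := f mu / g0 mu.
  have [|Pt _] := allP (- t *: g0 + f).
    move=> nu nus; rewrite fnD fnZ; have [->|nm] := eqVneq nu mu.
      by rewrite /t mulNr divfK // addNr.
    by rewrite (Ps g0) ?(fs nu) ?mulr0 ?addr0 // inE negb_or nm.
  by have -> : f = t *: g0 + (- t *: g0 + f); [fring|exact: PP].
(* The [mu]-coordinate is chosen so that the extended functional kills the pivot [g0]; every [g] in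
   [P] is a multiple of [g0] plus a vector of [P] vanishing at [mu]. *)
- right; pose t := - (\sum_(nu <- s) c nu * g0 nu) / g0 mu.
  exists (c + t *: d); split.
  - move=> E; apply: c0; apply/funext => nu; have [->|nm] := eqVneq nu mu; first exact: cs.
    by have := congr1 (fun F : fn C n m => F nu) E; rewrite fnD fnZ ds // mulr0 addr0.
  - move=> nu; rewrite inE negb_or => /andP[nm nus].
    by rewrite fnD fnZ ds // mulr0 addr0 cs.
  - move=> g Pg; rewrite big_cons sums fnD fnZ dmu mulr1 (cs mu) // add0r.
    have Pg' : P (- (g mu / g0 mu) *: g0 + g) /\ (- (g mu / g0 mu) *: g0 + g) mu = 0.
      by split; [exact: PP|rewrite fnD fnZ mulNr divfK // addNr].
    have := cP _ Pg'; under eq_bigr do rewrite fnD fnZ mulrDr mulrCA.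
    rewrite big_split /= -mulr_sumr /t => E.
    by rewrite -[RHS]E; congr (_ + _); field.
Qed.
End Annihilator.

Arguments Defs.Delta : simpl never.
Arguments Defs.eta : simpl never.

(** * Irreducibility *)

Section Irreducibility.
Variables (C : numClosedFieldType) (n m n1 n2 : nat).
Hypotheses (n12 : (n1 <= n2)%N) (n2n : (n2 <= n)%N).
Implicit Types (i j : 'I_n) (r s : 'I_m) (f g h : fn C n m) (mu nu : mon n m) (k l : int).
Local Notation dx := (dx C n m).
Local Notation dy := (dy C n m).
Local Notation dvt := (dvt C n m).
Local Notation sx := (sx C n m n1).
Local Notation sdx := (sdx C n m n1).
Local Notation sy := (sy C n m n2).
Local Notation sdy := (sdy C n m n2).
Local Notation eta := (Defs.eta C n m n1 n2).
Local Notation is_poly := (is_poly C n m).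
Local Notation Ak := (Ak C n m n1 n2).
Local Notation Hk := (Hk C n m n1 n2).
Local Notation wt := (wt n m).
Local Notation mid := (mid n n1 n2).
Local Notation kappa := (kappa m n1 n2).
Local Notation is_submod := (is_submod C n m n1 n2).
Local Notation delta := (delta C n m).
Local Notation pair := (pair C n m n1 n2).
Local Notation eu := (eu n m n1 n2).
Local Notation ev := (ev n m n1 n2).
Local Notation em := (em n m n1 n2).
Local Notation irreducible := (irreducible C n m n1 n2).
Local Notation eta_img := (eta_img C n m n1 n2).
Local Notation deg := (deg n m n1 n2).

(** For an outer index sigma turns x_i d/dx_i - y_i d/dy_i into deg u_i + deg v_i + 1 up to sign, so
    these torus elements measure the sum of the u- and v-degrees and not [eu] alone. *)
Definition outer mu : nat := `|(eu mu + ev mu)%R|%N.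

Lemma outerE mu : (outer mu)%:Z = eu mu + ev mu.
Proof. by rewrite /outer gez0_abs // addr_ge0 ?eu_ge0 ?ev_ge0. Qed.

Lemma outer_sum (a b : {ffun 'I_n -> nat}) (S T : {set 'I_m}) : outer (a, b, S, T) = (\sum_(i | ~~ mid i) (a i + b i))%N.
Proof.
apply/eqP; rewrite -eqz_nat; apply/eqP.
rewrite outerE /eu /ev /wt !mul0r !addr0 Posz_sum -!big_split /= [RHS]big_mkcond /=.
apply: eq_bigr => i _; rewrite /mid; case: (ltnP i n1) => h1; case: (leqP n2 i) => h2 /=;
  rewrite ?mul0r ?mul1r ?PoszD ?add0r ?addr0 //; try (exfalso; lia); exact: addrC.
Qed.

Definition outer_op f : fn C n m := fun mu => (outer mu)%:R * f mu.

Lemma submod_outer W f : is_submod W -> W f -> W (outer_op f).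
Proof.
move=> sW wf.
have -> : outer_op f = \sum_(i | ~~ mid i)
   ((if (i < n1)%N then -1 else 1) *: (sx i (sdx i f) - sy i (sdy i f)) - f).
  apply/funext => -[[[a b] S] T]; rewrite /outer_op outer_sum natr_sum mulr_suml fn_sum.
  apply: eq_bigr => i hi; rewrite fnD fnN fnZ fnD fnN /Defs.sx /Defs.sdx /Defs.sy /Defs.sdy.
  move: hi; rewrite /mid; case: (ltnP i n1) => h1; case: (leqP n2 i) => h2 //= _;
    try (exfalso; lia); rewrite ?foppE ?linearN /= ?fnN ?dx_mulxE ?mulx_dxE ?dy_mulyE ?muly_dyE !natrD; ring.
apply: (submod_sum C n m n1 n2 W sW) => i _; apply: (submodB C n m n1 n2 W sW) => //.
by apply: (submodZ C n m n1 n2 W sW); exact: (gen_xx C n m n1 n2 W sW).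
Qed.

Definition outer_part (N : nat) f : fn C n m := fun mu => if outer mu == N then f mu else 0.

(* Lagrange interpolation in the Cartan operator outer_op. *)
Lemma submod_outer_part W f (N : nat) : is_submod W -> is_poly f -> W f -> W (outer_part N f).
Proof.
move=> sW pf wf.
have [M hM] := poly_bound C n m n1 n2 n12 n2n (fun mu => (outer mu)%:Z) f pf.
pose F (l : seq nat) : fn C n m := fun mu =>
  (\prod_(j <- l | j != N) (((outer mu)%:R - j%:R) / (N%:R - j%:R))) * f mu.
have key (l : seq nat) : W (F l).
  elim: l => [|j l IH].
    by have -> : F [::] = f by apply/funext => mu; rewrite /F big_nil mul1r.
  have [jN|jN] := eqVneq j N.
    by have -> : F (j :: l) = F l by apply/funext => mu; rewrite /F big_cons jN eqxx.
  have -> : F (j :: l) = (N%:R - j%:R)^-1 *: (outer_op (F l) - j%:R *: F l).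
    by apply/funext => mu; rewrite fnZ fnD fnN fnZ /outer_op /F big_cons jN; ring.
  apply: (submodZ C n m n1 n2 W sW); apply: (submodB C n m n1 n2 W sW).
    exact: submod_outer.
  exact: (submodZ C n m n1 n2 W sW).
move: (key (iota 0 M.+1)); congr W; apply/funext => mu; rewrite /F /outer_part.
have [->|nz] := eqVneq (f mu) 0; first by rewrite mulr0 if_same.
have oM : (outer mu < M.+1)%N by rewrite ltnS -lez_nat; exact: hM.
case: eqP => [->|/eqP oN].
  rewrite big1 ?mul1r // => j jN; rewrite divff // subr_eq0 eqr_nat eq_sym //.
by rewrite big_mkcond (bigD1_seq (outer mu)) ?iota_uniq ?mem_iota //= oN subrr !mul0r.
Qed.

Lemma Hk_submod k : is_submod (Hk k).
Proof.
split; first exact: Hk0.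
split; first by move=> f g hf hg; have := HkP C n m n1 n2 1 k f g hf hg; rewrite scale1r.
split; first by move=> c f; exact: HkZ.
by move=> T oT f; exact: Hk_osp.
Qed.

Lemma eta_iter_submod V d : is_submod V -> is_submod (eta_img d V).
Proof.
move=> sV; split; first by exists 0; rewrite (iter_linear0 _ _ _ eta); split=> //; case: sV.
split.
  move=> f g [f' [vf ->]] [g' [vg ->]]; exists (f' + g'); split; first exact: (submodD C n m n1 n2 V sV).
  by have := iter_linearP C n m eta d 1 f' g'; rewrite !scale1r.
split.
  move=> c f [f' [vf ->]]; exists (c *: f'); split; first exact: (submodZ C n m n1 n2 V sV).
  by have := iter_linearP C n m eta d c f' 0; rewrite (iter_linear0 _ _ _ eta) !addr0.
move=> T oT f [f' [vf ->]]; exists (T f'); split; first exact: (submod_osp C n m n1 n2 V sV).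
by elim: (d) => // e IH; rewrite !iterS -IH (osp_eta C n m n1 n2 n12 T) //.
Qed.

Lemma wt_ge_coord (cx cy : 'I_n -> int) (ct : int) (a b : {ffun 'I_n -> nat}) (S T : {set 'I_m}) i :
  (forall j, 0 <= cx j) -> (forall j, 0 <= cy j) -> 0 <= ct ->
  cx i * (a i)%:Z <= wt cx cy ct (a, b, S, T) /\ cy i * (b i)%:Z <= wt cx cy ct (a, b, S, T).
Proof.
move=> hx hy ht; rewrite /wt.
have px (c : 'I_n -> int) (e : {ffun 'I_n -> nat}) : (forall j, 0 <= c j) ->
    c i * (e i)%:Z <= \sum_j c j * (e j)%:Z /\ 0 <= \sum_j c j * (e j)%:Z.
  move=> hc; split; last by apply: sumr_ge0 => j _; exact: mulr_ge0.
  by rewrite (bigD1 i) //= lerDl; apply: sumr_ge0 => j _; exact: mulr_ge0.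
have [x1 x2] := px cx a hx; have [y1 y2] := px cy b hy.
have t0 : 0 <= ct * (#|S| + #|T|)%N%:Z by exact: mulr_ge0.
split; first by rewrite -addrA (le_trans x1) // lerDl addr_ge0.
by rewrite addrAC (le_trans y1) // lerDr addr_ge0.
Qed.

Lemma finite_degree k (N : nat) : exists s : seq (mon n m), uniq s /\
  forall mu, (mu \in s) = (deg mu == k) && (outer mu == N).
Proof.
(* Each exponent is at most the total degree, which is N + em = N + k + eu - ev and hence at most 2N
   + |k|. *)
pose B := (2 * N + `|k|).+1.
pose toN (x : {ffun 'I_n -> 'I_B}) : {ffun 'I_n -> nat} := [ffun i => x i : nat].
pose all_mon := [seq (toN p.1.1.1, toN p.1.1.2, p.1.2, p.2) |
  p <- enum {: {ffun 'I_n -> 'I_B} * {ffun 'I_n -> 'I_B} * {set 'I_m} * {set 'I_m}}].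
exists (undup [seq mu <- all_mon | (deg mu == k) && (outer mu == N)]).
split; first exact: undup_uniq.
move=> mu; rewrite mem_undup mem_filter; case: (boolP ((deg mu == k) && (outer mu == N))) => //= /andP[/eqP dk /eqP oN].
case: mu dk oN => [[[a b] S] T] dk oN.
have bnd i : (a i < B)%N /\ (b i < B)%N.
  have ds := deg_split n m n1 n2 n12 n2n (a, b, S, T); rewrite dk in ds.
  have oE := outerE (a, b, S, T); rewrite oN in oE.
  have := ev_ge0 n m n1 n2 (a, b, S, T); have := eu_ge0 n m n1 n2 (a, b, S, T).
  have tot : wt (fun=> 1) (fun=> 1) 1 (a, b, S, T) =
      eu (a, b, S, T) + ev (a, b, S, T) + em (a, b, S, T).
    rewrite -!wtD; apply: wt_eq => j; rewrite /mid;
      by case: (ltnP j n1) => h1; case: (leqP n2 j) => h2 //=; exfalso; lia.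
  have [||| xa xb] := wt_ge_coord (fun=> 1) (fun=> 1) 1 a b S T i => //.
  rewrite !mul1r tot in xa xb; rewrite /B; lia.
apply/mapP; exists ([ffun i => Ordinal (proj1 (bnd i))], [ffun i => Ordinal (proj2 (bnd i))], S, T).
  by rewrite mem_enum.
by congr (_, _, _, _); apply/ffunP => i; rewrite /= !ffunE.
Qed.

Variables (i0 r0 : 'I_n) (s0 : 'I_m).
Hypotheses (i0E : i0 = 0%N :> nat) (n1_gt0 : (0 < n1)%N) (r0E : r0 = n1 :> nat) (n1n2 : (n1 < n2)%N).
Local Notation vk := (vk n m i0 r0).

Lemma r0_mid : mid r0. Proof. by rewrite /mid r0E leqnn. Qed.

Lemma Ak_delta mu : Ak (deg mu) (delta mu).
Proof.
split=> [|nu]; last by rewrite /delta; have [->//|_] := eqVneq nu mu; rewrite eqxx.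
by exists [:: mu] => nu; rewrite inE /delta => /negbTE->.
Qed.

Lemma deg_vk k : deg (vk k) = k.
Proof.
rewrite degE // /vk /vac /wt !cards0 mulr0 addr0.
rewrite [X in _ + X]big1 ?addr0; last by move=> i _; rewrite ffunE mulr0.
set j := if _ then _ else _; rewrite (bigD1 j) //= big1 ?addr0; last first.
  by move=> i /negbTE ij; rewrite ffunE ij mulr0.
rewrite ffunE eqxx /j /dgx; case: (ltrP 0 k) => k0.
  by rewrite r0E leqnn mul1r; lia.
by rewrite i0E leqNgt n1_gt0 /=; lia.
Qed.

Lemma dx_delta0 i (a b : {ffun 'I_n -> nat}) (S T : {set 'I_m}) : a i = 0%N -> dx i (delta (a, b, S, T)) = 0.
Proof.
move=> ai; apply/funext => -[[[a' b'] S'] T'].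
rewrite /Defs.dx /delta; case: eqP => [[E _ _ _]|_]; last by rewrite mulr0.
by move: ai; rewrite -E incrE eqxx addn1.
Qed.
Lemma dy_delta0 i (a b : {ffun 'I_n -> nat}) (S T : {set 'I_m}) : b i = 0%N -> dy i (delta (a, b, S, T)) = 0.
Proof.
move=> ai; apply/funext => -[[[a' b'] S'] T'].
rewrite /Defs.dy /delta; case: eqP => [[_ E _ _]|_]; last by rewrite mulr0.
by move: ai; rewrite -E incrE eqxx addn1.
Qed.
Lemma dvt_delta0 r a b (S : {set 'I_m}) : dvt r (delta (a, b, S, set0)) = 0.
Proof.
apply/funext => -[[[a' b'] S'] T'].
rewrite /Defs.dvt /delta; case: ifP => // _; case: eqP => [[_ _ _ E]|_]; last by rewrite mulr0.
by have := setU11 r T'; rewrite E inE.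
Qed.

Lemma Hk_vk k : Hk k (delta (vk k)).
Proof.
apply/HkE; split; first by rewrite -{1}(deg_vk k); exact: Ak_delta.
rewrite Delta_sums /vk /vac !big1 ?oppr0 ?addr0 // => [r _|i hi|i hi|i hi].
- by rewrite dvt_delta0 linear0.
- rewrite dx_delta0 ?linear0 // ffunE; case: eqP => // ij; move: hi; rewrite ij.
  by case: ifP => _; rewrite ?i0E ?r0E; lia.
- by rewrite dy_delta0 ?linear0 // ffunE.
- by rewrite dy_delta0 ?linear0 // ffunE.
Qed.

Lemma delta_neq0 mu : delta mu <> 0.
Proof.
move=> /(congr1 (fun F : fn C n m => F mu)); rewrite /delta eqxx fn0 => /eqP.
by rewrite oner_eq0.
Qed.

Lemma fn_neq0 f : f <> 0 <-> exists mu, f mu != 0.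
Proof.
split=> [nz|[mu /eqP nz E]]; last by apply: nz; rewrite E.
case: (pselect (exists mu, f mu != 0)) => // no; case: nz; apply/funext => mu.
by apply/eqP; apply: contraT => fmu; case: no; exists mu.
Qed.

Section Proper.
Variables (k : int) (W : fn C n m -> Prop).
Hypotheses (kc : k + kappa <= 1) (sW : is_submod W) (WH : forall f, W f -> Hk k f).
Hypothesis nW : exists2 f, W f & f <> 0.

Definition Weta f := exists w a, [/\ W w, Ak (k - 2) a & f = w + eta a].
Definition Wperp f := Ak k f /\ forall g, Weta g -> pair f g = 0.

Lemma Weta_submod : is_submod Weta.
Proof.
split; first by exists 0, 0; split; [exact: (submod0 C n m n1 n2 W sW)|exact: Ak0|rewrite linear0 addr0].
split.
  move=> f g [w [a [ww aa ->]]] [w' [a' [ww' aa' ->]]]; exists (w + w'), (a + a').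
  split; [exact: (submodD C n m n1 n2 W sW)|exact: AkD|].
  by rewrite faddE linearD /= addrACA.
split.
  move=> c f [w [a [ww aa ->]]]; exists (c *: w), (c *: a).
  split; [exact: (submodZ C n m n1 n2 W sW)|exact: AkZ|].
  by rewrite fscaleE linearZ /= scalerDr.
move=> T oT f [w [a [ww aa ->]]]; exists (T w), (T a).
split; [exact: (submod_osp C n m n1 n2 W sW)|exact: Ak_osp|].
have := osp_linear C n m n1 n2 T 1 w (eta a) oT.
by rewrite !scale1r (osp_eta C n m n1 n2 n12 T) //.
Qed.

Lemma Weta_Ak f : Weta f -> Ak k f.
Proof.
move=> [w [a [/WH[ww _] aa ->]]]; apply: AkD => //.
by rewrite -(subrK 2 k); exact: Ak_eta.
Qed.

Lemma Wperp_submod : is_submod Wperp.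
Proof.
have Wp g : Weta g -> is_poly g by move=> /Weta_Ak[].
split; first by split=> [|g _]; [exact: Ak0|exact: pair0].
split.
  move=> f g [af pf] [ag pg]; split; first exact: AkD.
  by move=> h hh; rewrite faddE pairD ?pf ?pg ?addr0 //; exact: Wp.
split.
  move=> c f [af pf]; split; first exact: AkZ.
  by move=> h hh; rewrite fscaleE pairZ ?pf ?mulr0 //; exact: Wp.
move=> T oT f [af pf]; split; first exact: Ak_osp.
move=> g hg; have [T' [oT' [e E]]] := osp_adjoint C n m n1 n2 T oT.
rewrite E ?pf ?mulr0 //; [|by case: af|exact: Wp].
exact: (submod_osp C n m n1 n2 _ Weta_submod).
Qed.

(** Pairing [f] with eta of a monomial reads off, up to a non-zero weight, one coefficient of Delta
    f; this is why eta A_<k-2> is added to [W]. *)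
Lemma Wperp_Hk f : Wperp f -> Hk k f.
Proof.
move=> [af pf]; apply/HkE; split=> //; apply/funext => nu; apply/eqP; apply: contraT => nz.
have dn := proj2 (Ak_Delta C n m n1 n2 n12 k f af) nu nz.
have pd : is_poly (delta nu) by case: (Ak_delta nu).
have : pair f (eta (delta nu)) = 0.
  apply: pf; exists 0, (delta nu); split; last by rewrite add0r.
    exact: (submod0 C n m n1 n2 W sW).
  by rewrite -dn; exact: Ak_delta.
rewrite pair_eta //; last by case: af.
by rewrite pair_delta => /eqP; rewrite mulf_eq0 (negbTE (wgt_neq0 _ _ _ _ _ _)) (negbTE nz).
Qed.

Lemma submod_full h : Hk k h -> W h.
Proof.
move=> hh; case: (pselect (W h)) => // nWh.
(* If h = w + eta a, then eta a is harmonic and so zero by [harmonic_eta0]: enlarging [W] does not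
   swallow [h]. *)
have nS : ~ Weta h.
  move=> [w [a [ww aa hE]]]; apply: nWh.
  have dw := proj1 (HkE _ _ _ _ _ _ _) (WH w ww); have dh := proj1 (HkE _ _ _ _ _ _ _) hh.
  have e0 : eta a = 0.
    apply: (harmonic_eta0 C n m n1 n2 n12 n2n k) => //.
    have -> : eta a = h - w by rewrite hE addrAC subrr add0r.
    by rewrite linearB /= (proj2 dw) (proj2 dh) subr0.
  by rewrite hE e0 addr0.
have ah : Ak k h by case: hh.
have [M hM] := poly_bound C n m n1 n2 n12 n2n (fun mu => (outer mu)%:Z) h (proj1 ah).
(* If all components of [h] were in [Weta], so would be their sum; hence a single finite-dimensional
   level already separates [h] from [Weta]. *)
have [N nN] : exists N, ~ Weta (outer_part N h).
  case: (pselect (exists N, ~ Weta (outer_part N h))) => // no; case: nS.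
  have -> : h = \sum_(N < M.+1) outer_part N h.
    apply/funext => mu; rewrite fn_sum /outer_part.
    have [->|nz] := eqVneq (h mu) 0; first by rewrite big1 // => N _; rewrite if_same.
    have oM : (outer mu < M.+1)%N by rewrite ltnS -lez_nat; exact: hM.
    rewrite (bigD1 (Ordinal oM)) //= eqxx big1 ?addr0 // => N nM.
    by rewrite ifF //; apply: contraNF nM => /eqP E; apply/eqP/val_inj.
  apply: (submod_sum C n m n1 n2 _ Weta_submod) => N _.
  by case: (pselect (Weta (outer_part N h))) => // nn; case: no; exists N.
have [s [us hs]] := finite_degree k N.
pose P f := Weta f /\ forall mu, mu \notin s -> f mu = 0.
have partP f : Ak k f -> forall mu, mu \notin s -> outer_part N f mu = 0.
  move=> [_ dk] mu; rewrite hs /outer_part; have [oN|_] := eqVneq (outer mu) N; last by [].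
  by rewrite andbT => dn; apply/eqP; apply: contraT => /dk E; rewrite E eqxx in dn.
have [|||allP|[c [c0 cs cP]]] := exists_annihilator C n m s P us.
- by split=> //; exact: (submod0 C n m n1 n2 _ Weta_submod).
- move=> c f g [Wf f0] [Wg g0]; split.
    by apply: (submodD C n m n1 n2 _ Weta_submod) => //; exact: (submodZ C n m n1 n2 _ Weta_submod).
  by move=> mu ms; rewrite fnD fnZ f0 // g0 // mulr0 addr0.
- by move=> f [].
- by case: nN; case: (allP (outer_part N h)) => //; exact: partP.
(* Dividing by the weights turns the coordinate functional [c] into the pairing with [c']. *)
pose c' : fn C n m := fun mu => (wgt C n m n1 n2 mu)^-1 * c mu.
have c'perp : Wperp c'.
  split.
    split; first by exists s => mu /cs; rewrite /c' => ->; rewrite mulr0.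
    move=> mu; rewrite /c' mulf_eq0 negb_or => /andP[_ cmu].
    have : mu \in s by apply: contraT => /cs E; rewrite E eqxx in cmu.
    by rewrite hs => /andP[/eqP].
  (* Only the level-N component of [g] meets the support of [c'], and interpolation keeps that
     component inside [Weta]. *)
  move=> g Wg; have ag := Weta_Ak g Wg.
  have Pg : P (outer_part N g).
    split; last exact: partP.
    by apply: submod_outer_part => //; [exact: Weta_submod|case: ag].
  rewrite -[RHS](cP _ Pg) /pair (totalE _ _ _ _ s) //.
    apply: eq_big_seq => mu; rewrite hs => /andP[_ /eqP oN].
    by rewrite /pairf /c' /outer_part oN eqxx mulrA mulVKf ?wgt_neq0.
  by move=> mu /cs E; rewrite /pairf /c' E mulr0 mul0r mulr0.
have c'0 : c' <> 0.
  apply/fn_neq0; have /fn_neq0 [mu nz] := c0; exists mu.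
  by rewrite /c' mulf_neq0 // invr_eq0 wgt_neq0.
(* The same monomial lies in [W] and in the orthogonal, yet its pairing with itself is its weight,
   which is non-zero. *)
have v1 := submod_vac C n m n1 n2 n12 n2n i0 r0 s0 i0E n1_gt0 r0E n1n2 k W kc sW WH nW.
have [av pv] := submod_vac C n m n1 n2 n12 n2n i0 r0 s0 i0E n1_gt0 r0E n1n2 k Wperp kc Wperp_submod
  Wperp_Hk (ex_intro2 _ _ c' c'perp c'0).
have Wv : Weta (delta (vk k)).
  by exists (delta (vk k)), 0; split; [|exact: Ak0|rewrite linear0 addr0].
have /eqP := pv _ Wv; rewrite pair_delta mulf_eq0 (negbTE (wgt_neq0 _ _ _ _ _ _)).
by rewrite /delta eqxx oner_eq0.
Qed.
End Proper.

Lemma Hk_irreducible k : k + kappa <= 1 -> irreducible (Hk k).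
Proof.
move=> kc; split; first exact: Hk_submod.
split; first by exists (delta (vk k)); split; [exact: Hk_vk|apply/fn_neq0; exact: delta_neq0].
move=> W sW WH; case: (pselect (exists2 f, W f & f <> 0)) => [nW|no].
  by right=> f; exact: submod_full.
left=> f wf mu; apply/eqP; apply: contraT => nz; case: no; exists f => //.
by apply/fn_neq0; exists mu.
Qed.

(** Among the terms of eta only the product of x_(n1+1) and y_(n1+1) raises the exponent of
    x_(n1+1). Where this exponent is maximal in [f], the coefficient therefore passes to eta f
    unchanged. Hence eta is injective, and eta f always has a monomial divisible by y_(n1+1), unlike
    [vk k]. *)
Lemma eta_leading f : is_poly f -> f <> 0 -> exists a b S T,
  f (a, b, S, T) != 0 /\ eta f (incr n a r0, incr n b r0, S, T) = f (a, b, S, T).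
Proof.
move=> pf /fn_neq0 [mu0 nz0].
pose e mu : nat := let: (a, _, _, _) := mu in a r0.
have [M hM] := poly_bound C n m n1 n2 n12 n2n (fun mu => (e mu)%:Z) f pf.
have exP : exists N, `[< exists mu, f mu != 0 /\ e mu = N >].
  by exists (e mu0); apply/asboolP; exists mu0.
have bP N : `[< exists mu, f mu != 0 /\ e mu = N >] -> (N <= M)%N.
  by move=> /asboolP [mu [/hM + <-]]; rewrite lez_nat.
case: (ex_maxnP exP bP) => N /asboolP [[[[a b] S] T] [nz eN]] maxN.
exists a, b, S, T; split=> //.
have hz (a1 b1 : {ffun 'I_n -> nat}) (S1 T1 : {set 'I_m}) : a1 r0 = (a r0).+1 -> f (a1, b1, S1, T1) = 0.
  move=> a1E; apply/eqP; apply: contraT => nz1.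
  have := maxN (e (a1, b1, S1, T1)); rewrite -eN /= a1E ltnn; apply.
  by apply/asboolP; exists (a1, b1, S1, T1).
have rm := r0_mid; rewrite eta_sums !(fnD, fn_sum).
rewrite big1 => [|i hi]; last first.
  rewrite /Defs.muly /Defs.dx; case: ifP => // _; rewrite hz ?mulr0 // !incrE eqxx.
  by case: eqP => [E|_]; [move: hi; rewrite -E r0E ltnn|rewrite addn0 addn1].
rewrite add0r [X in _ + X]big1 ?addr0 => [|r _]; last first.
  rewrite /Defs.multh /Defs.mulvt; case: ifP => // _; case: ifP => _; rewrite ?mulr0 //.
  by rewrite hz ?mulr0 // incrE eqxx addn1.
rewrite [X in _ + X]big1 ?addr0 => [|i hi]; last first.
  rewrite /Defs.mulx /Defs.dy; case: ifP => // _; rewrite hz ?mulr0 // decrE incrE eqxx.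
  by case: eqP => [E|_]; [move: hi; rewrite -E r0E leqNgt n1n2|rewrite subn0 addn1].
rewrite (bigD1 r0) //= big1 ?addr0 => [|i /andP[hi ir]].
  by rewrite /Defs.mulx /Defs.muly !incrE eqxx !addn1 /= !incrK.
rewrite /Defs.mulx /Defs.muly; case: ifP => // _; case: ifP => // _.
by rewrite hz // decrE incrE eqxx eq_sym (negbTE ir) subn0 addn1.
Qed.

Lemma eta_inj f : is_poly f -> eta f = 0 -> f = 0.
Proof.
move=> pf e0; case: (pselect (f = 0)) => // /(eta_leading f pf) [a [b [S [T [nz]]]]].
by rewrite e0 fn0 => E; rewrite -E eqxx in nz.
Qed.
Lemma iter_eta_inj d l f : Ak l f -> iter d eta f = 0 -> f = 0.
Proof.
move=> af; elim: d => //= d IH E; apply: IH; apply: eta_inj E.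
by case: (Ak_iter_eta C n m n1 n2 n12 n2n d l f af).
Qed.

Lemma vk_notin_eta k f : is_poly f -> eta f <> delta (vk k).
Proof.
move=> pf E; have f0 : f <> 0 by move=> f0; apply: (delta_neq0 (vk k)); rewrite -E f0 linear0.
have [a [b [S [T [nz]]]]] := eta_leading f pf f0.
rewrite E /delta; case: eqP => [[_ /ffunP /(_ r0)]|_ H]; last by rewrite -H eqxx in nz.
by rewrite incrE ffunE eqxx addn1.
Qed.

Lemma Hk_reducible k : irreducible (Hk k) -> k + kappa <= 1.
Proof.
move=> [_ [_ irr]]; rewrite leNgt; apply/negP => kc.
(* The exponent at which the factor l + kappa + d - 1 with l = k - 2d vanishes, so that Delta kills
   eta^d of H_<l>; it is positive precisely when the bound fails. *)
pose d := `|(k + kappa - 1)%R|%N.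
have dE : d%:Z = k + kappa - 1 by rewrite /d; lia.
have [d' d'E] : exists d', d = d'.+1 by exists d.-1; lia.
pose l := k - (2 * d)%N%:Z.
have sub f : eta_img d (Hk l) f -> Hk k f.
  move=> [h [hh ->]]; have [ah _] := hh; apply/HkE; split.
    by rewrite -[k](subrK (2 * d)%N%:Z); exact: Ak_iter_eta.
  rewrite d'E (Delta_iter_eta C n m n1 n2 n12 n2n l) //.
  by rewrite (_ : l + kappa + d'%:Z = 0) ?mulr0 ?scale0r // /l; lia.
have := irr (eta_img d (Hk l)) (eta_iter_submod _ d (Hk_submod l)) sub.
case=> [all0|full].
  have : eta_img d (Hk l) (iter d eta (delta (vk l))) by exists (delta (vk l)); split=> //; exact: Hk_vk.
  move=> /all0 /funext E; apply: (delta_neq0 (vk l)).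
  by apply: (iter_eta_inj d l) => //; case: (Hk_vk l).
have [h [hh]] := full _ (Hk_vk k); rewrite d'E iterS => /esym.
apply: vk_notin_eta; have [ah _] := hh.
by case: (Ak_iter_eta C n m n1 n2 n12 n2n d' l h ah).
Qed.

(** eta^d is injective and commutes with osp, so a submodule of the image pulls back to a submodule
    of H_<l>. *)
Lemma eta_img_irreducible d l : irreducible (Hk l) -> irreducible (eta_img d (Hk l)).
Proof.
move=> [sH [[f0 [hf0 nz]] irr]]; split; first exact: eta_iter_submod.
split.
  exists (iter d eta f0); split; first by exists f0.
  apply/fn_neq0 => E; move/fn_neq0: nz; apply.
  by apply: (iter_eta_inj d l) E; case: hf0.
move=> W sW WV; pose W0 f := Hk l f /\ W (iter d eta f).
have sW0 : is_submod W0.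
  split; first by split; [exact: Hk0|rewrite fzeroE (iter_linear0 _ _ _ eta); exact: (submod0 C n m n1 n2 W sW)].
  split.
    move=> f g [hf wf] [hg wg]; split; first exact: (submodD C n m n1 n2 _ sH).
    have := iter_linearP C n m eta d 1 f g; rewrite !scale1r faddE => ->.
    exact: (submodD C n m n1 n2 W sW).
  split.
    move=> c f [hf wf]; split; first exact: HkZ.
    have := iter_linearP C n m eta d c f 0; rewrite (iter_linear0 _ _ _ eta) !addr0 fscaleE => ->.
    exact: (submodZ C n m n1 n2 W sW).
  move=> T oT f [hf wf]; split; first exact: Hk_osp.
  have -> : iter d eta (T f) = T (iter d eta f) by elim: (d) => // e IH; rewrite !iterS IH (osp_eta C n m n1 n2 n12 T) //.
  exact: (submod_osp C n m n1 n2 W sW).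
case: (irr W0 sW0 (fun f => @proj1 _ _)) => [W00|W0H].
  left=> g wg mu; have [f [hf gE]] := WV g wg.
  have f0' : f = 0 by apply/funext => nu; apply: W00; split=> //; rewrite -gE.
  by rewrite gE f0' (iter_linear0 _ _ _ eta).
by right=> g [f [hf ->]]; case: (W0H f hf).
Qed.

End Irreducibility.

Theorem theorem4p2 (C : numClosedFieldType) (n m n1 n2 : nat)
  (hm : (1 <= m)%N) (hn1 : (1 <= n1)%N) (hn12 : (n1.+1 < n2)%N) (hn2 : (n2 <= n)%N)
  (k : int) :
  (irreducible C n m n1 n2 (Hk C n m n1 n2 k) <->
     k <= n1%:Z + m%:Z + 1 - n2%:Z) /\
  (k <= n1%:Z + m%:Z + 1 - n2%:Z ->
     (* each eta^i(H_<k-2i>) is an irreducible submodule of A_<k> *)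
     (forall i : nat,
        irreducible C n m n1 n2 (eta_img C n m n1 n2 i (Hk C n m n1 n2 (k - (2 * i)%N%:Z)))) /\
     (forall (i : nat) (g : fn C n m),
        eta_img C n m n1 n2 i (Hk C n m n1 n2 (k - (2 * i)%N%:Z)) g ->
        Ak C n m n1 n2 k g) /\
     (* A_<k> is the sum of the eta^i(H_<k-2i>) ... *)
     (forall f : fn C n m, Ak C n m n1 n2 k f ->
        exists (N : nat) (g : nat -> fn C n m),
          (forall i : nat,
             eta_img C n m n1 n2 i (Hk C n m n1 n2 (k - (2 * i)%N%:Z)) (g i)) /\
          forall mu, f mu = \sum_(i < N) g i mu) /\
     (* ... and the sum is direct *)
     (forall (N : nat) (g : nat -> fn C n m),
        (forall i : nat, (i < N)%N ->
           eta_img C n m n1 n2 i (Hk C n m n1 n2 (k - (2 * i)%N%:Z)) (g i)) ->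
        (forall mu, \sum_(i < N) g i mu = 0) ->
        forall i : nat, (i < N)%N -> forall mu, g i mu = 0)).
Proof.
have n12 : (n1 <= n2)%N by lia.
have n1n2 : (n1 < n2)%N by lia.
have n0 : (0 < n)%N by lia.
have n1n : (n1 < n)%N by lia.
pose i0 := Ordinal n0; pose r0 := Ordinal n1n; pose s0 := Ordinal hm.
have irr l : l + kappa m n1 n2 <= 1 -> irreducible C n m n1 n2 (Hk C n m n1 n2 l).
  exact: (Hk_irreducible C n m n1 n2 n12 hn2 i0 r0 s0).
have bound : (k <= n1%:Z + m%:Z + 1 - n2%:Z) = (k + kappa m n1 n2 <= 1).
  by rewrite /kappa; lia.
rewrite bound; split.
  split; last exact: irr.
  exact: (Hk_reducible C n m n1 n2 n12 hn2 i0 r0).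
move=> kc; split.
  move=> i; apply: (eta_img_irreducible C n m n1 n2 n12 hn2 r0) => //.
  by apply: irr; lia.
split.
  move=> i g [f [[af _] ->]]; rewrite -[k](subrK (2 * i)%N%:Z).
  exact: Ak_iter_eta.
split.
  move=> f af; have [N [g [gH fE]]] := decomp_exists C n m n1 n2 n12 hn2 k f kc af.
  exists N, (fun i => iter i (Defs.eta C n m n1 n2) (g i)); split=> [i|mu].
    by exists (g i).
  by rewrite {1}fE fn_sum.
move=> N g gH s0'.
(* Harmonic preimages are given for i < N only; the other indices take the default 0 so that choice
   yields a total function. *)
have /choice [h hh] : forall i, exists h, (i < N)%N ->
    Hk C n m n1 n2 (k - (2 * i)%N%:Z) h /\ g i = iter i (Defs.eta C n m n1 n2) h.
  move=> i; case: (boolP (i < N)%N) => [iN|_]; last by exists 0.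
  by have [h [hH gE]] := gH i iN; exists h.
have sum0 : \sum_(i < N) iter i (Defs.eta C n m n1 n2) (h i) = 0.
  apply/funext => mu; rewrite fn_sum -[RHS](s0' mu); apply: eq_bigr => i _.
  by rewrite (proj2 (hh i (ltn_ord i))).
move=> i iN mu; rewrite (proj2 (hh i iN)).
rewrite (decomp_direct C n m n1 n2 n12 hn2 k N h kc _ sum0 i iN).
  by rewrite iter_linear0.
by move=> j jN; exact: (proj1 (hh j jN)).
Qed.
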